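(* Let $\sigma'>0$ on $\mathbb{R}$, let $\{f_I^{(j)}\}_{j=1,\dots,N}$ be weakly linearly independent and let $h(\xi)=\xi$ for all $\xi\in\mathbb{R}$. Then $(a_\infty,b_\infty,w_\infty,\mu_\infty)\in L^2(Y\times(0,T))\times L^2(Y\times Y\times(0,T))\times L^2(U\times Y)\times L^2(U)$ is a critical point of the functional $J$ if and only if the following three conditions hold, where $f^{(j)}$ denotes the solution of the forward problem with controls $(a_\infty,b_\infty)$ and initial datum $f^{(j)}_I$: 1. for $j=1,\dots,N$ the terminal state $f^{(j)}(\cdot,T)$ is a least-squares solution of ''$W_\infty f^{(j)}(\cdot,T)=P^{(j)}-\mu_\infty$'', i.e. $W_\infty^*W_\infty f^{(j)}(\cdot,T)=W_\infty^*(P^{(j)}-\mu_\infty)$, where $(W_\infty\varphi)(u)=\int_Y w_\infty(u,y)\varphi(y)\,dy$; 2. $w_\infty(u,y)=\sum_{k=1}^K w_{\infty,k}(u)\sigma_k(y)+h_{w_\infty}(u,y)$, where $\{\sigma_1,\dots,\sigma_K\}\subset L^2(Y)$ is an orthonormal basis of $\mathrm{span}\{f^{(1)}(\cdot,T),\dots,f^{(N)}(\cdot,T)\}$ ($K$ being its dimension), $h_{w_\infty}(u,\cdot)\in\mathrm{span}\{\sigma_1,\dots,\sigma_K\}^\perp$ for a.e. $u\in U$, and $(w_{\infty,1},\dots,w_{\infty,K})\in L^2(U)^K$ is a solution of $$A^{\mathrm{tr}}A\,(w_{\infty,1}(u),\dots,w_{\infty,K}(u))^{\mathrm{tr}}=A^{\mathrm{tr}}P(u)\quad\text{for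 a.e. }u\in U;$$ 3. $\displaystyle \mu_\infty(u)=\frac1{\sqrt N}\Big(P(u)\cdot\tilde e-\tilde e^{\mathrm{tr}}\,\Omega\,(w_{\infty,1}(u),\dots,w_{\infty,K}(u))^{\mathrm{tr}}\Big)$ for a.e. $u\in U$. Here $P(u)=(P^{(1)}(u),\dots,P^{(N)}(u))^{\mathrm{tr}}$, $\tilde e=N^{-1/2}(1,\dots,1)^{\mathrm{tr}}\in\mathbb{R}^N$, $\Omega\in\mathbb{R}^{N\times K}$ with $\Omega_{ik}=\int_Y f^{(i)}(y,T)\sigma_k(y)\,dy$, and $A=(I-\tilde e\otimes\tilde e)\,\Omega$.
   Context: Setting: $Y\subseteq\mathbb{R}^d$ and $U\subseteq\mathbb{R}^l$ are bounded open sets with Lebesgue measure, $0<T<\infty$, $N\in\mathbb{N}$; the activation $\sigma:\mathbb{R}\to\mathbb{R}$ is continuously differentiable and uniformly Lipschitz; training data $(f_I^{(j)},P^{(j)})\in L^2(Y)\times L^2(U)$, $j=1,\dots,N$, are given with $f_I^{(i)}\neq f_I^{(j)}$ for $i\ne j$. For controls $(a,b)$ the forward problem is: $f^{(j)}=f^{(j)}_{a,b}\in C([0,T];L^2(Y))$ is the unique (integral) solution of $$\partial_t f^{(j)}(y,t)=\sigma\Big(a(y,t)-\int_Y b(y,z,t)f^{(j)}(z,t)\,dz\Big),\qquad f^{(j)}(y,0)=f_I^{(j)}(y).$$ The loss functional is $$J(a,b,w,\mu)=\frac1{2N}\sum_{j=1}^N\int_U\big|h(Z^{(j)}(u))-P^{(j)}(u)\big|^2du,\qquad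 Z^{(j)}(u)=\int_Y w(u,y)f^{(j)}(y,T)\,dy+\mu(u).$$ A critical point is a point of $L^2(Y\times(0,T))\times L^2(Y\times Y\times(0,T))\times L^2(U\times Y)\times L^2(U)$ at which the Gateaux derivative of $J$ (with respect to all four variables) vanishes. Functions $\varphi_1,\dots,\varphi_N$ on a domain are weakly linearly independent if $\sum_{j}\lambda_j\varphi_j=0$ (a.e.) together with $\sum_j\lambda_j=0$ ($\lambda_j\in\mathbb{R}$) implies $\lambda_1=\dots=\lambda_N=0$. *)

(* Defs.v *)
From HB Require Import structures.
From mathcomp Require Import all_boot all_order all_algebra.
From mathcomp Require Import all_classical all_reals all_analysis.

Set Implicit Arguments.
Unset Strict Implicit.
Unset Printing Implicit Defensive.

Import Order.TTheory GRing.Theory Num.Theory.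
Import numFieldNormedType.Exports.

Local Open Scope classical_set_scope.
Local Open Scope ring_scope.

(* R^n as a measurable space, with the product of the Borel sigma-algebras. *)
Notation Rn R n := (n.-tuple (measurableTypeR R)).

Section tuple_lebesgue.
Context {R : realType}.

Definition tuple_cons n (p : measurableTypeR R * Rn R n) : Rn R n.+1 :=
  [tuple of p.1 :: p.2].

Lemma measurable_tuple_cons n : measurable_fun [set: _] (@tuple_cons n).
Proof. exact: (measurable_cons measurable_fst measurable_snd). Qed.

Section cons.
Context (n : nat) (m : {sigma_finite_measure set (Rn R n) -> \bar R}).

Definition lebesgue_cons : set (Rn R n.+1) -> \bar R :=
  pushforward (@lebesgue_measure R \x m)%E (@tuple_cons n).

Let lebesgue_cons0 : lebesgue_cons set0 = 0%E.
Proof. by rewrite /lebesgue_cons /pushforward preimage_set0 measure0. Qed.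

Let lebesgue_cons_ge0 A : (0 <= lebesgue_cons A)%E.
Proof. by rewrite /lebesgue_cons /pushforward measure_ge0. Qed.

Let lebesgue_cons_sigma_additive : semi_sigma_additive lebesgue_cons.
Proof.
exact: (@measure_semi_sigma_additive _ _ _
  (measure_function_pushforward__canonical__measure_function_Measure
    (@lebesgue_measure R \x m)%E (@measurable_tuple_cons n))).
Qed.

HB.instance Definition _ := isMeasure.Build _ _ _ lebesgue_cons
  lebesgue_cons0 lebesgue_cons_ge0 lebesgue_cons_sigma_additive.

(* The library's own sigma-finite instance for product measures is shadowed by
   the one for subprobabilities, hence the direct proof. *)
Let lebesgue_cons_sigma_finite : sigma_finite setT lebesgue_cons.
Proof.
have /sigma_finiteP[F [FT ndF Foo]] := sigma_finiteT (@lebesgue_measure R).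
have /sigma_finiteP[G [GT ndG Goo]] := sigma_finiteT m.
pose g (x : Rn R n.+1) : measurableTypeR R * Rn R n :=
  (thead x, [tuple of behead x]).
have mg : measurable_fun setT g.
  by apply/measurable_fun_pair => /=;
    [exact: measurable_tnth|exact: measurable_behead].
have gK p : g (tuple_cons p) = p.
  by case: p => x t; rewrite /g /tuple_cons theadE; congr pair; exact/val_inj.
have FGT : \bigcup_k (F k `*` G k) = setT.
  rewrite -setXTT FT GT predeqE => -[x y]; split.
    by move=> [k _ []/= ? ?]; split; exists k.
  move=> [/= [i _ Fx] [j _ Gy]]; exists (maxn i j) => //; split.
  - by move: x Fx; exact/subsetPset/ndF/leq_maxl.
  - by move: y Gy; exact/subsetPset/ndG/leq_maxr.
exists (fun k => g @^-1` (F k `*` G k)).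
  by rewrite -preimage_bigcup FGT preimage_setT.
move=> k; have [mF Fk] := Foo k; have [mG Gk] := Goo k; split.
  by rewrite -[X in measurable X]setTI; apply: mg => //; exact: measurableX.
rewrite /lebesgue_cons /pushforward.
have -> : @tuple_cons n @^-1` (g @^-1` (F k `*` G k)) = F k `*` G k.
  by apply/funext => p; rewrite /preimage /mkset gK.
by rewrite product_measure1E// lte_mul_pinfty// ge0_fin_numE.
Qed.

HB.instance Definition _ := Measure_isSigmaFinite.Build _ _ _ lebesgue_cons
  lebesgue_cons_sigma_finite.

End cons.

(* n-dimensional Lebesgue measure: the iterated product of the measure on the
   line, transported along R * R^n = R^(n+1); a unit mass when n = 0. *)
Fixpoint tuple_lebesgue n : {sigma_finite_measure set (Rn R n) -> \bar R} :=
  match n return {sigma_finite_measure set (Rn R n) -> \bar R} with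
  | 0%N => \d_ [tuple]
  | n'.+1 => lebesgue_cons (tuple_lebesgue n')
  end.

Lemma measurable_box n (a b : 'I_n -> R) :
  measurable [set x : Rn R n | forall i, tnth x i \in `[a i, b i]].
Proof.
rewrite (_ : mkset _ =
    \bigcap_(i in [set: 'I_n]) [set x | tnth x i \in `[a i, b i]]).
  apply: fin_bigcap_measurable => // i _.
  rewrite -[X in measurable X]setTI.
  exact: (measurable_tnth i measurableT (measurable_itv `[a i, b i])).
by apply/seteqP; split=> [x h i _|x h i]; exact: h.
Qed.

Lemma tuple_lebesgue_box n (a b : 'I_n -> R) : (forall i, a i <= b i) ->
  tuple_lebesgue n [set x | forall i, tnth x i \in `[a i, b i]] =
  (\prod_(i < n) (b i - a i))%:E.
Proof.
elim: n a b => [|n ih] a b ab.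
  by rewrite big_ord0/= diracE mem_set// => -[].
rewrite big_ord_recl /= /lebesgue_cons /pushforward.
rewrite (_ : _ @^-1` _ = `[a ord0, b ord0]%classic `*`
  [set x : Rn R n | forall i, tnth x i \in `[a (lift ord0 i), b (lift ord0 i)]]).
  rewrite product_measure1E//=; last exact: measurable_box.
  rewrite ih; last by move=> i; exact: ab.
  rewrite lebesgue_measure_itv/= lte_fin lt_neqAle ab andbT.
  by case: eqVneq => [->|_]; rewrite ?subrr ?mul0r ?mul0e ?EFinM.
apply/seteqP; split=> -[x t] /=.
  move=> h; split; first exact: (h ord0).
  by move=> i; have := h (lift ord0 i); rewrite tnthS.
move=> [h0 h] i; case: (unliftP ord0 i) => [j|] -> //.
by rewrite tnthS; exact: h.
Qed.

End tuple_lebesgue.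

Section L2.
Context {dX} {X : measurableType dX} {R : realType}.
Variables (mu : {measure set X -> \bar R}) (D : set X).
Implicit Types f g : X -> R.

(* L^2(D, mu) at the level of representatives: only the values on D matter,
   and f \_ D extends f by 0 outside D. *)
Definition L2 : set (X -> R) := [set f | f \_ D \in Lfun mu 2%:E].

Definition L2norm f : R := fine 'N[mu]_2%:E[EFin \o f \_ D].

Definition L2dot f g : R := \int[mu]_(x in D) (f x * g x).

Definition weakly_independent n (phi : 'I_n -> X -> R) : Prop :=
  forall c : 'I_n -> R,
    ae_eq mu D (fun x => \sum_j c j * phi j x) (cst 0) ->
    \sum_j c j = 0 -> forall j, c j = 0.

Definition L2span n (phi : 'I_n -> X -> R) : set (X -> R) :=
  [set g | L2 g /\ exists c : 'I_n -> R,
             ae_eq mu D g (fun x => \sum_j c j * phi j x)].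

Definition L2orth (S : set (X -> R)) : set (X -> R) :=
  [set g | L2 g /\ forall p, S p -> L2dot g p = 0].

Definition orthonormal_basis K (phi : 'I_K -> X -> R) (S : set (X -> R)) :=
  [/\ forall k, L2 (phi k),
      forall i k, L2dot (phi i) (phi k) = (i == k)%:R &
      L2span phi = S].

End L2.

Section adjoint.
Context {dX dV} {X : measurableType dX} {V : measurableType dV} {R : realType}.
Variables (mu : {measure set X -> \bar R}) (D : set X).
Variables (nu : {measure set V -> \bar R}) (E : set V).

Definition kernel_operator (w : V * X -> R) (phi : X -> R) (u : V) : R :=
  \int[mu]_(y in D) (w (u, y) * phi y).

(* The Hilbert-space adjoint of W : L^2(D) -> L^2(E); the value is unique up to
   equality a.e. on D. *)
Definition L2adjoint (W : (X -> R) -> V -> R) (psi : V -> R) : X -> R :=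
  xget (cst 0) [set g | L2 mu D g /\
    forall phi, L2 mu D phi -> L2dot nu E (W phi) psi = L2dot mu D phi g].

End adjoint.

Section gateaux.
Context {R : realType} {V : lmodType R}.
Variables (E : set V) (F : V -> R).

(* DF is the Gateaux derivative at x of F, seen as a function on the space E of
   admissible points. *)
Definition is_gateaux_derivative (x : V) (DF : V -> R) : Prop :=
  forall v, E v -> is_derive (0 : R) (1 : R) (fun s : R => F (x + s *: v)) (DF v).

(* The zero map is linear and continuous, so these need not be required of DF. *)
Definition critical_point (x : V) : Prop :=
  E x /\ is_gateaux_derivative x (fun=> 0).

End gateaux.

Section learning.
Context {R : realType} {d l N : nat}.
Variables (Y : set (Rn R d)) (U : set (Rn R l)) (T : R) (sigma : R -> R).

Local Notation leb := (tuple_lebesgue _).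
Local Notation time := (measurableTypeR R).

Definition L2Yt := L2 (leb \x @lebesgue_measure R)%E (Y `*` `]0, T[).
Definition L2YYt :=
  L2 ((leb \x leb) \x @lebesgue_measure R)%E (Y `*` Y `*` `]0, T[).
Definition L2UY := L2 (leb \x leb)%E (U `*` Y).

(* The time integral is taken pointwise in y; for a.e. y in Y it is the value at
   y of the L^2(Y)-valued Bochner integral. *)
Definition forward_solution (a : Rn R d * time -> R)
    (b : Rn R d * Rn R d * time -> R) (f0 : Rn R d -> R)
    (f : time -> Rn R d -> R) : Prop :=
  [/\ forall t, t \in `[0, T] -> L2 leb Y (f t),
      forall t, t \in `[0, T] ->
        L2norm leb Y (f s \- f t) @[s --> within `[0, T] (nbhs t)] --> (0 : R) &
      forall t, t \in `[0, T] ->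
        ae_eq leb Y (f t) (fun y => f0 y + \int[@lebesgue_measure R]_(s in `[0, t])
          sigma (a (y, s) - \int[leb]_(z in Y) (b (y, z, s) * f s z)))].

(* f t y is f(y, t).  The solution is unique up to equality a.e. on Y, for each
   t in [0, T]. *)
Definition forward a b f0 : time -> Rn R d -> R :=
  xget (fun=> cst 0) [set f | forward_solution a b f0 f].

Definition controls : lmodType R :=
  ((Rn R d * time -> R^o) * (Rn R d * Rn R d * time -> R^o) *
   (Rn R l * Rn R d -> R^o) * (Rn R l -> R^o))%type.

Definition control_space : set controls :=
  [set x | let: (a, b, w, mu) := x in
    [/\ L2Yt a, L2YYt b, L2UY w & L2 leb U mu]].

Variables (h : R -> R) (f0 : 'I_N -> Rn R d -> R) (P : 'I_N -> Rn R l -> R).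

Definition output (x : controls) (j : 'I_N) (u : Rn R l) : R :=
  let: (a, b, w, mu) := x in
  kernel_operator leb Y w (forward a b (f0 j) T) u + mu u.

Definition loss (x : controls) : R :=
  (2 * N%:R)^-1 *
  \sum_(j < N) \int[leb]_(u in U) (`|h (output x j u) - P j u| ^+ 2).

End learning.

(* Y transported to the row vectors, which carry the norm and the topology of
   R^n that tuples lack. *)
Definition row_set {R : realType} n (Y : set (Rn R n)) : set 'rV[R]_n :=
  [set v | Y [tuple v ord0 i | i < n]].

(* The unit vector N^(-1/2) (1, ..., 1)^T. *)
Definition unit_diag (R : realType) N : 'cV[R]_N :=
  const_mx (Num.sqrt N%:R)^-1.

Definition gram {R : realType} d (Y : set (Rn R d)) N K
    (f : 'I_N -> Rn R d -> R) (phi : 'I_K -> Rn R d -> R) : 'M[R]_(N, K) :=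
  \matrix_(i, k) L2dot (tuple_lebesgue d) Y (f i) (phi k).

(* Main.v *)
Require Import Defs.
From HB Require Import structures.
From mathcomp Require Import all_boot all_order all_algebra.
From mathcomp Require Import all_classical all_reals all_analysis.
From mathcomp Require Import measurable_realfun lra ring.
Import Order.TTheory GRing.Theory Num.Theory.
Import numFieldNormedType.Exports.
Local Open Scope classical_set_scope.
Local Open Scope ring_scope.
Set Implicit Arguments.
Unset Strict Implicit.
Unset Printing Implicit Defensive.

(* All data are extended by zero, so that Y, U and ]0, T[ become finite measure
   spaces and the unknown becomes the velocity v = df/dt, which solves the
   Volterra equation v = sigma(a - B(fI + \int_0^t v)) in L^2. A weight rho(t) of
   exponential type makes the linear Volterra operators involved contract; this
   gives existence, uniqueness, stability and, through an adjoint equation that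
   runs backwards in time, the directional derivatives of J:
     dJ = (1/N) \sum_j ( \int P_j sigma'(..) (da - db f_j)
                         + \int r_j (dw f_j(T) + dmu) ),
   where r_j is the terminal residual and the costate P_j has terminal value
   q_j = W^* r_j.

   At a critical point, the directions da = theta_i, db(y, z, t) =
   - theta_i(y, t) fI_i(z), with theta_i = \sum_j P_j sigma'(..) E_ij(t) and
   E_ij(t) = 1 + <fI_i, f_j(t)>, yield theta_i = 0. At t = 0 the matrix E is
   1 1^T plus the Gram matrix of the initial data; it is invertible because the
   data are weakly independent, and so is E(t) for small t. Hence sigma' P_j, and
   therefore P_j, vanishes near t = 0. The costate equation is linear and can be
   solved forwards in time as well, so q_j = W^* r_j = 0 for every j, which is
   condition 1. The directions dw and dmu give \sum_j r_j f_j(T) = 0 and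
   \sum_j r_j = 0; expanding in the basis, these are the normal equations of
   conditions 2 and 3. Conversely the three conditions annihilate dJ. *)

(** Two features of the L^2 setting shape the argument. The squared Hilbert-Schmidt norm of b(., .,
    t) is merely integrable in time, so an exponential weight alone gives no contraction: that norm
    is split into a bounded part, which the weight handles, and a tail of small integral. Moreover v
    -> sigma(v) is in general not differentiable as a map from L^2 to L^2, so the state is never
    differentiated. Difference quotients are paired with the costate through an exact duality
    identity, and only the scalar remainder is sent to 0, by dominated convergence. This requires
    convergence almost everywhere, hence the fixed steps 4^-n, along which increments of size
    O(4^-n) in L^2 converge almost everywhere. One sequence of steps is enough at a critical point,
    where the derivative is known to exist and to be 0. In the converse direction the terms carrying
    q_j vanish, and a quadratic remainder of the loss gives its derivative without any
    differentiability of the state. *)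

Lemma aeS dX (X : measurableType dX) (R : realType)
    (m : {measure set X -> \bar R}) (P Q : X -> Prop) :
  (forall x, P x -> Q x) -> {ae m, forall x, P x} -> {ae m, forall x, Q x}.
Proof. by move=> PQ; apply: filterS. Qed.

Lemma aeI dX (X : measurableType dX) (R : realType)
    (m : {measure set X -> \bar R}) (P Q S : X -> Prop) :
  (forall x, P x -> Q x -> S x) ->
  {ae m, forall x, P x} -> {ae m, forall x, Q x} -> {ae m, forall x, S x}.
Proof. by move=> PQ; apply: filterS2. Qed.

Lemma ge0_fineK (R : realType) (x : \bar R) :
  (0 <= x -> x < +oo -> x = (fine x)%:E)%E.
Proof. by move=> x0 xoo; rewrite fineK// ge0_fin_numE. Qed.

Lemma lty_double_sum (R : realType) (x y : \bar R) :
  (x < +oo -> y < +oo -> 2%:E * x + 2%:E * y < +oo)%E.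
Proof. by move=> x0 y0; apply: lte_add_pinfty; exact: lte_mul_pinfty. Qed.

Lemma ge0_integral_double_sum dX (X : measurableType dX) (R : realType)
    (m : {measure set X -> \bar R}) (f g : X -> \bar R) :
  measurable_fun setT f -> (forall x, 0 <= f x)%E ->
  measurable_fun setT g -> (forall x, 0 <= g x)%E ->
  (\int[m]_x (2%:E * f x + 2%:E * g x) = 2%:E * \int[m]_x f x + 2%:E * \int[m]_x g x)%E.
Proof.
move=> mf f0 mg g0; rewrite ge0_integralD//; last 4 first.
- by move=> x _; rewrite mule_ge0.
- exact: measurable_funeM.
- by move=> x _; rewrite mule_ge0.
- exact: measurable_funeM.
by rewrite !ge0_integralZl.
Qed.

(** * Square integrals *)

Section square_integral.
Context {dX} {X : measurableType dX} {R : realType}.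
Variable m : {measure set X -> \bar R}.
Implicit Types f g : X -> R.

(** The squared L^2 norm stays in the extended reals: monotonicity and Tonelli then ask for
    measurability only, and finiteness enters separately through [sqint]. *)
Definition sqi f : \bar R := (\int[m]_x (f x ^+ 2 : R)%:E)%E.

Lemma sqi_ge0 f : (0 <= sqi f)%E.
Proof. by apply: integral_ge0 => x _; rewrite lee_fin sqr_ge0. Qed.

Lemma measurable_sqr f : measurable_fun setT f ->
  measurable_fun setT (fun x => (f x ^+ 2 : R)%:E).
Proof. by move=> mf; apply/measurable_EFinP; exact: measurable_funX. Qed.

Lemma sqi0 : sqi (cst 0) = 0%E.
Proof. by apply: integral0_eq => x _; rewrite expr0n. Qed.

Lemma le_sqi f g : measurable_fun setT f -> measurable_fun setT g ->
  (forall x, `|f x| <= `|g x|) -> (sqi f <= sqi g)%E.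
Proof.
move=> mf mg fg; apply: ge0_le_integral => //.
- by move=> x _; rewrite lee_fin sqr_ge0.
- exact: measurable_sqr.
- exact: measurable_sqr.
- move=> x _; rewrite lee_fin -(real_normK (num_real (f x))).
  by rewrite -(real_normK (num_real (g x))) ler_pXn2r ?nnegrE.
Qed.

Lemma sqiZ c f : measurable_fun setT f ->
  sqi (fun x => c * f x) = ((c ^+ 2)%:E * sqi f)%E.
Proof.
move=> mf; rewrite /sqi -ge0_integralZl//.
- by apply: eq_integral => x _; rewrite exprMn EFinM.
- exact: measurable_sqr.
- by move=> x _; rewrite lee_fin sqr_ge0.
- by rewrite lee_fin sqr_ge0.
Qed.

Lemma sqiD f g : measurable_fun setT f -> measurable_fun setT g ->
  (sqi (fun x => (f x + g x)%R) <= 2%:E * sqi f + 2%:E * sqi g)%E.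
Proof.
move=> mf mg; rewrite /sqi -!ge0_integralZl//; try by [
  apply: measurable_sqr | move=> x _; rewrite lee_fin sqr_ge0].
rewrite -ge0_integralD//; last 4 first.
- by move=> x _; rewrite mule_ge0// lee_fin sqr_ge0.
- by apply: measurable_funeM; exact: measurable_sqr.
- by move=> x _; rewrite mule_ge0// lee_fin sqr_ge0.
- by apply: measurable_funeM; exact: measurable_sqr.
apply: ge0_le_integral => //.
- by move=> x _; rewrite lee_fin sqr_ge0.
- by apply: measurable_sqr; exact: measurable_funD.
- by apply: emeasurable_funD; apply: measurable_funeM; exact: measurable_sqr.
- move=> x _; rewrite -!EFinM -EFinD lee_fin.
  have := sqr_ge0 (f x - g x); rewrite sqrrB sqrrD !mulr_natl; lra.
Qed.

Lemma sqi_eq0 f : measurable_fun setT f ->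
  sqi f = 0%E <-> ae_eq m setT f (cst 0).
Proof.
move=> mf; have := @ae_eq_integral_abs _ _ _ m setT measurableT
  (fun x => (f x ^+ 2)%:E) (measurable_sqr mf).
rewrite (_ : (\int[m]_x `|(f x ^+ 2)%:E|)%E = sqi f); last first.
  by apply: eq_integral => x _; rewrite gee0_abs// lee_fin sqr_ge0.
move=> ->; split; apply: aeS => x /(_ I) h _; rewrite ?h ?expr0n//.
by case: h => /eqP; rewrite sqrf_eq0 => /eqP.
Qed.

Lemma ae_eq_sqi f g : measurable_fun setT f -> measurable_fun setT g ->
  ae_eq m setT f g -> sqi f = sqi g.
Proof.
move=> mf mg fg; apply: ge0_ae_eq_integral => //; try by [
  apply: measurable_sqr | move=> x _; rewrite lee_fin sqr_ge0].
by apply: aeS fg => x fg _; rewrite fg.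
Qed.

(** Hölder's inequality with both exponents equal to 2. Integrability of the product can be left out
    because [Rintegral] is 0 when the integral is infinite. *)
Lemma cauchy_schwarz f g : measurable_fun setT f -> measurable_fun setT g ->
  (((\int[m]_x (f x * g x)) ^+ 2)%:E <= sqi f * sqi g)%E.
Proof.
move=> mf mg.
have N2 h : ('N[m]_2%:E[EFin \o h] * 'N[m]_2%:E[EFin \o h] = sqi h)%E.
  transitivity ('N[m]_2%:E[EFin \o h] `^ 2)%E.
    rewrite (_ : 2 = 1 + 1)%R// poweRD ?poweRe1 ?Lnorm_ge0//.
    by apply: add_neq0_poweRD_def; rewrite -[1 + 1]/(2%:R) pnatr_eq0.
  rewrite powR_Lnorm//; apply: eq_integral => x _.
  rewrite [LHS](_ : _ = (`|h x| `^ 2)%:E)// powR_mulrn//.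
  by rewrite real_normK//; exact: num_real.
have h : ('N[m]_1[EFin \o (f \* g)%R] <=
    'N[m]_2%:E[EFin \o f] * 'N[m]_2%:E[EFin \o g])%E.
  by apply: hoelder => //; rewrite [RHS]splitr !div1r.
have le1 : (`|\int[m]_x (f x * g x)|%:E <= 'N[m]_1[EFin \o (f \* g)%R])%E.
  rewrite Lnorm1; apply: (@le_trans _ _ (`|\int[m]_x (f x * g x)%:E|)%E).
    by rewrite /Rintegral; case: (integral _ _ _) => //= *; rewrite normr0 leey.
  apply: le_abse_integral => //.
  by apply/measurable_EFinP; exact: measurable_funM.
have {h}le1 := le_trans le1 h.
rewrite -(real_normK (num_real (Rintegral _ _ _))) expr2 EFinM.
by rewrite -(N2 f) -(N2 g) muleACA; apply: lee_pmul.
Qed.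

End square_integral.
Arguments sqi {dX X R} m f%_R.

Ltac mfun1 := match goal with
| |- measurable_fun _ _ => assumption
| |- measurable_fun _ (fun x => EFin (@?f x)) => apply/measurable_EFinP
| |- measurable_fun _ (fun x => mule (@?f x) (@?g x)) => apply: emeasurable_funM
| |- measurable_fun _ (fun x => GRing.mul (@?f x) (@?g x)) => apply: measurable_funM
| |- measurable_fun _ (fun x => GRing.exp (@?f x) _) => apply: measurable_funX
| |- measurable_fun _ (fun x => Algebra.add (@?f x) (Algebra.opp (@?g x))) =>
    apply: measurable_funB
| |- measurable_fun _ (fun x => Algebra.add (@?f x) (@?g x)) => apply: measurable_funD
| |- measurable_fun _ (fun x => pair (@?f x) (@?g x)) => apply: measurable_fun_pair
| |- measurable_fun _ (fun x => x) => exact: measurable_id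
| |- measurable_fun _ (fun=> _) => exact: measurable_cst
| |- measurable_fun _ (fst) => exact: measurable_fst
| |- measurable_fun _ (snd) => exact: measurable_snd
| |- measurable_fun _ (fun x => fst (@?f x)) => apply: (measurableT_comp measurable_fst)
| |- measurable_fun _ (fun x => snd (@?f x)) => apply: (measurableT_comp measurable_snd)
| mf : measurable_fun setT ?f |- measurable_fun _ (fun x => ?f (@?g x)) =>
    apply: (measurableT_comp mf)
end.
Ltac mfun := repeat (cbv beta; mfun1).

(** * Tonelli and Hilbert-Schmidt bounds on product spaces *)

Section product_integrals.
Context {dX dY} {X : measurableType dX} {Y : measurableType dY} {R : realType}.
Variables (m : {sigma_finite_measure set X -> \bar R}).
Variables (n : {sigma_finite_measure set Y -> \bar R}).

(** The real integral is [fine] of a difference of two Tonelli integrals, each measurable, so joint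
    measurability suffices even where the integral diverges. *)
Lemma measurable_integralr (f : X * Y -> R) : measurable_fun setT f ->
  measurable_fun setT (fun x => \int[n]_y f (x, y)).
Proof.
move=> mf; rewrite /Rintegral.
apply: (measurableT_comp (@fine_measurable R setT measurableT)).
rewrite (_ : (fun x => _) = (fun x => (\int[n]_y ((EFin \o f)^\+ (x, y))) -
    (\int[n]_y ((EFin \o f)^\- (x, y))))%E); last first.
  apply/funext => x; rewrite integralE.
  by congr (_ - _)%E; apply: eq_integral => y _; rewrite ?funeposE ?funenegE.
have mEf : measurable_fun setT (EFin \o f) by exact/measurable_EFinP.
apply: emeasurable_funB.
  by apply: measurable_fun_fubini_tonelli_F => //; exact: measurable_funepos.
by apply: measurable_fun_fubini_tonelli_F => //; exact: measurable_funeneg.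
Qed.

Lemma sqi_prodE (f : X * Y -> R) : measurable_fun setT f ->
  sqi (m \x n)%E f = (\int[n]_y sqi m (fun x => f (x, y)))%E.
Proof.
move=> mf; rewrite /sqi fubini_tonelli2//; first exact: measurable_sqr.
by move=> x; rewrite lee_fin sqr_ge0.
Qed.

Lemma measurable_sqi (f : X * Y -> R) : measurable_fun setT f ->
  measurable_fun setT (fun y => sqi m (fun x => f (x, y))).
Proof.
move=> mf; apply: (measurable_fun_fubini_tonelli_G (fun p => (f p ^+ 2)%:E)).
  exact: measurable_sqr.
by move=> x; rewrite lee_fin sqr_ge0.
Qed.

(** Cauchy-Schwarz in y for each x, then Tonelli: an integral operator is bounded by the
    Hilbert-Schmidt norm of its kernel. *)
Lemma sqi_kernel (b : X * Y -> R) (f : Y -> R) :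
  measurable_fun setT b -> measurable_fun setT f ->
  (sqi m (fun x => \int[n]_y (b (x, y) * f y)%R)%R <= sqi (m \x n)%E b * sqi n f)%E.
Proof.
move=> mb mf; have mb2 := measurable_sqr mb.
have b0 x : (0 <= (b x ^+ 2)%:E)%E by rewrite lee_fin sqr_ge0.
have mF := measurable_fun_fubini_tonelli_F (m2 := n) _ mb2 b0.
rewrite {2}/sqi fubini_tonelli1// -ge0_integralZr//; last 2 first.
- by move=> x _; exact: integral_ge0.
- exact: sqi_ge0.
apply: ge0_le_integral => //.
- by move=> x _; rewrite lee_fin sqr_ge0.
- apply: measurable_sqr; apply: (measurable_integralr (f := fun p => b p * f p.2)).
  by mfun.
- exact: emeasurable_funM.
- by move=> x _; apply: cauchy_schwarz => //; mfun.
Qed.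

End product_integrals.

(** * Volterra operators and weights *)

Section weights.
Context {R : realType}.
Variable tm : {finite_measure set (measurableTypeR R) -> \bar R}.
Variable S : measurableTypeR R -> measurableTypeR R -> bool.

(** An integral up to time t becomes an integral over all times against this factor, so that Tonelli
    applies to it as to any kernel in (t, s). *)
Definition ind (p : measurableTypeR R * measurableTypeR R) : R := (S p.1 p.2)%:R.

(* S t s means that the time s precedes the time t for the equation at hand;
   both directions of time are needed. *)
Definition has_weights := forall delta : R, 0 < delta ->
  exists rho : measurableTypeR R -> R, [/\ measurable_fun setT rho,
    exists2 k, 0 < k & forall t, k <= rho t <= k^-1,
    forall t s, S t s -> rho t <= rho s &
    forall s, (\int[tm]_t (ind (t, s) * rho t)%:E <= (delta * rho s)%:E)%E].

Hypothesis mS : measurable_fun setT ind.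
Hypothesis wS : has_weights.

Lemma ind_ge0 p : 0 <= ind p. Proof. exact: ler0n. Qed.

(** The part of c above the level n tends to 0 almost everywhere and is dominated by c, so its
    integral falls below e for some n. *)
Lemma integrable_tail (c : measurableTypeR R -> \bar R) (e : R) :
  measurable_fun setT c -> (forall t, 0 <= c t)%E ->
  (\int[tm]_t c t < +oo)%E -> 0 < e ->
  exists (n : nat) (r : measurableTypeR R -> \bar R), [/\ measurable_fun setT r,
    forall t, (0 <= r t)%E, (\int[tm]_t r t <= e%:E)%E &
    forall t, (c t <= n%:R%:E + r t)%E].
Proof.
move=> mc c0 ic e0.
pose r (n : nat) t := (c t * (n%:R%:E < c t)%E%:R%:E)%E.
have mr n : measurable_fun setT (r n).
  apply: emeasurable_funM => //.
  rewrite (_ : (fun t => _) = EFin \o (\1_[set t | (n%:R%:E < c t)%E])).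
    apply/measurable_EFinP; apply: measurable_indic.
    by rewrite -[X in measurable X]setTI; exact: emeasurable_fun_o_infty.
  by apply/funext => t /=; rewrite indicE mem_setE.
have r0 n t : (0 <= r n t)%E by rewrite mule_ge0// lee_fin.
have rc n t : (r n t <= c t)%E.
  by rewrite /r; case: (_ < _)%E; rewrite ?mule1 ?mule0.
have iC : tm.-integrable setT c.
  apply/integrableP; split => //; apply: le_lt_trans ic.
  by under eq_integral do rewrite gee0_abs//.
have r_cvg : {ae tm, forall t, setT t -> r ^~ t @ \oo --> (0 : \bar R)}.
  apply: aeS (integrable_ae measurableT iC) => t /(_ I) ct _.
  apply: cvg_near_cst; near=> n.
  rewrite /r -(fineK ct) lte_fin ltNge.
  suff -> : fine (c t) <= n%:R by rewrite mule0.
  by near: n; exact: nbhs_infty_ger.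
have r_le : {ae tm, forall t n, setT t -> (`|r n t| <= c t)%E}.
  by apply: aeW => t n _; rewrite gee0_abs.
have [_ _] := dominated_convergence measurableT mr (measurable_cst _) r_cvg iC
  r_le.
rewrite /= integral0.
move=> /fine_cvgP[_ /cvgrPdist_le /(_ e e0) [n _ /(_ n (leqnn n))]].
rewrite /= sub0r normrN ger0_norm; last by rewrite fine_ge0// integral_ge0.
move=> ine; exists n, (r n); split => //.
  rewrite -(@fineK _ (\int[tm]_t r n t)%E) ?lee_fin//.
  rewrite ge0_fin_numE ?integral_ge0//; apply: le_lt_trans ic.
  exact: ge0_le_integral.
move=> t; rewrite /r; case: (ltP (n%:R%:E)%E (c t)) => ct.
  by rewrite mule1 leeDr// lee_fin.
by rewrite mule0 adde0.
Unshelve. all: by end_near.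
Qed.

(** A weight alone cannot tame an unbounded c. After truncation, the bounded part is absorbed by a
    weight with a small ratio, and the tail has a small integral against which the monotonicity of
    the weight suffices. *)
Lemma weight_kernel (c : measurableTypeR R -> \bar R) (e : R) :
  measurable_fun setT c -> (forall t, 0 <= c t)%E ->
  (\int[tm]_t c t < +oo)%E -> 0 < e ->
  exists rho : measurableTypeR R -> R, [/\ measurable_fun setT rho,
    exists2 k, 0 < k & forall t, k <= rho t <= k^-1 &
    forall q : measurableTypeR R -> \bar R, measurable_fun setT q ->
      (forall s, 0 <= q s)%E ->
      (\int[tm]_t ((rho t)%:E * (c t * \int[tm]_s ((ind (t, s))%:E * q s))) <=
       e%:E * \int[tm]_s ((rho s)%:E * q s))%E].
Proof.
move=> mc c0 ic e0; have e20 : 0 < e / 2 by rewrite divr_gt0.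
have [n [r [mr r0 ir cr]]] := integrable_tail mc c0 ic e20.
(* The part of c below n costs n times this ratio, at most e / 2; the tail costs the other half.
   Using n + 1 avoids a division by 0. *)
have d0 : 0 < e / 2 / n.+1%:R by rewrite divr_gt0.
have [rho [mrho [k k0 krho] Srho irho]] := wS d0.
have rho0 t : 0 <= rho t by have /andP[/(le_trans (ltW k0))] := krho t.
exists rho; split => //; first by exists k.
move=> q mq q0.
pose F (p : measurableTypeR R * measurableTypeR R) :=
  ((rho p.1)%:E * (c p.1 * ((ind p)%:E * q p.2)))%E.
have mF : measurable_fun setT F by rewrite /F; mfun.
have F0 p : (0 <= F p)%E by rewrite !mule_ge0// ?lee_fin ?ind_ge0.
rewrite [leLHS](_ : _ = \int[tm]_t \int[tm]_s F (t, s))%E; last first.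
  apply: eq_integral => t _; rewrite /F/= ge0_integralZl//; first 1 last.
  - by mfun.
  - by move=> s _; rewrite !mule_ge0// ?lee_fin ?ind_ge0.
  - by rewrite lee_fin.
  rewrite ge0_integralZl//; first by mfun.
  by move=> s _; rewrite !mule_ge0// ?lee_fin ?ind_ge0.
rewrite fubini_tonelli// -ge0_integralZl//; last 3 first.
- by mfun.
- by move=> s _; rewrite !mule_ge0// lee_fin.
- by rewrite lee_fin ltW.
apply: ge0_le_integral => //.
- by move=> s _; exact: integral_ge0.
- exact: measurable_fun_fubini_tonelli_G.
- by mfun.
move=> s _.
(* For fixed s, the weight multiplying n is kept at time t and integrated by [irho]; the weight
   multiplying r t is raised to rho s, which leaves only the integral of r. *)
apply: (@le_trans _ _ (\int[tm]_t (q s * (n%:R%:E * (ind (t, s) * rho t)%:E +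
    (rho s)%:E * r t)))%E).
  apply: ge0_le_integral => //.
  - by mfun.
  - apply: emeasurable_funM => //; apply: emeasurable_funD; first by mfun.
    by mfun.
  move=> t _; rewrite /F/= (muleCA (c t)) (muleCA (rho t)%:E).
  rewrite (muleA (rho t)%:E) (muleC _ (q s)) muleCA lee_wpmul2l//.
  rewrite /ind/=; case: (boolP (S t s)) => ts; last first.
    by rewrite !mul0r !mule0 mul0e add0e mule_ge0 ?lee_fin.
  rewrite !mul1r mul1e; apply: (le_trans (lee_wpmul2l _ (cr t))).
    by rewrite lee_fin.
  rewrite ge0_muleDr ?lee_fin// muleC leeD2l// lee_wpmul2r// lee_fin.
  exact: Srho.
rewrite ge0_integralZl//; last 2 first.
- by apply: emeasurable_funD; mfun.
- by move=> t _; rewrite adde_ge0 ?mule_ge0 ?lee_fin ?mulr_ge0 ?ind_ge0.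
rewrite muleC muleA lee_wpmul2r// ge0_integralD//; last 4 first.
- by move=> t _; rewrite ?mule_ge0 ?lee_fin ?mulr_ge0 ?ind_ge0.
- by mfun.
- by move=> t _; rewrite ?mule_ge0 ?lee_fin ?mulr_ge0 ?ind_ge0.
- by mfun.
rewrite !ge0_integralZl//; last 3 first.
- by rewrite lee_fin.
- by mfun.
- by move=> t _; rewrite ?mule_ge0 ?lee_fin ?mulr_ge0 ?ind_ge0.
apply: (@le_trans _ _ (n%:R%:E * (e / 2 / n.+1%:R * rho s)%:E +
   (rho s)%:E * (e / 2)%:E)%E).
  by rewrite leeD// lee_wpmul2l// lee_fin.
rewrite -!EFinM -EFinD lee_fin.
have : n%:R / n.+1%:R <= 1 :> R by rewrite ler_pdivrMr// mul1r ler_nat.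
have := rho0 s; set x := rho s; move=> x0 nn.
rewrite [leRHS](_ : _ = e / 2 * x * 1 + x * (e / 2)); last by field.
rewrite lerD2r mulrCA [leLHS](_ : _ = e / 2 * x * (n%:R / n.+1%:R)); last by ring.
by rewrite ler_wpM2l// mulr_ge0// ltW.
Qed.

End weights.

Section volterra.
Context {dX} {X : measurableType dX} {R : realType}.
Variable m : {finite_measure set X -> \bar R}.
Variable tm : {finite_measure set (measurableTypeR R) -> \bar R}.
Variable S : measurableTypeR R -> measurableTypeR R -> bool.
Hypothesis mS : measurable_fun setT (ind S).

(** Integration of v in time: from 0 to t for [before], from t to T for its reversal. *)
Definition vol (v : X * measurableTypeR R -> R) (p : X * measurableTypeR R) : R :=
  \int[tm]_s (ind S (p.2, s) * v (p.1, s)).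

Definition slice (v : X * measurableTypeR R -> R) t := sqi m (fun y => v (y, t)).

Definition app (b : X * X * measurableTypeR R -> R) (f : X -> R) y t : R :=
  \int[m]_z (b (y, z, t) * f z).

(** The squared Hilbert-Schmidt norm of the operator with kernel b(., ., t). *)
Definition energy (b : X * X * measurableTypeR R -> R) t : \bar R :=
  sqi (m \x m)%E (fun p => b (p, t)).

Lemma measurable_vol v : measurable_fun setT v -> measurable_fun setT (vol v).
Proof.
move=> mv; rewrite /vol.
apply: (measurable_integralr tm (f := fun q : (X * measurableTypeR R) * measurableTypeR R =>
  ind S (q.1.2, q.2) * v (q.1.1, q.2))).
by mfun.
Qed.

Lemma measurable_app b f : measurable_fun setT b ->
  measurable_fun setT (fun q : X * measurableTypeR R => f q) ->
  measurable_fun setT (fun p : X * measurableTypeR R =>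
    app b (fun z => f (z, p.2)) p.1 p.2).
Proof.
move=> mb mf; rewrite /app.
apply: (measurable_integralr m (f := fun q : (X * measurableTypeR R) * X =>
  b (q.1.1, q.2, q.1.2) * f (q.2, q.1.2))).
by mfun.
Qed.

Lemma measurable_slice v : measurable_fun setT v -> measurable_fun setT (slice v).
Proof. exact: measurable_sqi. Qed.

Lemma slice_ge0 v t : (0 <= slice v t)%E. Proof. exact: sqi_ge0. Qed.

Lemma measurable_energy b : measurable_fun setT b ->
  measurable_fun setT (energy b).
Proof.
move=> mb; rewrite /energy.
rewrite (_ : (fun t => _) =
    fun t => (\int[m]_y (sqi m (fun z => b (y, z, t)))))%E; last first.
  apply/funext => t; rewrite /sqi fubini_tonelli1//.
    by apply: measurable_sqr; mfun.
  by move=> p; rewrite lee_fin sqr_ge0.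
have m1 : measurable_fun setT (fun q : X * measurableTypeR R =>
    sqi m (fun z => b (q.1, z, q.2))).
  apply: (measurable_fun_fubini_tonelli_F
    (fun q : (X * measurableTypeR R) * X => (b (q.1.1, q.2, q.1.2) ^+ 2)%:E)).
    by apply: (measurable_sqr (f := fun q => b (q.1.1, q.2, q.1.2))); mfun.
  by move=> p; rewrite lee_fin sqr_ge0.
apply: (measurable_fun_fubini_tonelli_G _ m1) => p; exact: sqi_ge0.
Qed.

Lemma sqi_app b f t : measurable_fun setT b -> measurable_fun setT f ->
  (sqi m (fun y => app b f y t) <= energy b t * sqi m f)%E.
Proof.
move=> mb mf; apply: (sqi_kernel m m (b := fun p => b (p, t))) => //.
by mfun.
Qed.

(** The indicator equals its square, so each factor of Cauchy-Schwarz in time receives a copy: one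
    factor is bounded by the total mass, and the other keeps the restriction to earlier times, on
    which the weights act. *)
Lemma slice_vol v t : measurable_fun setT v ->
  (slice (vol v) t <= tm setT * \int[tm]_s ((ind S (t, s))%:E * slice v s))%E.
Proof.
move=> mv; have mi : measurable_fun setT (fun s => ind S (t, s)) by mfun.
have mq : measurable_fun setT (fun p : X * measurableTypeR R =>
    (ind S (t, p.2) * v p ^+ 2)%:E) by mfun.
have q0 (p : X * measurableTypeR R) : (0 <= (ind S (t, p.2) * v p ^+ 2)%:E)%E.
  by rewrite lee_fin mulr_ge0 ?ind_ge0 ?sqr_ge0.
have -> : (\int[tm]_s ((ind S (t, s))%:E * slice v s) =
    \int[m]_y \int[tm]_s (ind S (t, s) * v (y, s) ^+ 2)%:E)%E.
  rewrite (fubini_tonelli (m1 := m) (m2 := tm) _ mq q0).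
  apply: eq_integral => s _; rewrite /slice /sqi.
  rewrite -ge0_integralZl//.
  - by apply: measurable_sqr; mfun.
  - by move=> y _; rewrite lee_fin sqr_ge0.
  - by rewrite lee_fin ind_ge0.
have mF := measurable_fun_fubini_tonelli_F (m2 := tm) _ mq q0.
have G0 y : (0 <= \int[tm]_s (ind S (t, s) * v (y, s) ^+ 2)%:E)%E.
  by apply: integral_ge0 => s _; exact: (q0 (y, s)).
rewrite -(ge0_integralZl m measurableT mF); [|by move=> y _; exact: G0|by []].
apply: ge0_le_integral => //.
- by move=> y _; rewrite lee_fin sqr_ge0.
- by apply: measurable_sqr; have := measurable_vol mv => mvv; mfun.
- exact: measurable_funeM.
move=> y _; rewrite /vol /=.
have -> : \int[tm]_s (ind S (t, s) * v (y, s)) =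
    \int[tm]_s (ind S (t, s) * (ind S (t, s) * v (y, s))).
  apply: eq_Rintegral => s _; rewrite mulrA; congr (_ * _).
  by rewrite /ind; case: (S _ _); rewrite ?mulr1 ?mulr0.
apply: (le_trans (cauchy_schwarz _ _ _)) => //; first by mfun.
apply: lee_pmul; rewrite ?sqi_ge0//.
  rewrite -[leRHS]mul1e -(integral_cst tm measurableT 1%E).
  apply: ge0_le_integral => //.
  - by move=> s _; rewrite lee_fin sqr_ge0.
  - exact: measurable_sqr.
  - by move=> s _; rewrite lee_fin /ind/=; case: (S _ _);
      rewrite ?expr1n ?expr0n ?ler01.
rewrite le_eqVlt; apply/orP; left; apply/eqP; apply: eq_integral => s _.
rewrite exprMn; congr (_ * _)%:E.
by rewrite /ind/=; case: (S _ _); rewrite ?expr1n ?expr0n.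
Qed.

Hypothesis wS : has_weights tm S.

(** The weight depends on b only through the majorant c of its energy, so one weight serves a whole
    family of perturbed kernels. Since w is only dominated pointwise, the bound also covers
    Lipschitz nonlinearities. *)
Lemma volterra_contraction (c : measurableTypeR R -> \bar R) (k e : R) :
  measurable_fun setT c -> (forall t, 0 <= c t)%E -> (\int[tm]_t c t < +oo)%E ->
  0 < e ->
  exists rho : measurableTypeR R -> R, [/\ measurable_fun setT rho,
    exists2 r, 0 < r & forall t, r <= rho t <= r^-1 &
    forall b (v w : X * measurableTypeR R -> R), measurable_fun setT b -> measurable_fun setT v ->
      measurable_fun setT w -> (forall t, energy b t <= c t)%E ->
      (forall y t, `|w (y, t)| <= `|k * app b (fun z => vol v (z, t)) y t|) ->
      (\int[tm]_t ((rho t)%:E * slice w t) <=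
       e%:E * \int[tm]_t ((rho t)%:E * slice v t))%E].
Proof.
move=> mc c0 ic e0.
pose V := fine (tm setT).
have V0 : 0 <= V by exact: fine_ge0.
have VE : tm setT = V%:E by rewrite fineK// fin_num_measure.
(* The factor V comes from Cauchy-Schwarz in time, and the 1 keeps K positive so that the target
   factor can be e / K. *)
pose K := k ^+ 2 * V + 1.
have K0 : 0 < K by rewrite ltr_wpDl// mulr_ge0// sqr_ge0.
have eK0 : 0 < e / K by rewrite divr_gt0.
have [rho [mrho brho wrho]] := weight_kernel mS wS mc c0 ic eK0.
exists rho; split => // b v w mb mv mw bc wb.
have rho0 t : 0 <= rho t.
  by case: brho => r r0 /(_ t) /andP[/(le_trans (ltW r0))].
have mvv := measurable_vol mv.
have msv := measurable_slice mv.
have msw := measurable_slice mw.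
have mi : measurable_fun setT
    (fun t => \int[tm]_s ((ind S (t, s))%:E * slice v s))%E.
  apply: (measurable_fun_fubini_tonelli_F
    (fun p : measurableTypeR R * measurableTypeR R =>
      (ind S p)%:E * slice v p.2)%E).
    by mfun.
  by move=> p; rewrite mule_ge0 ?slice_ge0// lee_fin ind_ge0.
have i0 t : (0 <= \int[tm]_s ((ind S (t, s))%:E * slice v s))%E.
  by apply: integral_ge0 => s _; rewrite mule_ge0 ?slice_ge0// lee_fin ind_ge0.
have sw t : (slice w t <=
    K%:E * (c t * \int[tm]_s ((ind S (t, s))%:E * slice v s)))%E.
  have mvt : measurable_fun setT (fun z => vol v (z, t)) by mfun.
  have ma : measurable_fun setT (fun y => app b (fun z => vol v (z, t)) y t).
    by have := measurable_app mb mvv => ma; apply: (measurableT_comp ma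
      (measurable_fun_pair (@measurable_id _ _ _) (measurable_cst t))).
  have mwt : measurable_fun setT (fun y => w (y, t)) by mfun.
  apply: (le_trans (le_sqi m mwt (measurable_funM (measurable_cst k) ma) _)).
    by move=> y; exact: wb.
  rewrite sqiZ//.
  apply: (@le_trans _ _ ((k ^+ 2)%:E * (c t * (V%:E *
      \int[tm]_s ((ind S (t, s))%:E * slice v s))))%E).
    rewrite lee_wpmul2l ?lee_fin ?sqr_ge0//.
    apply: (le_trans (sqi_app _ mb mvt)); apply: lee_pmul.
    - exact: sqi_ge0.
    - exact: sqi_ge0.
    - exact: bc.
    - by rewrite -VE; exact: slice_vol.
  rewrite (muleCA (c t)) [leLHS]muleA -EFinM lee_wpmul2r ?mule_ge0//.
  by rewrite lee_fin lerDl.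
apply: (@le_trans _ _ (\int[tm]_t (K%:E * ((rho t)%:E *
    (c t * \int[tm]_s ((ind S (t, s))%:E * slice v s)))))%E).
  apply: ge0_le_integral => //.
  - by move=> t _; rewrite mule_ge0 ?slice_ge0 ?lee_fin.
  - by mfun.
  - by apply: measurable_funeM; mfun.
  - by move=> t _; rewrite muleCA lee_wpmul2l ?lee_fin.
rewrite ge0_integralZl//; last 3 first.
- by mfun.
- by move=> t _; rewrite !mule_ge0 ?lee_fin.
- by rewrite lee_fin ltW.
have /(_ _ msv (slice_ge0 v)) h := wrho.
apply: (le_trans (lee_wpmul2l _ h)); first by rewrite lee_fin ltW.
by rewrite muleA -EFinM mulrCA divff ?gt_eqF// mulr1.
Qed.

End volterra.

(** * Square integrable functions and completeness *)

Section square_integrable.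
Context {dX} {X : measurableType dX} {R : realType}.
Variable m : {measure set X -> \bar R}.
Implicit Types f g : X -> R.

Definition sqint f := measurable_fun setT f /\ (sqi m f < +oo)%E.

Lemma sqintM_integrable f g : sqint f -> sqint g ->
  m.-integrable setT (fun x => (f x * g x)%:E).
Proof.
move=> [mf sf] [mg sg].
have i2 h : measurable_fun setT h -> (sqi m h < +oo)%E ->
    m.-integrable setT (fun x => (h x ^+ 2)%:E).
  move=> mh sh; apply/integrableP; split; first exact: measurable_sqr.
  by under eq_integral do rewrite gee0_abs ?lee_fin ?sqr_ge0//.
apply: (le_integrable measurableT _ _ (integrableD measurableT (i2 f mf sf) (i2 g mg sg))).
  by mfun.
move=> x _ /=; rewrite !lee_fin.
have fg : `|f x * g x| <= f x ^+ 2 + g x ^+ 2.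
  rewrite normrM -(real_normK (num_real (f x))) -(real_normK (num_real (g x))).
  have := sqr_ge0 (`|f x| - `|g x|); have := sqr_ge0 (`|f x|).
  have := sqr_ge0 (`|g x|); rewrite sqrrB; nra.
by apply: (le_trans fg); rewrite ler_norm.
Qed.

Lemma sqintD f g : sqint f -> sqint g -> sqint (fun x => f x + g x).
Proof.
move=> [mf sf] [mg sg]; split; first by mfun.
apply: (le_lt_trans (sqiD m mf mg)); apply: lte_add_pinfty;
  by apply: lte_mul_pinfty; rewrite ?lee_fin.
Qed.

Lemma sqintZ c f : sqint f -> sqint (fun x => c * f x).
Proof.
move=> [mf sf]; split; first by mfun.
by rewrite sqiZ//; apply: lte_mul_pinfty; rewrite ?lee_fin ?sqr_ge0.
Qed.

Lemma sqintB f g : sqint f -> sqint g -> sqint (fun x => f x - g x).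
Proof.
move=> sf sg; have := sqintD sf (sqintZ (-1) sg).
by under eq_fun do rewrite mulN1r.
Qed.

Lemma sqint0 : sqint (fun=> 0).
Proof. by split => //; rewrite [sqi _ _]sqi0. Qed.

Lemma sqint_sum (I : Type) (r : seq I) (F : I -> X -> R) :
  (forall i, sqint (F i)) -> sqint (fun x => \sum_(i <- r) F i x).
Proof.
move=> sF; elim: r => [|i r ih].
  by under eq_fun do rewrite big_nil; exact: sqint0.
by under eq_fun do rewrite big_cons; exact: sqintD.
Qed.

Lemma sqint_le f g : measurable_fun setT f -> sqint g ->
  (forall x, `|f x| <= `|g x|) -> sqint f.
Proof. by move=> mf [mg sg] fg; split => //; apply: le_lt_trans (le_sqi m mf mg fg) sg. Qed.

Lemma sqint_ae_eq f g : measurable_fun setT f -> sqint g ->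
  ae_eq m setT f g -> sqint f.
Proof. by move=> mf [mg sg] fg; split => //; rewrite (ae_eq_sqi mf mg fg). Qed.

Lemma le_sqi_ae f g : measurable_fun setT f -> measurable_fun setT g ->
  {ae m, forall x, `|f x| <= `|g x|} -> (sqi m f <= sqi m g)%E.
Proof.
move=> mf mg fg; apply: ae_ge0_le_integral => //; try by [
  apply: measurable_sqr | move=> x _; rewrite lee_fin sqr_ge0].
apply: aeS fg => x fg _; rewrite lee_fin -(real_normK (num_real (f x))).
by rewrite -(real_normK (num_real (g x))) ler_pXn2r ?nnegrE.
Qed.

Lemma Rintegral_ae_eq f g : measurable_fun setT f -> measurable_fun setT g ->
  ae_eq m setT f g -> \int[m]_x f x = \int[m]_x g x.
Proof.
move=> mf mg fg; congr fine; apply: ae_eq_integral => //; try by mfun.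
by apply: aeS fg => x fg _; rewrite fg.
Qed.

(** The weights 4^n leave a series of squared increments with finite integral G, and where G is
    finite the increments are at most 2^-n times the root of G. Hence convergence almost everywhere
    with |v - u_n|^2 <= 4 G 4^-n, and integrating G gives the constant 8 C. *)
Lemma sqi_complete (u : nat -> X -> R) (C : R) :
  (forall n, measurable_fun setT (u n)) -> 0 <= C ->
  (forall n, (sqi m (fun x => (u n.+1 x - u n x)%R) <= (C * 16^-1 ^+ n)%:E)%E) ->
  exists v : X -> R, measurable_fun setT v /\
    forall n, (sqi m (fun x => (v x - u n x)%R) <= (8 * C * 4^-1 ^+ n)%:E)%E.
Proof.
move=> mu C0 uC.
pose D n x := u n.+1 x - u n x.
have mD n : measurable_fun setT (D n) by exact: measurable_funB.
pose T n x := (4 ^+ n * D n x ^+ 2)%:E.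
have T0 n x : (0 <= T n x)%E by rewrite lee_fin mulr_ge0 ?sqr_ge0 ?exprn_ge0.
have mT n : measurable_fun setT (T n).
  by apply/measurable_EFinP; apply: measurable_funM => //; exact: measurable_funX.
pose G x := (\sum_(n <oo) T n x)%E.
have mG : measurable_fun setT G.
  by apply: ge0_emeasurable_sum => // n _ x _; exact: T0.
have G0 x : (0 <= G x)%E by apply: nneseries_ge0 => n _ _; exact: T0.
have iG : (\int[m]_x G x <= (2 * C)%:E)%E.
  rewrite integral_nneseries//.
  apply: lime_le; first by apply: is_cvg_nneseries => n _ _; exact: integral_ge0.
  apply: nearW => n.
  apply: (@le_trans _ _ (\sum_(0 <= i < n) (C * 4^-1 ^+ i)%:E)%E).
    apply: lee_sum => i _; rewrite /T.
    under eq_integral do rewrite EFinM.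
    rewrite ge0_integralZl//; last 2 first.
    - exact: measurable_sqr.
    - by move=> x _; rewrite lee_fin sqr_ge0.
    apply: (le_trans (lee_wpmul2l _ (uC i))); first by rewrite lee_fin exprn_ge0.
    rewrite -EFinM lee_fin mulrCA -exprMn.
    by rewrite (_ : 4 * 16^-1 = 4^-1) //; field.
  apply: (@le_trans _ _ (2 * C * (1 - 4^-1 ^+ n))%:E); last first.
    by rewrite lee_fin -[leRHS]mulr1 ler_wpM2l ?mulr_ge0// lerBlDr lerDl exprn_ge0.
  elim: n => [|n ih]; first by rewrite big_geq// subrr mulr0.
  rewrite big_nat_recr//=; apply: (le_trans (leeD2r _ ih)).
  rewrite -EFinD lee_fin exprS.
  have : 0 <= (4^-1 : R) ^+ n by rewrite exprn_ge0.
  set z := _ ^+ n; move=> z0; have : 0 <= C * z by rewrite mulr_ge0.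
  lra.
pose A := [set x | (G x < +oo)%E].
have mA : measurable A.
  by rewrite -[X in measurable X]setTI; exact: emeasurable_fun_infty_o.
have uA x n k : A x ->
    `|u (n + k)%N x - u n x| <= 2 * Num.sqrt (fine (G x)) * (2^-1 ^+ n - 2^-1 ^+ (n + k)).
  move=> Ax; have GE : G x = (fine (G x))%:E by rewrite fineK// ge0_fin_numE.
  set s := Num.sqrt _; have s0 : 0 <= s by exact: sqrtr_ge0.
  have Ds i : `|D i x| <= s * 2^-1 ^+ i.
    have : (T i x <= G x)%E.
      apply: (@le_trans _ _ (\sum_(0 <= j < i.+1) T j x)%E).
        by rewrite big_nat_recr//= leeDr// sume_ge0.
      by apply: nneseries_lim_ge => // j _ _; exact: T0.
    rewrite GE lee_fin => /(ler_wsqrtr); rewrite -/s sqrtrM ?exprn_ge0//.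
    rewrite sqrtr_sqr (_ : 4 = 2 ^+ 2); last by rewrite -natrX.
    rewrite -exprM mulnC exprM sqrtr_sqr ger0_norm ?exprn_ge0// => h.
    by rewrite exprVn ler_pdivlMr ?exprn_gt0// mulrC.
  elim: k => [|k ih]; first by rewrite addn0 !subrr normr0 mulr0.
  rewrite addnS -[u (n + k).+1 x](subrK (u (n + k)%N x)) -addrA.
  apply: (le_trans (ler_normD _ _)); apply: (le_trans (lerD (Ds _) ih)).
  by rewrite exprS; set z := _ ^+ (n + k); set y := _ ^+ n; lra.
have cA x : A x -> cvgn (u ^~ x).
  move=> Ax; set s := 2 * Num.sqrt (fine (G x)).
  have s0 : 0 <= s by rewrite mulr_ge0 ?sqrtr_ge0.
  apply/cauchy_cvgP; apply: cauchy_exP => e e0.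
  have [n _ /(_ n (leqnn n)) /= sn] : \forall n \near \oo, s * 2^-1 ^+ n < e.
    have : s * 2^-1 ^+ n @[n --> \oo] --> s * 0.
      apply: cvgM; first exact: cvg_cst.
      by apply: cvg_expr; rewrite ger0_norm// invf_lt1// ltr1n.
    rewrite mulr0 => /cvgr0Pnorm_lt /(_ e e0); apply: filterS => k.
    by rewrite ger0_norm// mulr_ge0 ?exprn_ge0.
  exists (u n x); exists n => // k /= nk.
  rewrite /ball /= distrC -(subnKC nk); apply: (le_lt_trans (uA x n _ Ax)).
  apply: le_lt_trans sn; rewrite -/s ler_wpM2l// lerBlDr lerDl exprn_ge0//.
(* Cutting off outside A makes the sequence converge everywhere, so the limit is measurable. *)
pose v x := limn (fun n => u n x * \1_A x).
have cv x : (u n x * \1_A x) @[n --> \oo] --> v x.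
  suff : cvgn (fun n => u n x * \1_A x) by [].
  case: (pselect (A x)) => Ax; last first.
    rewrite indicE memNset//; under eq_fun do rewrite mulr0; exact: is_cvg_cst.
  by rewrite indicE mem_set//; under eq_fun do rewrite mulr1; exact: cA.
exists v; split.
  apply: (measurable_fun_cvg (h := fun n x => u n x * \1_A x)).
    by move=> n; apply: measurable_funM => //; exact: measurable_indic.
  by move=> x _; exact: cv.
move=> n.
apply: (@le_trans _ _ (\int[m]_x ((4 * 4^-1 ^+ n)%:E * G x))%E); last first.
  rewrite ge0_integralZl//.
  apply: (le_trans (lee_wpmul2l _ iG)); first by rewrite lee_fin mulr_ge0 ?exprn_ge0.
  by rewrite -EFinM lee_fin; set z := _ ^+ n; lra.
have mv : measurable_fun setT v.
  apply: (measurable_fun_cvg (h := fun n x => u n x * \1_A x)).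
    by move=> k; apply: measurable_funM => //; exact: measurable_indic.
  by move=> x _; exact: cv.
apply: ge0_le_integral => //.
- by move=> x _; rewrite lee_fin sqr_ge0.
- by apply: measurable_sqr; exact: measurable_funB.
- exact: measurable_funeM.
move=> x _; case: (pselect (A x)) => Ax; last first.
  have -> : G x = +oo%E.
    by apply/eqP; rewrite -leye_eq leNgt; apply/negP.
  by rewrite gt0_muley ?leey// lte_fin mulr_gt0// exprn_gt0.
have GE : G x = (fine (G x))%:E by rewrite fineK// ge0_fin_numE.
have uv : u n x @[n --> \oo] --> v x.
  have := cv x; rewrite indicE mem_set//.
  by under eq_fun do rewrite mulr1.
have : `|v x - u n x| <= 2 * Num.sqrt (fine (G x)) * 2^-1 ^+ n.
  have h : `|u k x - u n x| @[k --> \oo] --> `|v x - u n x|.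
    by apply: cvg_norm; apply: cvgB => //; exact: cvg_cst.
  rewrite -(cvg_lim _ h)//; apply: limr_le; first exact: cvgP h.
  exists n => // k /= nk; rewrite -(subnKC nk); apply: (le_trans (uA x n _ Ax)).
  by rewrite ler_wpM2l ?mulr_ge0 ?sqrtr_ge0// lerBlDr lerDl exprn_ge0.
move=> h; rewrite GE -EFinM lee_fin -(real_normK (num_real (v x - u n x))).
apply: (@le_trans _ _ ((2 * Num.sqrt (fine (G x)) * 2^-1 ^+ n) ^+ 2)).
  by rewrite ler_pXn2r ?nnegrE// !mulr_ge0 ?sqrtr_ge0 ?exprn_ge0.
rewrite !exprMn sqr_sqrtr ?fine_ge0// -exprM mulnC exprM.
rewrite (_ : 2^-1 ^+ 2 = 4^-1 :> R); last by field.
by rewrite (_ : 2 ^+ 2 = 4 :> R); [rewrite mulrAC|ring].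
Qed.

End square_integrable.

(** * The Volterra equation *)

Section picard.
Context {dX} {X : measurableType dX} {R : realType}.
Variable m : {finite_measure set X -> \bar R}.
Variable tm : {finite_measure set (measurableTypeR R) -> \bar R}.
Variable S : measurableTypeR R -> measurableTypeR R -> bool.
Hypothesis mS : measurable_fun setT (ind S).
Implicit Types v w B : X * measurableTypeR R -> R.
Implicit Types b : X * X * measurableTypeR R -> R.

Notation mt := (m \x tm)%E.

Lemma integral_slice v : measurable_fun setT v ->
  (\int[tm]_t slice m v t = sqi mt v)%E.
Proof. by move=> mv; rewrite sqi_prodE. Qed.

Lemma le_integral_slice (rho : measurableTypeR R -> R) v w :
  measurable_fun setT rho -> (forall t, 0 <= rho t) ->
  measurable_fun setT v -> measurable_fun setT w ->
  {ae tm, forall t, {ae m, forall y, `|v (y, t)| <= `|w (y, t)|}} ->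
  (\int[tm]_t ((rho t)%:E * slice m v t) <=
   \int[tm]_t ((rho t)%:E * slice m w t))%E.
Proof.
move=> mrho rho0 mv mw vw.
have msv := measurable_slice m mv.
have msw := measurable_slice m mw.
apply: ae_ge0_le_integral => //.
- by move=> t _; rewrite mule_ge0 ?slice_ge0 ?lee_fin.
- by mfun.
- by move=> t _; rewrite mule_ge0 ?slice_ge0 ?lee_fin.
- by mfun.
apply: aeS vw => t vwt _; rewrite lee_wpmul2l ?lee_fin//.
by apply: le_sqi_ae => //; mfun.
Qed.

Lemma weight_bounds (rho : measurableTypeR R -> R) (r : R) v :
  measurable_fun setT rho -> 0 < r -> (forall t, r <= rho t <= r^-1) ->
  measurable_fun setT v ->
  (r%:E * sqi mt v <= \int[tm]_t ((rho t)%:E * slice m v t) /\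
   \int[tm]_t ((rho t)%:E * slice m v t) <= r^-1%:E * sqi mt v)%E.
Proof.
move=> mrho r0 rr mv; have msv := measurable_slice m mv.
rewrite -integral_slice// -!ge0_integralZl//; try by
  [move=> t _; exact: slice_ge0 | rewrite lee_fin ?invr_ge0 ltW].
have rho0 t : 0 <= rho t by have /andP[/(le_trans (ltW r0))] := rr t.
split; apply: ge0_le_integral => //; try by [mfun | apply: measurable_funeM |
  move=> t _; rewrite mule_ge0 ?slice_ge0 ?lee_fin// ltW].
- by move=> t _; rewrite lee_wpmul2r ?slice_ge0// lee_fin; have /andP[] := rr t.
- by move=> t _; rewrite lee_wpmul2r ?slice_ge0// lee_fin; have /andP[] := rr t.
Qed.

Lemma ae_sqi_lty dZ (Z : measurableType dZ) (n : {measure set Z -> \bar R})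
    (h : Z -> \bar R) : measurable_fun setT h -> (forall z, 0 <= h z)%E ->
  (\int[n]_z h z < +oo)%E -> {ae n, forall z, (h z < +oo)%E}.
Proof.
move=> mh h0 ih; have : n.-integrable setT h.
  apply/integrableP; split => //.
  by under eq_integral do rewrite gee0_abs//.
move=> /(integrable_ae measurableT); apply: aeS => z /(_ I).
by rewrite ge0_fin_numE.
Qed.

(** [app] is additive only where its integrals converge. Finite total energy makes almost every row
    b(y, ., t) square integrable, hence the nested almost-everywhere form of later identities. *)
Lemma good_kernel b : measurable_fun setT b ->
  (\int[tm]_t energy m b t < +oo)%E ->
  {ae tm, forall t, {ae m, forall y, sqint m (fun z => b (y, z, t))}}.
Proof.
move=> mb ib.
have := ae_sqi_lty (measurable_energy m mb) (fun t => sqi_ge0 _ _) ib.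
apply: aeS => t.
have mbt : measurable_fun setT (fun p : X * X => (b (p, t) ^+ 2)%:E).
  by apply: measurable_sqr; mfun.
have b0 (p : X * X) : (0 <= (b (p, t) ^+ 2)%:E)%E by rewrite lee_fin sqr_ge0.
rewrite /energy /sqi fubini_tonelli1// => h.
have := ae_sqi_lty (measurable_fun_fubini_tonelli_F _ mbt b0) _ h.
move=> {}h; have {h} : {ae m, forall y, (\int[m]_z (b (y, z, t) ^+ 2)%:E < +oo)%E}.
  by apply: h => y; apply: integral_ge0 => z _; exact: (b0 (y, z)).
apply: aeS => y hy; split => //.
by mfun.
Qed.

Lemma appB b f g y t : sqint m (fun z => b (y, z, t)) -> sqint m f ->
  sqint m g -> app m b (fun z => f z - g z) y t = app m b f y t - app m b g y t.
Proof.
move=> sb sf sg; rewrite /app -RintegralB//; last 2 first.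
- exact: (sqintM_integrable sb sf).
- exact: (sqintM_integrable sb sg).
by apply: eq_Rintegral => z _; rewrite mulrBr.
Qed.

Lemma app_ae_eq b f g y t : measurable_fun setT b ->
  measurable_fun setT f -> measurable_fun setT g -> ae_eq m setT f g ->
  app m b f y t = app m b g y t.
Proof.
move=> mb mf mg fg; apply: Rintegral_ae_eq; try by mfun.
by apply: aeS fg => z fg _; rewrite fg.
Qed.

Lemma sqint_cst (c : R) : sqint mt (fun=> c).
Proof.
split => //; rewrite sqi_prodE// /sqi.
rewrite [ltLHS](_ : _ = \int[tm]_t (cst ((c ^+ 2)%:E * m setT) t))%E; last first.
  by apply: eq_integral => t _; exact: (integral_cst m measurableT (c ^+ 2)%:E).
rewrite integral_cst// -ge0_fin_numE; last by rewrite !mule_ge0 ?lee_fin ?sqr_ge0.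
by rewrite !fin_numM// fin_num_measure.
Qed.

Lemma sqint_lipschitz (g : R -> R) (k : R) f : measurable_fun setT g ->
  (forall x y, `|g x - g y| <= k * `|x - y|) -> sqint mt f -> sqint mt (fun p => g (f p)).
Proof.
move=> mg gk sf; have [mf _] := sf.
have sk : sqint mt (fun p => g (f p) - g 0).
  apply: (sqint_le _ (sqintZ k sf)) => [|p].
    by apply: measurable_funB; [exact: measurableT_comp|exact: measurable_cst].
  apply: (le_trans (gk _ _)); rewrite subr0 normrM ler_wpM2r//; exact: ler_norm.
by have := sqintD sk (sqint_cst (g 0)); under eq_fun do rewrite subrK.
Qed.

Lemma sqint_slice_integrable v : sqint mt v ->
  {ae m, forall z, tm.-integrable setT (fun s => (v (z, s))%:E)}.
Proof.
move=> sv; have := sqintM_integrable sv (sqint_cst 1) => /ae_integrable1.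
by apply: aeS => z; under eq_fun do rewrite mulr1.
Qed.

Lemma ind_integrable (h : measurableTypeR R -> R) t :
  tm.-integrable setT (EFin \o h) ->
  tm.-integrable setT (fun s => (ind S (t, s) * h s)%:E).
Proof.
move=> ih; apply: (le_integrable measurableT _ _ ih).
  have mh : measurable_fun setT h by apply/measurable_EFinP; exact: measurable_int ih.
  by mfun.
move=> s _; rewrite lee_fin normrM.
by rewrite /ind; case: (S _ _); rewrite /= ?normr1 ?mul1r ?normr0 ?mul0r.
Qed.

(** Integrability of v(z, .) and w(z, .) over the whole time interval decides whether z is
    exceptional, so one null set serves all t. *)
Lemma volB v w : sqint mt v -> sqint mt w ->
  {ae m, forall z, forall t,
    vol tm S (fun p => v p - w p) (z, t) = vol tm S v (z, t) - vol tm S w (z, t)}.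
Proof.
move=> /sqint_slice_integrable iv /sqint_slice_integrable iw.
apply: aeI iv iw => z iv iw t; rewrite /vol /= -RintegralB//.
- by apply: eq_Rintegral => s _; rewrite mulrBr.
- exact: ind_integrable.
- exact: ind_integrable.
Qed.

Lemma slice_vol_le v t : measurable_fun setT v ->
  (slice m (vol tm S v) t <= tm setT * sqi mt v)%E.
Proof.
move=> mv; apply: (le_trans (slice_vol m tm mS t mv)); rewrite lee_wpmul2l//.
rewrite -integral_slice//; have msv := measurable_slice m mv.
apply: ge0_le_integral => //.
- by move=> s _; rewrite mule_ge0 ?slice_ge0 ?lee_fin ?ind_ge0.
- by mfun.
- move=> s _; rewrite -[leRHS]mul1e lee_wpmul2r ?slice_ge0// lee_fin.
  by rewrite /ind; case: (S _ _).
Qed.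

Lemma sqint_vol v t : sqint mt v -> sqint m (fun z => vol tm S v (z, t)).
Proof.
move=> [mv sv]; split; first by have := measurable_vol tm mS mv; move=> ?; mfun.
apply: (le_lt_trans (slice_vol_le t mv)).
by apply: lte_mul_pinfty => //; rewrite fin_num_measure.
Qed.

(** The energy is only integrable in time, so f has to be bounded in L^2 uniformly in time;
    trajectories are, by [slice_vol]. *)
Lemma sqint_app b (f : X * measurableTypeR R -> R) (M : R) :
  measurable_fun setT b -> (\int[tm]_t energy m b t < +oo)%E ->
  measurable_fun setT f -> (forall t, slice m f t <= M%:E)%E ->
  sqint mt (fun p => app m b (fun z => f (z, p.2)) p.1 p.2).
Proof.
move=> mb ib mf fM; have ma := measurable_app m mb mf; split => //.
have me := measurable_energy m mb.
rewrite -integral_slice//.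
have M0 : 0 <= M by rewrite -lee_fin; apply: le_trans (fM 0); exact: sqi_ge0.
apply: (@le_lt_trans _ _ (\int[tm]_t (M%:E * energy m b t))%E).
  apply: ge0_le_integral => //.
  - by move=> t _; exact: slice_ge0.
  - exact: measurable_slice.
  - exact: measurable_funeM.
  move=> t _; have mft : measurable_fun setT (fun z => f (z, t)) by mfun.
  apply: (le_trans (sqi_app m t mb mft)); rewrite muleC lee_wpmul2r//.
    exact: sqi_ge0.
  exact: fM.
rewrite ge0_integralZl// ?lee_fin//; last by move=> t _; exact: sqi_ge0.
by apply: lte_mul_pinfty; rewrite ?lee_fin.
Qed.

Hypothesis wS : has_weights tm S.

(** Picard iteration from 0 in the weighted norm [N]. The weight lies between two positive
    constants, so the geometric rate passes to the plain norm, and the contraction factor 1/16 is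
    the rate that [sqi_complete] asks for. *)
Theorem picard (g : R -> R) (k : R) (a : X * measurableTypeR R -> R) b f0 :
  measurable_fun setT g -> (forall x y, `|g x - g y| <= k * `|x - y|) ->
  sqint mt a -> measurable_fun setT b ->
  (\int[tm]_t energy m b t < +oo)%E -> sqint m f0 ->
  exists v : X * measurableTypeR R -> R, sqint mt v /\ forall y t,
    v (y, t) = g (a (y, t) - app m b (fun z => f0 z + vol tm S v (z, t)) y t).
Proof.
move=> mg gk sa mb ib sf0; have [ma _] := sa; have [mf0 _] := sf0.
have k0 : 0 <= k.
  by have := gk 0 1; rewrite sub0r normrN1 mulr1; apply: le_trans.
pose Fv v (q : X * measurableTypeR R) := f0 q.1 + vol tm S v q.
pose Phi v (p : X * measurableTypeR R) :=
  g (a p - app m b (fun z => Fv v (z, p.2)) p.1 p.2).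
have mFv v : measurable_fun setT v -> measurable_fun setT (Fv v).
  by move=> mv; have := measurable_vol tm mS mv => mvv; rewrite /Fv; mfun.
have mPhi v : measurable_fun setT v -> measurable_fun setT (Phi v).
  move=> mv; have := measurable_app m mb (mFv v mv) => mapp.
  exact: (measurableT_comp mg (measurable_funB ma mapp)).
have sFv v t : sqint mt v -> sqint m (fun z => Fv v (z, t)).
  by move=> sv; apply: sqintD => //; exact: sqint_vol.
have sPhi v : sqint mt v -> sqint mt (Phi v).
  move=> sv; have [mv fv] := sv.
  pose M : \bar R := (2%:E * sqi m f0 + 2%:E * (tm setT * sqi mt v))%E.
  have FM t : (slice m (Fv v) t <= M)%E.
    have [mvt _] := sqint_vol t sv.
    apply: (le_trans (sqiD m mf0 mvt)); rewrite leeD2l// lee_wpmul2l ?lee_fin//.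
    exact: slice_vol_le.
  have ME : M = (fine M)%:E.
    apply: ge0_fineK; first by rewrite /M adde_ge0// ?mule_ge0 ?sqi_ge0.
    by case: sf0 => _ ?; apply: lty_double_sum => //; rewrite lte_mul_pinfty// fin_num_measure.
  have sapp := sqint_app mb ib (mFv v mv) (M := fine M).
  apply: (sqint_lipschitz mg gk (sqintB sa (sapp _))) => t.
  by rewrite -ME.
have lip v w : sqint mt v -> sqint mt w -> {ae tm, forall t, {ae m, forall y,
    `|Phi v (y, t) - Phi w (y, t)| <=
    `|k * app m b (fun z => vol tm S (fun p => v p - w p) (z, t)) y t|}}.
  move=> sv sw; have [mv _] := sv; have [mw _] := sw.
  have mvw : measurable_fun setT (fun p => v p - w p) by mfun.
  apply: aeS (good_kernel mb ib) => t; apply: aeS => y sb.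
  apply: (le_trans (gk _ _)).
  rewrite distrC /= (_ : forall x y z : R, x - y - (x - z) = z - y); last first.
    by move=> *; ring.
  rewrite -appB//; [|exact: sFv..].
  rewrite normrM (ger0_norm k0) ler_wpM2l//.
  have [mv1 _] := sFv v t sv; have [mw1 _] := sFv w t sw.
  have [mvol _] := sqint_vol t (sqintB sv sw).
  rewrite (@app_ae_eq b (fun z => Fv v (z, t) - Fv w (z, t))
    (fun z => vol tm S (fun p => v p - w p) (z, t)))//.
    by mfun.
  apply: aeS (volB sv sw) => z vw _; rewrite vw /Fv /=.
  by rewrite opprD addrACA subrr add0r.
have e0 : (0 : R) < 16^-1 by rewrite invr_gt0.
have [rho [mrho [r r0 rr] crho]] := volterra_contraction m mS wS k
  (measurable_energy m mb) (fun t => sqi_ge0 _ _) ib e0.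
have rho0 t : 0 <= rho t by have /andP[/(le_trans (ltW r0))] := rr t.
pose N v := (\int[tm]_t ((rho t)%:E * slice m v t))%E.
have contr v w : sqint mt v -> sqint mt w ->
    (N (fun p => (Phi v p - Phi w p)%R) <= 16^-1%:E * N (fun p => (v p - w p)%R))%E.
  move=> sv sw; have [mv _] := sv; have [mw _] := sw.
  have mvw : measurable_fun setT (fun p => v p - w p) by mfun.
  have mv1 := mPhi v mv; have mw1 := mPhi w mw.
  have mvv := measurable_vol tm mS mvw.
  have mA := measurable_app m mb mvv.
  pose B p := k * app m b (fun z => vol tm S (fun p => v p - w p) (z, p.2)) p.1 p.2.
  have mB : measurable_fun setT B := measurable_funM (measurable_cst k) mA.
  apply: (@le_trans _ _ (N B)).
    by apply: (le_integral_slice mrho rho0 (measurable_funB mv1 mw1) mB); exact: lip.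
  exact: (crho b).
pose u := fix u n := if n is n'.+1 then Phi (u n') else (fun=> 0).
have su n : sqint mt (u n).
  by elim: n => [|n ih]; [exact: sqint0|exact: sPhi].
pose D n p := u n.+1 p - u n p.
have sD n : sqint mt (D n) by exact: sqintB.
have ND n : (N (D n) <= (16^-1 ^+ n)%:E * N (D 0%N))%E.
  elim: n => [|n ih]; first by rewrite expr0 mul1e.
  apply: (le_trans (contr _ _ (su n.+1) (su n))).
  by rewrite exprS EFinM -muleA lee_wpmul2l// lee_fin ltW.
pose s0 := fine (sqi mt (D 0%N)).
have s0E : sqi mt (D 0%N) = s0%:E.
  by rewrite fineK// ge0_fin_numE ?sqi_ge0//; case: (sD 0%N).
have s00 : 0 <= s0 by exact/fine_ge0/sqi_ge0.
(* One factor r^-1 bounds the weighted norm by the plain one, the other returns to the plain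
   norm. *)
pose C := r^-1 * (r^-1 * s0).
have C0 : 0 <= C by rewrite !mulr_ge0 ?invr_ge0// ltW.
have sqN v (x : R) : measurable_fun setT v -> (N v <= x%:E)%E ->
    (sqi mt v <= (r^-1 * x)%:E)%E.
  move=> mv; have [h _] := weight_bounds mrho r0 rr mv => /(le_trans h) {}h.
  rewrite EFinM -(@lee_pmul2l _ r%:E) ?lte_fin//.
  by rewrite -!EFinM mulrA divff ?gt_eqF// mul1r.
have uC n : (sqi mt (fun p => (u n.+1 p - u n p)%R) <= (C * 16^-1 ^+ n)%:E)%E.
  rewrite /C -mulrA; apply: sqN; first by case: (sD n).
  apply: (le_trans (ND n)).
  have [_] := weight_bounds mrho r0 rr (sD 0%N).1; rewrite s0E => h.
  rewrite [leRHS]EFinM muleC lee_wpmul2r ?lee_fin ?exprn_ge0 ?invr_ge0//.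
have [v [mv vu]] := sqi_complete (fun n => (su n).1) C0 uC.
have sv : sqint mt v.
  split => //.
  have := vu 0%N; rewrite /= expr0 mulr1; under [X in sqi _ X]eq_fun do rewrite subr0.
  by move=> /le_lt_trans; apply; rewrite ltry.
have vPhi : ae_eq mt setT v (Phi v).
  have svP := sqintB sv (sPhi v sv).
  suff : sqi mt (fun p => v p - Phi v p) = 0%E.
    move=> /(sqi_eq0 _ svP.1); apply: aeS => p /(_ I) /eqP.
    by rewrite subr_eq0 => /eqP.
  (* The difference is split at the iterate n + 1: the first summand covers its distance to v, the
     second the contraction applied to u n - v, with a factor r^-1 for each change of norm. *)
  pose K := 16 * C + 2 * (r^-1 * (16^-1 * (r^-1 * (8 * C)))).
  have KP n : (sqi mt (fun p => (v p - Phi v p)%R) <= (K * 4^-1 ^+ n)%:E)%E.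
    have sB := sqintB sv (su n.+1).
    have sA := sqintB (su n.+1) (sPhi v sv).
    rewrite (_ : (fun p => v p - Phi v p) =
      (fun p => (v p - u n.+1 p) + (u n.+1 p - Phi v p))); last first.
      by apply/funext => p; rewrite addrA subrK.
    apply: (le_trans (sqiD _ sB.1 sA.1)).
    have h1 := vu n.+1.
    have h2 : (sqi mt (fun p => (u n.+1 p - Phi v p)%R) <=
        (r^-1 * (16^-1 * (r^-1 * (8 * C * 4^-1 ^+ n))))%:E)%E.
      apply: sqN sA.1 _; apply: (le_trans (contr _ _ (su n) sv)).
      rewrite EFinM lee_wpmul2l ?lee_fin ?invr_ge0//.
      have sC := sqintB (su n) sv.
      have [_ h] := weight_bounds mrho r0 rr sC.1; apply: (le_trans h).
      rewrite EFinM lee_wpmul2l ?lee_fin ?invr_ge0 ?(ltW r0)//.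
      apply: le_trans (vu n); apply: le_sqi; [exact: sC.1|exact: (sqintB sv (su n)).1|].
      by move=> p; rewrite distrC.
    apply: (le_trans (leeD (lee_wpmul2l _ h1) (lee_wpmul2l _ h2))); rewrite ?lee_fin//.
    rewrite /K exprS.
    have : 0 <= (4^-1 : R) ^+ n by rewrite exprn_ge0.
    set z := _ ^+ n => z0; have := mulr_ge0 C0 z0; set y := r^-1 => Cz.
    suff -> : (16 * C + 2 * (y * (16^-1 * (y * (8 * C))))) * z =
      16 * (C * z) + 2 * (y * (16^-1 * (y * (8 * C * z)))) by clear -Cz; lra.
    by clear; ring.
  apply/eqP; rewrite eq_le sqi_ge0 andbT.
  apply/lee_addgt0Pr => e e0'; rewrite add0e.
  have : K * 4^-1 ^+ n @[n --> \oo] --> K * 0.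
    apply: cvgM; first exact: cvg_cst.
    by apply: cvg_expr; rewrite ger0_norm// invf_lt1// ltr1n.
  rewrite mulr0 => /cvgr0Pnorm_lt /(_ e e0') [n _ /(_ n (leqnn n)) /= Kn].
  apply: (le_trans (KP n)); rewrite lee_fin; apply: ltW; apply: le_lt_trans Kn.
  exact: ler_norm.
(* v satisfies the equation only almost everywhere. [Phi v] agrees with v off a null set, which
   [app] after [vol] does not see, so [Phi v] satisfies the equation at every point. *)
exists (Phi v); split; first exact: sPhi.
move=> y t; rewrite [LHS]/Phi; congr (g (_ - _)).
have [mv1 _] := sFv v t sv; have [mv2 _] := sFv (Phi v) t (sPhi v sv).
apply: app_ae_eq; [exact: mb|exact: mv1|exact: mv2|].
have sP := sqintB sv (sPhi v sv).
have : slice m (vol tm S (fun p => v p - Phi v p)) t = 0%E.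
  apply/eqP; rewrite eq_le slice_ge0 andbT; apply: (le_trans (slice_vol_le t sP.1)).
  rewrite (_ : sqi mt (fun p => v p - Phi v p) = 0%E) ?mule0//.
  by apply/(sqi_eq0 _ sP.1); apply: aeS vPhi => p vp _; rewrite vp// subrr.
move=> /(sqi_eq0 _ (sqint_vol t sP).1).
apply: aeI (volB sv (sPhi v sv)) => z vol0 /(_ I) /= vz _.
rewrite /Fv; congr (_ + _).
by move: vz; rewrite vol0 => /eqP; rewrite subr_eq0 => /eqP.
Qed.

End picard.

(** * Fubini and transposition of kernels *)

Section fubini_real.
Context {dX dY} {X : measurableType dX} {Y : measurableType dY} {R : realType}.
Variables (m : {sigma_finite_measure set X -> \bar R}).
Variables (n : {sigma_finite_measure set Y -> \bar R}).

Lemma Rintegral_prod1 (h : X * Y -> R) :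
  (m \x n)%E.-integrable setT (EFin \o h) ->
  \int[(m \x n)%E]_p h p = \int[m]_x \int[n]_y h (x, y).
Proof.
move=> ih; have mh : measurable_fun setT h by apply/measurable_EFinP; exact: measurable_int ih.
congr fine; rewrite -(integral12_prod_meas1 ih); apply: ae_eq_integral => //.
- exact: (measurable_fubini_F ih).
- by apply/measurable_EFinP; exact: measurable_integralr.
apply: aeS (ae_integrable1 ih) => x ix _.
by rewrite /fubini_F /Rintegral fineK//; exact: integrable_fin_num.
Qed.

Lemma Rintegral_prod2 (h : X * Y -> R) :
  (m \x n)%E.-integrable setT (EFin \o h) ->
  \int[(m \x n)%E]_p h p = \int[n]_y \int[m]_x h (x, y).
Proof.
move=> ih; have mh : measurable_fun setT h by apply/measurable_EFinP; exact: measurable_int ih.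
congr fine; rewrite -(integral21_prod_meas1 ih); apply: ae_eq_integral => //.
- exact: (measurable_fubini_G ih).
- apply/measurable_EFinP; apply: (measurable_integralr m (f := fun p : Y * X => h (p.2, p.1))).
  by mfun.
apply: aeS (ae_integrable2 ih) => x ix _.
by rewrite /fubini_G /Rintegral fineK//; exact: integrable_fin_num.
Qed.

Lemma sqint_tensor (f : X -> R) (g : Y -> R) : sqint m f -> sqint n g ->
  sqint (m \x n)%E (fun p => f p.1 * g p.2).
Proof.
move=> [mf sf] [mg sg]; have mfg : measurable_fun setT (fun p : X * Y => f p.1 * g p.2) by mfun.
split => //; rewrite sqi_prodE//.
have -> : (\int[n]_y sqi m (fun x => (f (x, y).1 * g (x, y).2)%R) =
    \int[n]_y (sqi m f * (g y ^+ 2)%:E))%E.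
  apply: eq_integral => y _; rewrite muleC -sqiZ//; congr sqi.
  by apply/funext => x /=; rewrite mulrC.
rewrite ge0_integralZl//; last 3 first.
- exact: measurable_sqr.
- by move=> y _; rewrite lee_fin sqr_ge0.
- exact: sqi_ge0.
by apply: lte_mul_pinfty; rewrite ?sqi_ge0// ge0_fin_numE// sqi_ge0.
Qed.

Lemma kernel_integrable (k : X * Y -> R) f g : sqint (m \x n)%E k ->
  sqint m f -> sqint n g ->
  (m \x n)%E.-integrable setT (EFin \o (fun p => k p * (f p.1 * g p.2))).
Proof.
by move=> sk sf sg; exact: (sqintM_integrable sk (sqint_tensor sf sg)).
Qed.

Lemma sqint_slice1 (k : X * Y -> R) : sqint (m \x n)%E k ->
  {ae m, forall x, sqint n (fun y => k (x, y))}.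
Proof.
move=> [mk]; rewrite /sqi fubini_tonelli1//; last 2 first.
- exact: measurable_sqr.
- by move=> p; rewrite lee_fin sqr_ge0.
have mk2 := measurable_sqr mk.
have k0 (p : X * Y) : (0 <= (k p ^+ 2)%:E)%E by rewrite lee_fin sqr_ge0.
have := ae_sqi_lty (measurable_fun_fubini_tonelli_F (m2 := n) _ mk2 k0) (n := m).
move=> h /h {}h; have {}h := h (fun x => integral_ge0 _ (fun y _ => k0 (x, y))).
by apply: aeS h => x hx; split => //; mfun.
Qed.

Lemma sqint_slice2 (k : X * Y -> R) : sqint (m \x n)%E k ->
  {ae n, forall y, sqint m (fun x => k (x, y))}.
Proof.
move=> [mk]; rewrite sqi_prodE// => h.
have := ae_sqi_lty (measurable_sqi m mk) (fun y => sqi_ge0 _ _) h.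
by apply: aeS => y hy; split => //; mfun.
Qed.

(** The product k(x, y) f(x) g(y) pairs two square integrable functions on the product space, so it
    is integrable and both sides are its iterated integrals. *)
Lemma kernel_adjoint (k : X * Y -> R) f g : sqint (m \x n)%E k ->
  sqint m f -> sqint n g ->
  \int[m]_x (f x * \int[n]_y (k (x, y) * g y)) =
  \int[n]_y (g y * \int[m]_x (k (x, y) * f x)).
Proof.
move=> sk sf sg; have := kernel_integrable sk sf sg => ik.
have [mk _] := sk; have [mf _] := sf; have [mg _] := sg.
have m1 : measurable_fun setT (fun x => \int[n]_y (k (x, y) * g y)).
  by apply: (measurable_integralr n (f := fun p : X * Y => k p * g p.2)); mfun.
have m1' : measurable_fun setT (fun x => \int[n]_y (k (x, y) * (f x * g y))).
  apply: (measurable_integralr n (f := fun p : X * Y => k p * (f p.1 * g p.2))).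
  by mfun.
have m2 : measurable_fun setT (fun y => \int[m]_x (k (x, y) * f x)).
  by apply: (measurable_integralr m (f := fun p : Y * X => k (p.2, p.1) * f p.2)); mfun.
have m2' : measurable_fun setT (fun y => \int[m]_x (k (x, y) * (f x * g y))).
  apply: (measurable_integralr m
    (f := fun p : Y * X => k (p.2, p.1) * (f p.2 * g p.1))).
  by mfun.
transitivity (\int[(m \x n)%E]_p (k p * (f p.1 * g p.2))).
  rewrite Rintegral_prod1//; apply: Rintegral_ae_eq => //; first by mfun.
  apply: aeS (sqint_slice1 sk) => x sx _.
  rewrite -RintegralZl//; last exact: (sqintM_integrable sx sg).
  by apply: eq_Rintegral => y _ /=; rewrite mulrCA.
rewrite Rintegral_prod2//; apply: Rintegral_ae_eq => //; first by mfun.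
apply: aeS (sqint_slice2 sk) => y sy _.
rewrite -RintegralZl//; last exact: (sqintM_integrable sy sf).
by apply: eq_Rintegral => x _ /=; rewrite [f x * _]mulrC mulrCA.
Qed.

End fubini_real.

Section cauchy_schwarz_real.
Context {dX} {X : measurableType dX} {R : realType}.
Variable m : {measure set X -> \bar R}.

Lemma sqi_fineK f : sqint m f -> sqi m f = (fine (sqi m f))%:E.
Proof. by move=> [_ h]; rewrite fineK// ge0_fin_numE// sqi_ge0. Qed.

Lemma Rcauchy_schwarz (f g : X -> R) : sqint m f -> sqint m g ->
  (\int[m]_x (f x * g x)) ^+ 2 <= fine (sqi m f) * fine (sqi m g).
Proof.
move=> sf sg; rewrite -lee_fin [leRHS]EFinM -!sqi_fineK//.
by apply: cauchy_schwarz; [case: sf|case: sg].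
Qed.

(** Half of the geometric decay is spent: the series of 2^n d_n^2 still has a finite integral, hence
    is finite almost everywhere, and there d_n^2 <= G 2^-n. *)
Lemma ae_cvg0 (d : nat -> X -> R) (C : R) : (forall n, measurable_fun setT (d n)) ->
  0 <= C -> (forall n, (sqi m (d n) <= (C * 4^-1 ^+ n)%:E)%E) ->
  {ae m, forall x, d n x @[n --> \oo] --> (0 : R)}.
Proof.
move=> md C0 dC.
pose T n x := (2 ^+ n * d n x ^+ 2)%:E.
have T0 n x : (0 <= T n x)%E by rewrite lee_fin mulr_ge0 ?sqr_ge0 ?exprn_ge0.
have mT n : measurable_fun setT (T n).
  by apply/measurable_EFinP; apply: measurable_funM => //; exact: measurable_funX.
pose G x := (\sum_(n <oo) T n x)%E.
have mG : measurable_fun setT G.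
  by apply: ge0_emeasurable_sum => // n _ x _; exact: T0.
have G0 x : (0 <= G x)%E by apply: nneseries_ge0 => n _ _; exact: T0.
have iG : (\int[m]_x G x <= (2 * C)%:E)%E.
  rewrite integral_nneseries//.
  apply: lime_le; first by apply: is_cvg_nneseries => n _ _; exact: integral_ge0.
  apply: nearW => n.
  apply: (@le_trans _ _ (\sum_(0 <= i < n) (C * 2^-1 ^+ i)%:E)%E).
    apply: lee_sum => i _; rewrite /T.
    under eq_integral do rewrite EFinM.
    rewrite ge0_integralZl//; last 2 first.
    - exact: measurable_sqr.
    - by move=> x _; rewrite lee_fin sqr_ge0.
    apply: (le_trans (lee_wpmul2l _ (dC i))); first by rewrite lee_fin exprn_ge0.
    rewrite -EFinM lee_fin mulrCA -exprMn.
    by rewrite (_ : 2 * 4^-1 = 2^-1) //; field.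
  apply: (@le_trans _ _ (2 * C * (1 - 2^-1 ^+ n))%:E); last first.
    by rewrite lee_fin -[leRHS]mulr1 ler_wpM2l ?mulr_ge0// lerBlDr lerDl exprn_ge0.
  elim: n => [|n ih]; first by rewrite big_geq// subrr mulr0.
  rewrite big_nat_recr//=; apply: (le_trans (leeD2r _ ih)).
  rewrite -EFinD lee_fin exprS.
  have : 0 <= (2^-1 : R) ^+ n by rewrite exprn_ge0.
  set z := _ ^+ n; move=> z0; have : 0 <= C * z by rewrite mulr_ge0.
  lra.
have := ae_sqi_lty mG G0 (le_lt_trans iG (ltry _)).
apply: aeS => x Gx; have GE : G x = (fine (G x))%:E by rewrite fineK// ge0_fin_numE.
set g := fine (G x) in GE.
have g0 : 0 <= g by exact: fine_ge0.
have dg n : `|d n x| ^+ 2 <= g * 2^-1 ^+ n.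
  have : (T n x <= G x)%E.
    apply: (@le_trans _ _ (\sum_(0 <= j < n.+1) T j x)%E).
      by rewrite big_nat_recr//= leeDr// sume_ge0.
    by apply: nneseries_lim_ge => // j _ _; exact: T0.
  by rewrite GE lee_fin real_normK ?num_real// exprVn ler_pdivlMr ?exprn_gt0// mulrC.
apply/cvgr0Pnorm_le => e e0.
have : g * 2^-1 ^+ n @[n --> \oo] --> g * 0.
  apply: cvgM; first exact: cvg_cst.
  by apply: cvg_expr; rewrite ger0_norm// invf_lt1// ltr1n.
rewrite mulr0 => /cvgr0Pnorm_le /(_ (e ^+ 2)) h.
have {}h := h (exprn_gt0 2 e0).
apply: filterS h => n; rewrite ger0_norm ?mulr_ge0 ?exprn_ge0// => h.
have := le_trans (dg n) h.
by rewrite ler_pXn2r ?nnegrE// ltW.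
Qed.

End cauchy_schwarz_real.

Section fine_square_integral.
Context {dX} {X : measurableType dX} {R : realType}.
Variable m : {measure set X -> \bar R}.
Implicit Types f g : X -> R.

Lemma Rintegral_sqr f : \int[m]_x (f x * f x) = fine (sqi m f).
Proof. by []. Qed.

Lemma Rintegral_sqr_eq0 f : sqint m f -> \int[m]_x (f x * f x) = 0 ->
  ae_eq m setT f (cst 0).
Proof.
move=> sf; rewrite Rintegral_sqr// => f0.
by apply/(sqi_eq0 m sf.1); rewrite sqi_fineK// f0.
Qed.

Lemma sqintN f : sqint m f -> sqint m (fun x => - f x).
Proof. by move=> /(sqintZ (-1)); under eq_fun do rewrite mulN1r. Qed.

Lemma sqiB f g : measurable_fun setT f -> measurable_fun setT g ->
  (sqi m (fun x => (f x - g x)%R) <= 2%:E * sqi m f + 2%:E * sqi m g)%E.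
Proof.
move=> mf mg; have mg' : measurable_fun setT (fun x => -1 * g x) by mfun.
have := sqiD m mf mg'; rewrite (sqiZ m (-1) mg) sqrrN expr1n mul1e.
by under [in X in (X <= _)%E -> _]eq_fun do rewrite mulN1r.
Qed.

Lemma fine_sqi_ge0 f : 0 <= fine (sqi m f).
Proof. exact/fine_ge0/sqi_ge0. Qed.

Lemma fine_sqiD f g : sqint m f -> sqint m g ->
  fine (sqi m (fun x => f x + g x)) <= 2 * fine (sqi m f) + 2 * fine (sqi m g).
Proof.
move=> sf sg; have sfg := sqintD sf sg.
by rewrite -lee_fin EFinD !EFinM -!sqi_fineK//; apply: sqiD; [case: sf|case: sg].
Qed.

Lemma fine_sqiB f g : sqint m f -> sqint m g ->
  fine (sqi m (fun x => f x - g x)) <= 2 * fine (sqi m f) + 2 * fine (sqi m g).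
Proof.
move=> sf sg; have sfg := sqintB sf sg.
by rewrite -lee_fin EFinD !EFinM -!sqi_fineK//; apply: sqiB; [case: sf|case: sg].
Qed.

Lemma fine_sqiZ c f : sqint m f ->
  fine (sqi m (fun x => c * f x)) = c ^+ 2 * fine (sqi m f).
Proof. by move=> sf; rewrite (sqiZ m c sf.1) (sqi_fineK sf) -EFinM. Qed.

Lemma sqintMr f g (C : R) : sqint m f -> measurable_fun setT g ->
  (forall x, `|g x| <= C) -> sqint m (fun x => f x * g x).
Proof.
move=> sf mg gC; have [mf _] := sf.
apply: (sqint_le _ (sqintZ C sf)) => [|x]; first by mfun.
rewrite normrM mulrC normrM ler_wpM2r//.
by apply: (le_trans (gC _)); exact: ler_norm.
Qed.

End fine_square_integral.

(** The term 2 * (1/4) nx is half of nx and moves to the left because nx is finite, which gives nx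
    <= 4 ny; each r^-1 is a change of norm. *)
Lemma weighted_absorb {R : realType} (r : R) (x y nx ny : \bar R) : 0 < r ->
  (0 <= x)%E -> (x < +oo)%E -> (0 <= y)%E -> (y < +oo)%E -> (0 <= nx)%E -> (0 <= ny)%E ->
  (r%:E * x <= nx)%E -> (nx <= r^-1%:E * x)%E -> (ny <= r^-1%:E * y)%E ->
  (nx <= 2%:E * ny + 2%:E * (4^-1%:E * nx))%E ->
  (x <= (r^-1 * (4 * r^-1))%:E * y)%E.
Proof.
move=> r0; case: x => // x; case: y => // y _ _ _ _.
case: nx => [nx||]//; case: ny => [ny||]// _ _.
rewrite -!EFinM -!EFinD !lee_fin => h1 _ h2 h; have {}h : nx <= 4 * ny by lra.
rewrite -(ler_pM2l r0) !mulrA divff ?gt_eqF// mul1r.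
by rewrite -mulrA; apply: (le_trans h1); apply: (le_trans h); rewrite ler_wpM2l.
Qed.

(** * Stability under perturbation of the controls *)

Section stability.
Context {dX} {X : measurableType dX} {R : realType}.
Variable m : {finite_measure set X -> \bar R}.
Variable tm : {finite_measure set (measurableTypeR R) -> \bar R}.
Variable S : measurableTypeR R -> measurableTypeR R -> bool.
Hypothesis mS : measurable_fun setT (ind S).
Implicit Types v w A : X * measurableTypeR R -> R.
Implicit Types b : X * X * measurableTypeR R -> R.

Notation mt := (m \x tm)%E.

Definition traj (f0 : X -> R) v (p : X * measurableTypeR R) : R :=
  f0 p.1 + vol tm S v p.

Definition field (a : X * measurableTypeR R -> R) b f0 v p : R :=
  a p - app m b (fun z => traj f0 v (z, p.2)) p.1 p.2.

(* v is the time derivative of the trajectory, required to satisfy the equation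
   everywhere rather than almost everywhere. *)
Definition solves (sigma : R -> R) a b f0 v :=
  sqint mt v /\ forall p, v p = sigma (field a b f0 v p).

Lemma slice_volE v t M : measurable_fun setT v -> (tm setT * sqi mt v <= M%:E)%E ->
  (slice m (vol tm S v) t <= M%:E)%E.
Proof. by move=> mv; apply: le_trans; exact: slice_vol_le. Qed.

Lemma slice_vol_bound v : sqint mt v -> exists M : R, forall t,
  (slice m (vol tm S v) t <= M%:E)%E.
Proof.
move=> [mv sv]; exists (fine (tm setT * sqi mt v)) => t; apply: slice_volE => //.
rewrite fineK// fin_numM// ?fin_num_measure// ge0_fin_numE//; exact: sqi_ge0.
Qed.

Lemma slice_traj_bound f0 v : sqint m f0 -> sqint mt v -> exists M : R, forall t,
  (slice m (traj f0 v) t <= M%:E)%E.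
Proof.
move=> sf0 sv; have [M hM] := slice_vol_bound sv.
exists (2 * fine (sqi m f0) + 2 * M) => t.
have [mvt _] := sqint_vol mS t sv.
apply: (le_trans (sqiD m sf0.1 mvt)).
by rewrite [leRHS]EFinD !EFinM -sqi_fineK// leeD2l// lee_wpmul2l ?lee_fin//; exact: hM.
Qed.

Lemma measurable_traj f0 v : measurable_fun setT f0 -> measurable_fun setT v ->
  measurable_fun setT (traj f0 v).
Proof.
by move=> mf0 mv; have := measurable_vol tm mS mv => mvv; rewrite /traj; mfun.
Qed.

Lemma sqint_traj f0 v t : sqint m f0 -> sqint mt v ->
  sqint m (fun z => traj f0 v (z, t)).
Proof. by move=> sf0 sv; apply: sqintD => //; exact: sqint_vol. Qed.

Lemma sqint_bounded_slice f M : measurable_fun setT f ->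
  (forall t, slice m f t <= M%:E)%E -> sqint mt f.
Proof.
move=> mf fM; split => //; rewrite -integral_slice//.
have M0 : 0 <= M by rewrite -lee_fin; apply: le_trans (fM 0); exact: sqi_ge0.
apply: (@le_lt_trans _ _ (\int[tm]_t (cst M%:E t))%E).
  apply: ge0_le_integral => //.
  - by move=> t _; exact: slice_ge0.
  - exact: measurable_slice.
rewrite integral_cst//; apply: lte_mul_pinfty; rewrite ?lee_fin//.
by rewrite -ge0_fin_numE ?fin_num_measure.
Qed.

Lemma sqint_volp v : sqint mt v -> sqint mt (vol tm S v).
Proof.
move=> sv; have [M hM] := slice_vol_bound sv.
by apply: sqint_bounded_slice hM; apply: measurable_vol => //; case: sv.
Qed.

Lemma energyD b b' (s : R) t : measurable_fun setT b -> measurable_fun setT b' ->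
  `|s| <= 1 ->
  (energy m (fun p => (b p + s * b' p)%R) t <=
   2%:E * energy m b t + 2%:E * energy m b' t)%E.
Proof.
move=> mb mb' s1; rewrite /energy.
have m1 : measurable_fun setT (fun p : X * X => b (p, t)) by mfun.
have m2 : measurable_fun setT (fun p : X * X => b' (p, t)) by mfun.
apply: (le_trans (sqiD _ m1 (measurable_funM (measurable_cst s) m2))).
rewrite leeD2l// lee_wpmul2l ?lee_fin//; apply: le_sqi => //.
  exact: (measurable_funM (measurable_cst s) m2).
by move=> p; rewrite normrM ler_piMl.
Qed.

Lemma appDl b b' (s : R) f y t : sqint m (fun z => b (y, z, t)) ->
  sqint m (fun z => b' (y, z, t)) -> sqint m f ->
  app m (fun p => b p + s * b' p) f y t = app m b f y t + s * app m b' f y t.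
Proof.
move=> sb sb' sf; have i1 := sqintM_integrable sb sf.
have i2 := sqintM_integrable sb' sf.
rewrite /app -RintegralZl// -RintegralD//; last first.
  exact: (integrableZl measurableT s i2).
by apply: eq_Rintegral => z _; rewrite mulrDl mulrA.
Qed.

Lemma slice_normD A v t : measurable_fun setT A -> measurable_fun setT v ->
  (slice m (fun p => (`|A p| + `|v p|)%R) t <=
   2%:E * slice m A t + 2%:E * slice m v t)%E.
Proof.
move=> mA mv; have mAt : measurable_fun setT (fun y => A (y, t)) by mfun.
have mvt : measurable_fun setT (fun y => v (y, t)) by mfun.
have nA : measurable_fun setT (fun y => `|A (y, t)|) by exact: measurableT_comp.
have nv : measurable_fun setT (fun y => `|v (y, t)|) by exact: measurableT_comp.
apply: (le_trans (sqiD m nA nv)).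
apply: leeD; rewrite lee_wpmul2l ?lee_fin//.
  by apply: (le_sqi m nA mAt) => y; rewrite normr_id.
by apply: (le_sqi m nv mvt) => y; rewrite normr_id.
Qed.

Hypothesis wS : has_weights tm S.

(** A Gronwall inequality in L^2: in the weighted norm the Volterra term contracts by 1/4, so after
    squaring the sum it can be absorbed. The constant depends on c and k alone, hence is uniform
    over all kernels with energy at most c. *)
Lemma stability (c : measurableTypeR R -> \bar R) (k : R) :
  measurable_fun setT c -> (forall t, 0 <= c t)%E -> (\int[tm]_t c t < +oo)%E ->
  exists2 C : R, 0 <= C & forall b w A, measurable_fun setT b ->
    (forall t, energy m b t <= c t)%E -> sqint mt w -> sqint mt A ->
    {ae tm, forall t, {ae m, forall y, `|w (y, t)| <=
      `|A (y, t)| + `|k * app m b (fun z => vol tm S w (z, t)) y t|}} ->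
    (sqi mt w <= C%:E * sqi mt A)%E.
Proof.
move=> mc c0 ic; have e0 : (0 : R) < 4^-1 by rewrite invr_gt0.
have [rho [mrho [r r0 rr] crho]] := volterra_contraction m mS wS k mc c0 ic e0.
have rho0 t : 0 <= rho t by have /andP[/(le_trans (ltW r0))] := rr t.
exists (r^-1 * (4 * r^-1)); first by rewrite !mulr_ge0 ?invr_ge0// ltW.
move=> b w A mb bc sw sA wA; have [mw _] := sw; have [mA _] := sA.
pose N v := (\int[tm]_t ((rho t)%:E * slice m v t))%E.
have [B [mB NB wB]] : exists B, [/\ measurable_fun setT B,
    (N B <= 4^-1%:E * N w)%E &
    {ae tm, forall t, {ae m, forall y, `|w (y, t)| <= `|A (y, t)| + `|B (y, t)|}}].
  have mvv := measurable_vol tm mS mw; have mapp := measurable_app m mb mvv.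
  exists (fun p => k * app m b (fun z => vol tm S w (z, p.2)) p.1 p.2); split=> //.
  - exact: (measurable_funM (measurable_cst k) mapp).
  - exact: (crho b w _ mb mw (measurable_funM (measurable_cst k) mapp) bc).
have m2 v : measurable_fun setT v ->
    measurable_fun setT (fun t => (rho t)%:E * slice m v t)%E.
  by move=> mv; have := measurable_slice m mv => msv; mfun.
have p2 v t : (0 <= (rho t)%:E * slice m v t)%E.
  by rewrite mule_ge0 ?slice_ge0 ?lee_fin.
have N0 v : (0 <= N v)%E by apply: integral_ge0.
have NwD : (N w <= 2%:E * N A + 2%:E * N B)%E.
  pose D p := `|A p| + `|B p|.
  have mD : measurable_fun setT D.
    by apply: measurable_funD; exact: measurableT_comp.
  apply: (@le_trans _ _ (N D)).
    apply: (le_integral_slice mrho rho0 mw mD); apply: aeS wB => t; apply: aeS => y.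
    by move=> h; rewrite /D [X in _ <= X]ger0_norm ?addr_ge0.
  rewrite -(ge0_integral_double_sum _ (m2 _ mA) (p2 A) (m2 _ mB) (p2 B)).
  apply: ge0_le_integral; first exact: measurableT.
  - by move=> t _; exact: p2.
  - exact: m2.
  - by apply: emeasurable_funD; apply: measurable_funeM; exact: m2.
  move=> t _; rewrite (muleCA 2%:E) (muleCA 2%:E) -ge0_muleDr; last 2 first.
  - by rewrite mule_ge0 ?slice_ge0 ?lee_fin.
  - by rewrite mule_ge0 ?slice_ge0 ?lee_fin.
  by rewrite lee_wpmul2l ?lee_fin//; exact: slice_normD.
have [Nw1 Nw2] := weight_bounds m tm mrho r0 rr mw.
have [NA1 NA2] := weight_bounds m tm mrho r0 rr mA.
rewrite -/(N w) in Nw1 Nw2; rewrite -/(N A) in NA1 NA2.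
apply: (weighted_absorb r0 (sqi_ge0 mt w) sw.2 (sqi_ge0 mt A) sA.2 (N0 w) (N0 A)
  Nw1 Nw2 NA2).
by apply: (le_trans NwD); rewrite leeD2l// lee_wpmul2l ?lee_fin.
Qed.

Section perturbation.
Variables (sigma : R -> R) (k : R).
Hypothesis k_lip : forall x y, `|sigma x - sigma y| <= k * `|x - y|.
Variables (a da : X * measurableTypeR R -> R).
Variables (b db : X * X * measurableTypeR R -> R) (f0 : X -> R).
Hypotheses (sa : sqint mt a) (sda : sqint mt da).
Hypotheses (mb : measurable_fun setT b) (mdb : measurable_fun setT db).
Hypothesis ib : (\int[tm]_t energy m b t < +oo)%E.
Hypothesis idb : (\int[tm]_t energy m db t < +oo)%E.
Hypothesis sf0 : sqint m f0.

Let pert s := solves sigma (fun p => a p + s * da p) (fun p => b p + s * db p) f0.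

Lemma sqint_field a' b' v : sqint mt a' -> measurable_fun setT b' ->
  (\int[tm]_t energy m b' t < +oo)%E -> sqint mt v ->
  sqint mt (field a' b' f0 v).
Proof.
move=> sa' mb' ib' sv; have [M hM] := slice_traj_bound sf0 sv.
apply: sqintB => //; apply: sqint_app hM => //.
by apply: measurable_traj; [case: sf0|case: sv].
Qed.

(** The initial datum cancels and the perturbed kernel acts on the difference of the trajectories,
    while the direction (da, db) acts on the unperturbed trajectory only. *)
Lemma field_diff s v w : sqint mt v -> sqint mt w ->
  {ae tm, forall t, {ae m, forall y,
    field (fun p => a p + s * da p) (fun p => b p + s * db p) f0 w (y, t) -
      field a b f0 v (y, t) =
    s * field da db f0 v (y, t) -
      app m (fun p => b p + s * db p)
        (fun z => vol tm S (fun p => w p - v p) (z, t)) y t}}.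
Proof.
move=> sv sw; apply: aeI (good_kernel mb ib) (good_kernel mdb idb) => t.
apply: aeI => y sb sdb.
have sbs : sqint m (fun z => b (y, z, t) + s * db (y, z, t)).
  by apply: sqintD => //; exact: sqintZ.
have st := sqint_traj t sf0 sv; have st' := sqint_traj t sf0 sw.
have sd := sqint_vol mS t (sqintB sw sv).
have -> : app m (fun p => b p + s * db p)
    (fun z => vol tm S (fun p => w p - v p) (z, t)) y t =
    app m (fun p => b p + s * db p) (fun z => traj f0 w (z, t) - traj f0 v (z, t)) y t.
  apply: app_ae_eq; [by mfun|by case: sd|by case: (sqintB st' st)|].
  apply: aeS (volB mS sw sv) => z h _; rewrite h /traj /=.
  by rewrite opprD addrACA subrr add0r.
rewrite (appB (b := fun p => b p + s * db p) sbs st' st) (appDl s sb sdb st).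
rewrite /field /=.
move: (app m b _ _ _) (app m db _ _ _) (app m _ _ _ _) => x1 x2 x3; ring.
Qed.

Lemma perturbation_bound v : solves sigma a b f0 v ->
  exists2 C : R, 0 <= C & forall s w, `|s| <= 1 -> pert s w ->
    (sqi mt (fun p => (w p - v p)%R) <= (C * s ^+ 2)%:E)%E.
Proof.
move=> [sv hv]; have me := measurable_energy m mb; have mde := measurable_energy m mdb.
have e0 b' t : (0 <= energy m b' t)%E by exact: sqi_ge0.
(* A majorant of the energy of b + s db for all |s| <= 1 at once, which makes the constant
   independent of s. *)
pose c t := (2%:E * energy m b t + 2%:E * energy m db t)%E.
have mc : measurable_fun setT c by apply: emeasurable_funD; exact: measurable_funeM.
have c0 t : (0 <= c t)%E by rewrite adde_ge0 ?mule_ge0 ?lee_fin.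
have ic : (\int[tm]_t c t < +oo)%E.
  rewrite (ge0_integral_double_sum tm me (e0 b) mde (e0 db)).
  exact: (lty_double_sum ib idb).
have [C C0 hC] := stability k mc c0 ic.
have sA := sqint_field sda mdb idb sv.
pose A := field da db f0 v.
exists (C * (k ^+ 2 * fine (sqi mt A))).
  by apply: mulr_ge0 => //; apply: mulr_ge0; [exact: sqr_ge0|exact/fine_ge0/sqi_ge0].
move=> s w s1 [sw hw].
have mbs : measurable_fun setT (fun p => b p + s * db p) by mfun.
have sAs := sqintZ (k * s) sA.
have := hC _ (fun p => w p - v p) _ mbs (fun t => energyD t mb mdb s1) (sqintB sw sv) sAs.
rewrite (sqiZ mt); last by case: sA.
rewrite (sqi_fineK sA) -!EFinM => h.
apply: (le_trans (h _)); last first.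
  by rewrite lee_fin exprMn -mulrA (mulrAC _ (s ^+ 2)).
apply: aeS (field_diff s sv sw) => t; apply: aeS => y E.
rewrite hv hw; apply: (le_trans (k_lip _ _)); rewrite E.
have k0 : 0 <= k by have := k_lip 0 1; rewrite sub0r normrN1 mulr1; apply: le_trans.
rewrite -mulrA !(normrM k) (ger0_norm k0) -mulrDr ler_wpM2l//.
exact: ler_normB.
Qed.

End perturbation.
End stability.

(** * The costate and directional derivatives *)

Section linearization.
Context {dX} {X : measurableType dX} {R : realType}.
Variable m : {finite_measure set X -> \bar R}.
Variable tm : {finite_measure set (measurableTypeR R) -> \bar R}.
Variable S : measurableTypeR R -> measurableTypeR R -> bool.
Hypothesis mS : measurable_fun setT (ind S).
Implicit Types v w : X * measurableTypeR R -> R.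
Implicit Types b : X * X * measurableTypeR R -> R.

Notation mt := (m \x tm)%E.

Definition flip (t s : measurableTypeR R) := S s t.

Lemma measurable_flip : measurable_fun setT (ind flip).
Proof.
rewrite (_ : ind flip = fun p => ind S (p.2, p.1)); first by mfun.
by apply/funext => -[].
Qed.

Lemma sqint_time_cst (c : R) : sqint tm (fun=> c).
Proof.
split => //; rewrite /sqi (integral_cst tm measurableT (c ^+ 2)%:E).
by apply: lte_mul_pinfty; rewrite ?lee_fin ?sqr_ge0// -ge0_fin_numE ?fin_num_measure.
Qed.

Lemma sqint_ind : sqint (tm \x tm)%E (ind S).
Proof.
apply: (sqint_le mS (sqint_tensor (sqint_time_cst 1) (sqint_time_cst 1))) => p.
by rewrite mulr1 normr1 /ind; case: (S _ _); rewrite ?normr1 ?normr0.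
Qed.

(** The indicator of the order is a square integrable kernel in time. Transposing it at almost every
    point of space reverses the order. *)
Lemma vol_dual v w : sqint mt v -> sqint mt w ->
  \int[mt]_p (vol tm flip v p * w p) = \int[mt]_p (v p * vol tm S w p).
Proof.
move=> sv sw; have mf := measurable_flip.
have svv := sqint_volp mf sv; have sww := sqint_volp mS sw.
rewrite (Rintegral_prod1 (sqintM_integrable svv sw)).
rewrite (Rintegral_prod1 (sqintM_integrable sv sww)).
have [mv _] := sv; have [mw _] := sw; have [mvv _] := svv; have [mww _] := sww.
apply: Rintegral_ae_eq.
- by apply: (measurable_integralr tm (f := fun p => vol tm flip v p * w p)); mfun.
- by apply: (measurable_integralr tm (f := fun p => v p * vol tm S w p)); mfun.
apply: aeI (sqint_slice1 sv) (sqint_slice1 sw) => z vz wz _.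
have := kernel_adjoint sqint_ind vz wz; rewrite /vol /= => ->.
by apply: eq_Rintegral => s _; rewrite mulrC.
Qed.

Definition transpose b (p : X * X * measurableTypeR R) := b (p.1.2, p.1.1, p.2).

Lemma energy_transpose b t : measurable_fun setT b ->
  energy m (transpose b) t = energy m b t.
Proof.
move=> mb; rewrite /energy /sqi.
have mbt : measurable_fun setT (fun p : X * X => (b (p, t) ^+ 2)%:E).
  by apply: measurable_sqr; mfun.
have mbt' : measurable_fun setT (fun p : X * X => (b (p.2, p.1, t) ^+ 2)%:E).
  by apply: (measurable_sqr (f := fun p : X * X => b (p.2, p.1, t))); mfun.
rewrite fubini_tonelli1//; last by move=> p; rewrite lee_fin sqr_ge0.
by rewrite fubini_tonelli2//; move=> p; rewrite lee_fin sqr_ge0.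
Qed.

(** Transposition in space at almost every time. The uniform bounds on the slices make both
    space-time products integrable. *)
Lemma app_dual b f g Mf Mg : measurable_fun setT b ->
  (\int[tm]_t energy m b t < +oo)%E ->
  measurable_fun setT f -> measurable_fun setT g ->
  (forall t, slice m f t <= Mf%:E)%E -> (forall t, slice m g t <= Mg%:E)%E ->
  \int[mt]_p (app m (transpose b) (fun z => f (z, p.2)) p.1 p.2 * g p) =
  \int[mt]_p (f p * app m b (fun z => g (z, p.2)) p.1 p.2).
Proof.
move=> mb ib mf mg fM gM.
have mbT : measurable_fun setT (transpose b) by rewrite /transpose; mfun.
have ibT : (\int[tm]_t energy m (transpose b) t < +oo)%E.
  by under eq_integral do rewrite energy_transpose//.
have sf := sqint_bounded_slice tm mf fM; have sg := sqint_bounded_slice tm mg gM.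
have saf := sqint_app mbT ibT mf fM; have sag := sqint_app mb ib mg gM.
have [maf _] := saf; have [mag _] := sag.
rewrite (Rintegral_prod2 (sqintM_integrable saf sg)).
rewrite (Rintegral_prod2 (sqintM_integrable sf sag)).
apply: Rintegral_ae_eq.
- apply: (measurable_integralr m (f := fun q : measurableTypeR R * X =>
    app m (transpose b) (fun z => f (z, q.1)) q.2 q.1 * g (q.2, q.1))).
  apply: measurable_funM; last by mfun.
  exact: (measurableT_comp maf (measurable_fun_pair measurable_snd measurable_fst)).
- apply: (measurable_integralr m (f := fun q : measurableTypeR R * X =>
    f (q.2, q.1) * app m b (fun z => g (z, q.1)) q.2 q.1)).
  apply: measurable_funM; first by mfun.
  exact: (measurableT_comp mag (measurable_fun_pair measurable_snd measurable_fst)).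
have := ae_sqi_lty (measurable_energy m mb) (fun t => sqi_ge0 _ _) ib.
apply: aeS => t et _.
have sbt : sqint (m \x m)%E (fun p => b (p, t)) by split => //; mfun.
have sft : sqint m (fun y => f (y, t)) by split; [mfun|exact: le_lt_trans (fM t) (ltry _)].
have sgt : sqint m (fun y => g (y, t)) by split; [mfun|exact: le_lt_trans (gM t) (ltry _)].
have := kernel_adjoint sbt sft sgt; rewrite /app /= => ->.
by apply: eq_Rintegral => y _; rewrite mulrC.
Qed.

Definition total w z : R := \int[tm]_s w (z, s).

Lemma total_dual q w : sqint m q -> sqint mt w ->
  \int[m]_z (q z * total w z) = \int[mt]_p (q p.1 * w p).
Proof.
move=> sq sw; have sq1 := sqint_tensor sq (sqint_time_cst 1).
have sq' : sqint mt (fun p => q p.1).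
  by move: sq1; under eq_fun do rewrite mulr1.
rewrite (Rintegral_prod1 (sqintM_integrable sq' sw)).
have [mq _] := sq; have [mw _] := sw.
have mt' : measurable_fun setT (total w) by exact: (measurable_integralr tm (f := w)).
apply: Rintegral_ae_eq; first by mfun.
- by apply: (measurable_integralr tm (f := fun p => q p.1 * w p)); mfun.
apply: aeS (sqint_slice_integrable sw) => z iw _.
by rewrite /= /total -RintegralZl.
Qed.

(** For M = sigma'(..) this is the kernel of the linearized equation; its transpose drives the
    costate. *)
Definition scaled b (M : X * measurableTypeR R -> R) (p : X * X * measurableTypeR R) :=
  M (p.1.1, p.2) * b p.

(** The squared difference has zero inner integral at almost every time, so by Tonelli its
    space-time integral is 0. Joint measurability of f and g is what makes this possible. *)
Lemma nested_ae_eq (f g : X * measurableTypeR R -> R) :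
  measurable_fun setT f -> measurable_fun setT g ->
  {ae tm, forall t, {ae m, forall y, f (y, t) = g (y, t)}} -> ae_eq mt setT f g.
Proof.
move=> mf mg fg; have mfg : measurable_fun setT (fun p => f p - g p) by mfun.
suff : sqi mt (fun p => f p - g p) = 0%E.
  by move=> /(sqi_eq0 _ mfg); apply: aeS => p /(_ I) /eqP; rewrite subr_eq0 => /eqP.
rewrite sqi_prodE// (ge0_ae_eq_integral (g := cst 0%E))//; last 3 first.
- exact: (measurable_sqi m mfg).
- by move=> t _; exact: sqi_ge0.
- apply: aeS fg => t fg _; apply/sqi_eq0; first by mfun.
  by apply: aeS fg => y fg _; rewrite fg subrr.
by rewrite integral0.
Qed.

Lemma sqi_app_prod b (f : X * measurableTypeR R -> R) (M : R) :
  measurable_fun setT b -> measurable_fun setT f ->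
  (forall t, slice m f t <= M%:E)%E ->
  (sqi mt (fun p => app m b (fun z => f (z, p.2)) p.1 p.2) <=
   M%:E * \int[tm]_t energy m b t)%E.
Proof.
move=> mb mf fM; have ma := measurable_app m mb mf.
have me := measurable_energy m mb.
have M0 : 0 <= M by rewrite -lee_fin; apply: le_trans (fM 0); exact: sqi_ge0.
rewrite -integral_slice// -ge0_integralZl ?lee_fin//; last first.
  by move=> t _; exact: sqi_ge0.
apply: ge0_le_integral => //.
- by move=> t _; exact: slice_ge0.
- exact: measurable_slice.
- exact: measurable_funeM.
move=> t _; have mft : measurable_fun setT (fun z => f (z, t)) by mfun.
apply: (le_trans (sqi_app m t mb mft)); rewrite muleC lee_wpmul2r//.
  exact: sqi_ge0.
exact: fM.
Qed.

Section costate.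
Variables (b : X * X * measurableTypeR R -> R) (M : X * measurableTypeR R -> R).
Variables (q : X -> R) (k : R).
Hypotheses (mb : measurable_fun setT b) (mM : measurable_fun setT M).
Hypothesis ib : (\int[tm]_t energy m b t < +oo)%E.
Hypothesis Mk : forall p, `|M p| <= k.
Hypothesis sq : sqint m q.

Lemma k_ge0 : 0 <= k.
Proof. by apply: le_trans (Mk (point, 0)). Qed.

Lemma measurable_scaled : measurable_fun setT (scaled b M).
Proof. by rewrite /scaled; mfun. Qed.

Lemma measurable_transpose_scaled : measurable_fun setT (transpose (scaled b M)).
Proof. by have := measurable_scaled; rewrite /transpose => ?; mfun. Qed.

Lemma energy_scaled : (\int[tm]_t energy m (scaled b M) t < +oo)%E.
Proof.
have me := measurable_energy m mb; have mes := measurable_energy m measurable_scaled.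
apply: (@le_lt_trans _ _ (\int[tm]_t ((k ^+ 2)%:E * energy m b t))%E).
  apply: ge0_le_integral => //.
  - by move=> t _; exact: sqi_ge0.
  - by mfun.
  move=> t _; have mbt : measurable_fun setT (fun p : X * X => b (p, t)) by mfun.
  rewrite /energy -(sqiZ (m \x m)%E)//; apply: le_sqi.
  - by have := measurable_scaled => ?; mfun.
  - by mfun.
  - by move=> p; rewrite /scaled !normrM ler_wpM2r// (ger0_norm k_ge0).
rewrite ge0_integralZl// ?lee_fin ?sqr_ge0//; last by move=> t _; exact: sqi_ge0.
by rewrite lte_mul_pinfty// lee_fin sqr_ge0.
Qed.

Lemma energy_transpose_scaled :
  (\int[tm]_t energy m (transpose (scaled b M)) t < +oo)%E.
Proof.
rewrite (eq_integral (energy m (scaled b M))); first exact: energy_scaled.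
by move=> t _; rewrite energy_transpose//; exact: measurable_scaled.
Qed.

Variable pi : X * measurableTypeR R -> R.
Hypothesis pi_solves : solves m tm flip id (fun=> 0) (transpose (scaled b M))
  (fun z => - q z) pi.

(** [pi] is the time derivative of the costate. The terminal value problem is an instance of the
    forward one: reversed order of time, identity activation, zero input, datum - q, so that the
    trajectory of [pi] is minus the costate. *)
Definition costate (p : X * measurableTypeR R) : R := q p.1 - vol tm flip pi p.

Lemma costate_slice_bound : exists K : R, forall t, (slice m costate t <= K%:E)%E.
Proof.
have sNq := sqintN sq.
have [K hK] := slice_traj_bound measurable_flip sNq pi_solves.1.
exists K => t; apply: le_trans (hK t).
rewrite /slice /sqi le_eqVlt; apply/orP; left; apply/eqP; apply: eq_integral => y _.
by rewrite /costate /traj -sqrrN opprB addrC.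
Qed.

Lemma measurable_costate : measurable_fun setT costate.
Proof.
have := measurable_vol tm measurable_flip pi_solves.1.1 => mv.
by case: sq => mq _; rewrite /costate; mfun.
Qed.

Lemma sqint_costate : sqint mt costate.
Proof.
have [K hK] := costate_slice_bound.
by apply: sqint_bounded_slice hK; exact: measurable_costate.
Qed.

Lemma costate_eq : {ae tm, forall t, {ae m, forall y,
  pi (y, t) = app m (transpose (scaled b M)) (fun z => costate (z, t)) y t}}.
Proof.
apply: aeS (good_kernel measurable_transpose_scaled energy_transpose_scaled) => t.
apply: aeS => y sb; have [_ ->] := pi_solves; rewrite /field /= add0r.
have sc : sqint m (fun z => costate (z, t)).
  have [K hK] := costate_slice_bound; split; last exact: le_lt_trans (hK t) (ltry _).
  by have := measurable_costate => ?; mfun.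
transitivity (- app m (transpose (scaled b M)) (fun z => 0 - costate (z, t)) y t).
  congr (- app _ _ _ _ _); apply/funext => z.
  by rewrite /traj /costate /= sub0r opprB addrC.
rewrite (appB sb (sqint0 m) sc) /app.
have -> : \int[m]_z (transpose (scaled b M) (y, z, t) * 0) = 0.
  by under eq_Rintegral do rewrite mulr0; rewrite /Rintegral integral0.
by rewrite sub0r opprK.
Qed.

(** Writing q as costate plus the backward integral of [pi], time duality moves the integral onto w,
    and the costate equation followed by spatial duality moves the kernel. It holds for every square
    integrable w, so w may be an exact finite difference of velocities. *)
Lemma costate_dual w : sqint mt w ->
  \int[m]_z (q z * total w z) = \int[mt]_p
    (costate p * (w p + M p * app m b (fun z => vol tm S w (z, p.2)) p.1 p.2)).
Proof.
move=> sw; have [spi _] := pi_solves.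
have sc := sqint_costate; have mc := measurable_costate.
have [K hK] := costate_slice_bound; have [G hG] := slice_vol_bound mS sw.
have sv := sqint_volp mS sw; have mv := sv.1; have [mw _] := sw.
have svp := sqint_volp measurable_flip spi; have [mpi _] := spi.
have mapp := measurable_app m mb mv.
have sapp := sqint_app mb ib mv hG.
have mapps := measurable_app m measurable_scaled mv.
have sapps := sqint_app measurable_scaled energy_scaled mv hG.
have mappt := measurable_app m measurable_transpose_scaled mc.
rewrite total_dual//.
transitivity (\int[mt]_p (costate p * w p) + \int[mt]_p (pi p * vol tm S w p)).
  rewrite -vol_dual// -RintegralD//; last 2 first.
  - exact: sqintM_integrable.
  - exact: sqintM_integrable.
  by apply: eq_Rintegral => p _; rewrite /costate -mulrDl subrK.
transitivity (\int[mt]_p (costate p * w p) + \int[mt]_p (costate p *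
    app m (scaled b M) (fun z => vol tm S w (z, p.2)) p.1 p.2)).
  congr (_ + _); rewrite -(app_dual measurable_scaled energy_scaled mc mv hK hG).
  apply: Rintegral_ae_eq; [by mfun|by apply: measurable_funM|].
  apply: nested_ae_eq; [by mfun|by apply: measurable_funM|].
  by apply: aeS costate_eq => t; apply: aeS => y ->.
rewrite -RintegralD//; last 2 first.
- exact: sqintM_integrable.
- exact: sqintM_integrable.
have mL := measurable_funD (measurable_funM mc mw) (measurable_funM mc mapps).
have mR := measurable_funM mc (measurable_funD mw (measurable_funM mM mapp)).
apply: Rintegral_ae_eq; [exact: mL|exact: mR|].
apply: nested_ae_eq; [exact: mL|exact: mR|].
apply: aeS (good_kernel mb ib) => t; apply: aeS => y sb.
rewrite -mulrDr; congr (_ * (_ + _)); rewrite /app /scaled /=.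
rewrite -RintegralZl//; last exact: (sqintM_integrable sb (sqint_vol mS t sw)).
by apply: eq_Rintegral => z _; rewrite mulrA.
Qed.

End costate.
End linearization.

(** * Limits of difference quotients of the terminal state *)

Section derivative.
Context {dX} {X : measurableType dX} {R : realType}.
Variable m : {finite_measure set X -> \bar R}.
Variable tm : {finite_measure set (measurableTypeR R) -> \bar R}.
Variable S : measurableTypeR R -> measurableTypeR R -> bool.
Hypothesis mS : measurable_fun setT (ind S).
Hypothesis wS : has_weights tm S.
Notation mt := (m \x tm)%E.

Variables (sigma : R -> R) (k : R).
Hypothesis k_lip : forall x y, `|sigma x - sigma y| <= k * `|x - y|.
Hypothesis sigma_derivable : forall x : R, derivable sigma x 1.
Hypothesis dsigma_continuous : continuous (derive1 sigma).

(** Inversion is continuous off 0 and takes the conventional value 0 at 0. This gives the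
    measurability of the quotient [eps]. *)
Lemma measurable_invr : measurable_fun setT (@GRing.inv R).
Proof.
have mN : measurable (~` [set (0 : R)]) by apply: measurableC; exact: measurable_set1.
rewrite -(setUv [set (0 : R)]); apply/measurable_funU => //; split.
  apply: (@eq_measurable_fun _ _ _ _ [set (0 : R)] (cst (0 : R))) => [x|].
    by rewrite inE => ->; rewrite invr0.
  exact: measurable_cst.
apply: open_continuous_measurable_fun; first by apply: closed_openC; exact: closed_eq.
by move=> x; rewrite inE => /eqP x0; exact: inv_continuous.
Qed.

Lemma sigma_measurable : measurable_fun setT sigma.
Proof.
apply: continuous_measurable_fun => x.
by apply: differentiable_continuous; apply/derivable1_diffP.
Qed.

Lemma lip_ge0 : 0 <= k.
Proof. by have := k_lip 0 1; rewrite sub0r normrN1 mulr1; apply: le_trans. Qed.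

Lemma dsigma_lim (x : R) :
  (sigma (h + x) - sigma x) / h @[h --> 0^'] --> (derive1 sigma x : R).
Proof.
have : h^-1 *: (sigma (h *: 1 + x) - sigma x) @[h --> 0^'] --> (derive1 sigma x : R).
  by rewrite derive1E; exact: sigma_derivable.
by under eq_fun => h do rewrite [h *: _]mulr1 [_ *: _]mulrC.
Qed.

(** The increments may vanish: the quotient is then 0 by convention, in accordance with the
    limit. *)
Lemma dsigma_cvg (x : R) (d : nat -> R) : d n @[n --> \oo] --> (0 : R) ->
  (sigma (x + d n) - sigma x - (derive1 sigma x : R) * d n) / d n
    @[n --> \oo] --> (0 : R).
Proof.
move=> d0; apply/cvgr0Pnorm_lt => e e0.
have := dsigma_lim (x := x); set l : R := derive1 sigma x.
move=> /cvgrPdist_lt /(_ e e0) /= [r r0 hr].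
move/cvgr0Pnorm_lt : d0 => /(_ r r0); apply: filterS => n dn.
have [->|dn0] := eqVneq (d n) 0; first by rewrite invr0 mulr0 normr0.
have := hr (d n); rewrite /ball /= sub0r normrN => /(_ dn dn0).
by rewrite distrC (addrC (d n)) [in X in _ -> X]mulrBl mulfK.
Qed.

Lemma dsigma_bound (x : R) : `|derive1 sigma x| <= k.
Proof.
have := dsigma_lim (x := x); set l : R := derive1 sigma x => hl.
have hn : `|(sigma (h + x) - sigma x) / h| @[h --> 0^'] --> `|l| by exact: cvg_norm.
rewrite -(cvg_lim _ hn)//; apply: limr_le; first exact: cvgP hn.
apply: filterS (nbhs_dnbhs_neq 0) => h h0.
rewrite normrM normfV ler_pdivrMr ?normr_gt0//.
by apply: (le_trans (k_lip _ _)); rewrite addrK.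
Qed.

Variables (a da : X * measurableTypeR R -> R).
Variables (b db : X * X * measurableTypeR R -> R) (f0 : X -> R).
Hypotheses (sa : sqint mt a) (sda : sqint mt da).
Hypotheses (mb : measurable_fun setT b) (mdb : measurable_fun setT db).
Hypothesis ib : (\int[tm]_t energy m b t < +oo)%E.
Hypothesis idb : (\int[tm]_t energy m db t < +oo)%E.
Hypothesis sf0 : sqint m f0.
Variable v : X * measurableTypeR R -> R.
Hypothesis v_solves : solves m tm S sigma a b f0 v.

Let zeta := field m tm S a b f0 v.
Let A := field m tm S da db f0 v.
Let M p : R := derive1 sigma (zeta p).
(* A geometric sequence of steps: the increments are O(step n) in L^2, hence
   summable in square, so they converge to 0 almost everywhere. *)
Let step (n : nat) : R := 4^-1 ^+ n.

Variable w : nat -> X * measurableTypeR R -> R.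
Hypothesis w_solves : forall n, solves m tm S sigma
  (fun p => a p + step n * da p) (fun p => b p + step n * db p) f0 (w n).

Variables (q : X -> R) (pi : X * measurableTypeR R -> R).
Hypothesis sq : sqint m q.
Hypothesis pi_solves : solves m tm (flip S) id (fun=> 0) (transpose (scaled b M))
  (fun z => - q z) pi.

Let P := costate tm S q pi.
Let dw n p := w n p - v p.
Let Bd n p := app m b (fun z => vol tm S (dw n) (z, p.2)) p.1 p.2.
Let Dd n p := app m db (fun z => vol tm S (dw n) (z, p.2)) p.1 p.2.
(** By [field_diff], this is almost everywhere the increment of the argument of [sigma] between v
    and w n. *)
Let delta n p := step n * A p - Bd n p - step n * Dd n p.
(** The relative remainder of the first-order expansion of [sigma]: at most 2 k, and small only
    where [delta] is, with no uniformity in p. *)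
Let eps n p :=
  (sigma (zeta p + delta n p) - sigma (zeta p) - M p * delta n p) / delta n p.

Let step0 n : 0 < step n. Proof. by rewrite exprn_gt0// invr_gt0. Qed.

Let step1 n : `|step n| <= 1.
Proof. by rewrite (ger0_norm (ltW (step0 n))) exprn_ile1// ?invr_ge0// invf_le1// ler1n. Qed.

Let sdw n : sqint mt (dw n).
Proof. by apply: sqintB; [case: (w_solves n)|case: v_solves]. Qed.

Let szeta : sqint mt zeta.
Proof. exact: (sqint_field mS sf0 sa mb ib v_solves.1). Qed.

Let sA : sqint mt A.
Proof. exact: (sqint_field mS sf0 sda mdb idb v_solves.1). Qed.

Let mM : measurable_fun setT M.
Proof.
have [mz _] := szeta; apply: (measurableT_comp _ mz).
exact: continuous_measurable_fun.
Qed.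

Let Mk p : `|M p| <= k. Proof. exact: dsigma_bound. Qed.

Let dw_bound : exists2 C : R, 0 <= C &
  forall n, (sqi mt (dw n) <= (C * step n ^+ 2)%:E)%E.
Proof.
have [C C0 hC] := perturbation_bound mS wS k_lip sda mb mdb ib idb sf0 v_solves.
by exists C => // n; exact: (hC _ _ (step1 n) (w_solves n)).
Qed.

Let vol_bound : exists2 C : R, 0 <= C &
  forall n t, (slice m (vol tm S (dw n)) t <= (C * step n ^+ 2)%:E)%E.
Proof.
have [C C0 hC] := dw_bound; exists (fine (tm setT) * C).
  by rewrite mulr_ge0// fine_ge0.
move=> n t; apply: (le_trans (slice_vol_le m tm mS t (sdw n).1)).
rewrite -mulrA EFinM fineK ?fin_num_measure// lee_wpmul2l//.
Qed.

Let measurable_vol_dw n : measurable_fun setT (vol tm S (dw n)).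
Proof. exact: (measurable_vol tm mS (sdw n).1). Qed.

Let sqint_app_dw c n : measurable_fun setT c -> (\int[tm]_t energy m c t < +oo)%E ->
  sqint mt (fun p => app m c (fun z => vol tm S (dw n) (z, p.2)) p.1 p.2).
Proof.
move=> mc ic; have [C _ hC] := vol_bound.
exact: (sqint_app mc ic (measurable_vol_dw n) (hC n)).
Qed.

Let sBd n : sqint mt (Bd n). Proof. exact: (sqint_app_dw n mb ib). Qed.
Let sDd n : sqint mt (Dd n). Proof. exact: (sqint_app_dw n mdb idb). Qed.

Let app_bound c : measurable_fun setT c -> (\int[tm]_t energy m c t < +oo)%E ->
  exists2 C : R, 0 <= C & forall n,
    fine (sqi mt (fun p => app m c (fun z => vol tm S (dw n) (z, p.2)) p.1 p.2)) <=
    C * step n ^+ 2.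
Proof.
move=> mc ic; have [C C0 hC] := vol_bound.
have I0 : (0 <= \int[tm]_t energy m c t)%E.
  by apply: integral_ge0 => t _; exact: sqi_ge0.
exists (C * fine (\int[tm]_t energy m c t)%E); first by rewrite mulr_ge0// fine_ge0.
move=> n; rewrite -lee_fin -(sqi_fineK (sqint_app_dw n mc ic)).
apply: (le_trans (sqi_app_prod tm mc (measurable_vol_dw n) (hC n))).
by rewrite (ge0_fineK I0 ic) -EFinM lee_fin mulrAC.
Qed.

Let sdelta n : sqint mt (delta n).
Proof.
exact: (sqintB (sqintB (sqintZ (step n) sA) (sBd n)) (sqintZ (step n) (sDd n))).
Qed.

Let delta_absorb (xA xB xD xAB CB CD u : R) :
  xAB <= 2 * (u * xA) + 2 * xB -> xB <= CB * u -> xD <= CD * u -> u * xD <= xD ->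
  2 * xAB + 2 * (u * xD) <= (4 * xA + 4 * CB + 2 * CD) * u.
Proof. lra. Qed.

Let delta_bound : exists2 C : R, 0 <= C &
  forall n, fine (sqi mt (delta n)) <= C * step n ^+ 2.
Proof.
have [CB CB0 hB] := app_bound mb ib; have [CD CD0 hD] := app_bound mdb idb.
exists (4 * fine (sqi mt A) + 4 * CB + 2 * CD).
  by rewrite !addr_ge0 ?mulr_ge0 ?fine_sqi_ge0.
move=> n; have sSA := sqintZ (step n) sA; have sSD := sqintZ (step n) (sDd n).
have h1 := fine_sqiB sSA (sBd n); have h2 := fine_sqiB (sqintB sSA (sBd n)) sSD.
rewrite fine_sqiZ// in h1; rewrite [in X in _ <= _ + X]fine_sqiZ// in h2.
apply: (le_trans h2); have hb := hB n; have hd := hD n; rewrite -/(Bd n) in hb.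
rewrite -/(Dd n) in hd.
have s2 : step n ^+ 2 <= 1.
  by rewrite -(ger0_norm (ltW (step0 n))) exprn_ile1.
have := ler_wpM2r (fine_sqi_ge0 mt (Dd n)) s2; rewrite mul1r.
by move=> hs; apply: (delta_absorb h1 hb hd hs).
Qed.

Let ms (f : X * measurableTypeR R -> R) :
  measurable_fun setT f -> measurable_fun setT (fun p => sigma (f p)).
Proof. by move=> mf; apply: measurableT_comp => //; exact: sigma_measurable. Qed.

Let deltaE n : ae_eq mt setT (fun p => dw n p)
  (fun p => sigma (zeta p + delta n p) - sigma (zeta p)).
Proof.
have [sv hv] := v_solves; have [sw hw] := w_solves n.
have [mz _] := szeta; have [md _] := sdelta n.
apply: nested_ae_eq; first by case: (sdw n).
  by apply: measurable_funB; apply: ms; [exact: (measurable_funD mz md)|exact: mz].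
have := field_diff mS a da mb mdb ib idb sf0 (step n) sv sw.
have gk := good_kernel mb ib; have gdk := good_kernel mdb idb.
move=> fd; apply: aeI (fd) _; last first.
  by apply: aeI gk gdk => t h1 h2; exact: (conj h1 h2).
move=> t h [gk1 gk2]; apply: aeI (h) _; last first.
  by apply: aeI gk1 gk2 => y h1 h2; exact: (conj h1 h2).
move=> y E [sb sdb]; rewrite /dw hw hv; congr (sigma _ - _).
have -> : delta n (y, t) = step n * A (y, t) - app m (fun p => b p + step n * db p)
    (fun z => vol tm S (dw n) (z, t)) y t.
  rewrite (appDl (step n) sb sdb); last exact: (sqint_vol mS t (sdw n)).
  by rewrite /delta opprD addrA.
by rewrite -/(zeta (y, t)) in E *; rewrite -E addrC subrK.
Qed.

Let sP : sqint mt P.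
Proof. exact: (sqint_costate mS sq pi_solves). Qed.

Let meps n : measurable_fun setT (eps n).
Proof.
have [md _] := sdelta n; have [mz _] := szeta.
apply: measurable_funM; last exact: (measurableT_comp measurable_invr md).
apply: measurable_funB; last exact: (measurable_funM mM md).
by apply: measurable_funB; apply: ms; [exact: (measurable_funD mz md)|exact: mz].
Qed.

Let eps_bound n p : `|eps n p| <= 2 * k.
Proof.
have k0 := lip_ge0; rewrite /eps; set d := delta n p; set z := zeta p.
have [->|d0] := eqVneq d 0; first by rewrite invr0 mulr0 normr0 mulr_ge0.
rewrite normrM normfV ler_pdivrMr ?normr_gt0//.
apply: (le_trans (ler_normB _ _)).
rewrite mulr_natl mulr2n mulrDl; apply: lerD.
  by apply: (le_trans (k_lip _ _)); rewrite addrC addKr.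
by rewrite normrM ler_wpM2r.
Qed.

Let Peps_le n p : `|P p * eps n p| <= `|2 * k * P p|.
Proof.
rewrite normrM [X in _ <= X]normrM mulrC ler_wpM2r//.
by apply: (le_trans (eps_bound n p)); exact: ler_norm.
Qed.

Let sPeps n : sqint mt (fun p => P p * eps n p).
Proof.
exact: (sqintMr sP (meps n) (eps_bound n)).
Qed.

Let sMA : sqint mt (fun p => M p * A p).
Proof.
by have := sqintMr sA mM Mk; under eq_fun do rewrite mulrC.
Qed.

Let sPM : sqint mt (fun p => P p * M p).
Proof.
exact: (sqintMr sP mM Mk).
Qed.

(** [delta] is O(4^-n) in L^2, hence tends to 0 almost everywhere, and so does [eps]. The weight P
    supplies the integrable majorant (2 k P)^2. *)
Let Peps_cvg : fine (sqi mt (fun p => P p * eps n p)) @[n --> \oo] --> (0 : R).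
Proof.
have [mP _] := sP; have [C C0 hC] := delta_bound.
have d0 : {ae mt, forall p, delta n p @[n --> \oo] --> (0 : R)}.
  apply: (@ae_cvg0 _ _ _ _ _ C) => // [n|n]; first by case: (sdelta n).
  rewrite (sqi_fineK (sdelta n)) lee_fin; apply: (le_trans (hC n)); rewrite ler_wpM2l//.
  by rewrite expr2 ler_piMl ?(ltW (step0 n))// (le_trans (ler_norm _)).
have f_cvg : {ae mt, forall p, setT p ->
    ((P p * eps n p) ^+ 2)%:E @[n --> \oo] --> (cst 0%E p : \bar R)}.
  apply: aeS d0 => p dp _; apply: cvg_EFin; first exact: nearW.
  rewrite [X in _ --> X](_ : _ = (P p * 0) ^+ 2); last by rewrite mulr0 expr0n.
  by apply: cvgM; apply: cvgM; [exact: cvg_cst|exact: dsigma_cvg|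
    exact: cvg_cst|exact: dsigma_cvg].
have ig : mt.-integrable setT (fun p => ((2 * k * P p) * (2 * k * P p))%:E).
  exact: (sqintM_integrable (sqintZ (2 * k) sP) (sqintZ (2 * k) sP)).
have f_le : {ae mt, forall p n, setT p ->
    (`|((P p * eps n p) ^+ 2)%:E| <= ((2 * k * P p) * (2 * k * P p))%:E)%E}.
  apply: aeW => p n _; rewrite gee0_abs ?lee_fin ?sqr_ge0//.
  rewrite -(real_normK (num_real (_ * _))) -expr2 -(real_normK (num_real (2 * k * _))).
  by rewrite ler_pXn2r ?nnegrE//; exact: Peps_le.
have mf n : measurable_fun setT (fun p => ((P p * eps n p) ^+ 2)%:E).
  by apply: measurable_sqr; have me := meps n; mfun.
have [_ _] := dominated_convergence measurableT mf (measurable_cst _) f_cvg ig f_le.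
by rewrite /= integral0 => /fine_cvgP[].
Qed.

Let sqr_cvg0 (u c : nat -> R) : (forall n, u n ^+ 2 <= c n) ->
  c n @[n --> \oo] --> (0 : R) -> u n @[n --> \oo] --> (0 : R).
Proof.
move=> uc c0; apply/cvgr0Pnorm_le => e e0.
move/cvgr0Pnorm_le : c0 => /(_ _ (exprn_gt0 2 e0)); apply: filterS => n cn.
have : `|u n| ^+ 2 <= e ^+ 2.
  rewrite real_normK ?num_real//; apply: (le_trans (uc n)).
  by apply: le_trans cn; exact: ler_norm.
by rewrite ler_pXn2r ?nnegrE// ltW.
Qed.

Let step_cvg0 : step n @[n --> \oo] --> (0 : R).
Proof. by apply: cvg_expr; rewrite ger0_norm// invf_lt1// ltr1n. Qed.

(** Expanding [sigma] gives dw + M Bd = step M A - step M Dd + eps delta, and the left-hand side is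
    the one paired with P in [costate_dual]. After division by the step, the Dd term is O(step), and
    the last term is bounded by |P eps| |delta| / step, a null sequence times a bounded one. *)
Theorem directional_derivative :
  (step n)^-1 * \int[m]_z (q z * total tm (dw n) z) @[n --> \oo] -->
  \int[mt]_p (P p * (M p * A p)).
Proof.
have [mP _] := sP; have [mA _] := sA.
have idn n : \int[m]_z (q z * total tm (dw n) z) =
    step n * \int[mt]_p (P p * (M p * A p)) -
    step n * \int[mt]_p ((P p * M p) * Dd n p) +
    \int[mt]_p ((P p * eps n p) * delta n p).
  rewrite (costate_dual mS mb mM ib Mk sq pi_solves (sdw n)).
  have i1 := sqintM_integrable sP sMA; have i2 := sqintM_integrable sPM (sDd n).
  have i3 := sqintM_integrable (sPeps n) (sdelta n).
  have me := meps n; have [md _] := sdelta n; have [mD _] := sDd n.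
  have [mB _] := sBd n; have [mw _] := sdw n.
  rewrite -!RintegralZl// -RintegralB//; last 2 first.
  - exact: (integrableZl measurableT (step n) i1).
  - exact: (integrableZl measurableT (step n) i2).
  rewrite -RintegralD//; last first.
    exact: (integrableB measurableT (integrableZl measurableT (step n) i1)
      (integrableZl measurableT (step n) i2)).
  apply: Rintegral_ae_eq.
  - by apply: measurable_funM => //; apply: measurable_funD => //; exact: measurable_funM.
  - by mfun.
  apply: aeS (deltaE n) => p /(_ I) E _; rewrite -/(Bd n p) E.
  have -> : sigma (zeta p + delta n p) - sigma (zeta p) =
      M p * delta n p + eps n p * delta n p.
    rewrite /eps; have [d0|d0] := eqVneq (delta n p) 0.
      by rewrite d0 !mulr0 addr0 addr0 subrr.
    by rewrite mulfVK// [RHS]addrC subrK.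
  rewrite -/(P p).
  have -> : delta n p = step n * A p - Bd n p - step n * Dd n p by [].
  move: (P p) (M p) (eps n p) (A p) (Bd n p) (Dd n p) => x1 x2 x3 x4 x5 x6; ring.
pose L := \int[mt]_p (P p * (M p * A p)).
pose u n := \int[mt]_p ((P p * M p) * Dd n p).
pose z n := (step n)^-1 * \int[mt]_p ((P p * eps n p) * delta n p).
have -> : (fun n => (step n)^-1 * \int[m]_x (q x * total tm (dw n) x)) =
    (fun n => L - u n + z n).
  apply/funext => n; rewrite idn mulrDr mulrBr !mulrA mulVf ?gt_eqF// !mul1r.
  by [].
rewrite -[X in _ --> X](_ : L - 0 + 0 = L); last by rewrite subr0 addr0.
have [CD CD0 hD] := app_bound mdb idb; have [Cd Cd0 hd] := delta_bound.
apply: cvgD; first apply: cvgB; first exact: cvg_cst.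
- apply: (sqr_cvg0 (c := fun n => fine (sqi mt (fun p => P p * M p)) * (CD * step n ^+ 2))).
    move=> n; apply: (le_trans (Rcauchy_schwarz sPM (sDd n))).
    by rewrite ler_wpM2l ?fine_sqi_ge0//; exact: hD.
  rewrite [X in _ --> X](_ : _ = fine (sqi mt (fun p => P p * M p)) * (CD * 0 ^+ 2));
    last by rewrite expr0n !mulr0.
  apply: cvgM; first exact: cvg_cst.
  by apply: cvgM; [exact: cvg_cst|apply: cvgM].
- apply: (sqr_cvg0 (c := fun n => fine (sqi mt (fun p => P p * eps n p)) * Cd)).
    move=> n; rewrite exprMn -(@ler_pM2l _ (step n ^+ 2)) ?exprn_gt0//.
    rewrite mulrA -exprMn divff ?gt_eqF// expr1n mul1r.
    apply: (le_trans (Rcauchy_schwarz (sPeps n) (sdelta n))).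
    by rewrite mulrCA ler_wpM2l ?fine_sqi_ge0// mulrC; exact: hd.
  rewrite [X in _ --> X](_ : _ = 0 * Cd); last by rewrite mul0r.
  by apply: cvgM => //; exact: cvg_cst.
Qed.

End derivative.

(** * Integration against a restricted measure *)

Section restricted_measure.
Context {dX} {X : measurableType dX} {R : realType}.
Variables (mu : {measure set X -> \bar R}) (D : set X) (mD : measurable D).
Import HBNNSimple.

Lemma ge0_integral_mrestr (f : X -> \bar R) : measurable_fun setT f ->
  (forall x, 0 <= f x)%E ->
  (\int[mrestr mu mD]_x f x = \int[mu]_(x in D) f x)%E.
Proof.
move=> mf f0; pose g := nnsfun_approx measurableT mf.
have g_cvg x : (EFin \o g ^~ x) n @[n --> \oo] --> f x by exact: cvg_nnsfun_approx.
have mg n : measurable_fun setT (fun x => (g n x)%:E) by exact/measurable_EFinP.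
have ndg x : {homo (fun n => (g n x)%:E) : a b / (a <= b)%N >-> (a <= b)%E}.
  by move=> a b ab; rewrite lee_fin; exact/lefP/nd_nnsfun_approx.
have lim1 := @cvg_monotone_convergence _ _ _ (mrestr mu mD) setT measurableT
  (fun n x => (g n x)%:E) mg.
have lim2 := @cvg_monotone_convergence _ _ _ mu D mD
  (fun n x => (g n x)%:E) (fun n => measurable_funTS (mg n)).
have fE : f = fun x => limn (fun n => (g n x)%:E).
  by apply/funext => x; apply/esym/cvg_lim => //; exact: g_cvg.
have gnn n x : (0 <= (g n x)%:E)%E by rewrite lee_fin; exact: fun_ge0.
have {}lim1 := lim1 (fun n x _ => gnn n x) (fun x _ => ndg x).
have {}lim2 := lim2 (fun n x _ => gnn n x) (fun x _ => ndg x).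
rewrite fE; apply: (cvg_unique _ lim1) => //.
rewrite (_ : (fun n => _) = fun n => (\int[mu]_(x in D) (g n x)%:E)%E)//.
apply/funext => n.
have gE x : (g n x)%:E = (\sum_(y \in range (g n)) (y * \1_(g n @^-1` [set y]) x)%:E)%E.
  by rewrite (fimfunE (g n)) fsumEFin.
under eq_integral do rewrite gE.
under [RHS]eq_integral do rewrite gE.
have m1 y (E : set X) : measurable_fun E (fun x => (y * \1_(g n @^-1` [set y]) x)%:E).
  by apply/measurable_EFinP; apply: measurable_funM => //; exact: measurable_indic.
have g0 y x : y \in range (g n) -> (0 <= (y * \1_(g n @^-1` [set y]) x)%:E)%E.
  by rewrite inE => -[z _ <-]; rewrite lee_fin mulr_ge0.
have h0 y x : (0 <= (y * \1_(g n @^-1` [set y]) x)%:E)%E.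
  rewrite lee_fin indicE; have [|] := boolP (x \in _); last by rewrite mulr0.
  by rewrite inE /= => <-; rewrite mulr1.
rewrite !ge0_integral_fsum//.
apply: eq_fsbigr => y yg.
have y0 : 0 <= y by move: yg; rewrite inE => -[z _ <-].
under eq_integral do rewrite EFinM.
under [RHS]eq_integral do rewrite EFinM.
have mi (E : set X) : measurable_fun E (fun x => (\1_(g n @^-1` [set y]) x)%:E : \bar R).
  by apply/measurable_EFinP; exact: measurable_indic.
rewrite !ge0_integralZl// ?lee_fin//; try by move=> x _; rewrite lee_fin.
congr (_ * _)%E; rewrite !integral_indic//.
by rewrite setIT.
Qed.

Lemma integral_mrestr (f : X -> \bar R) : measurable_fun setT f ->
  (\int[mrestr mu mD]_x f x = \int[mu]_(x in D) f x)%E.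
Proof.
move=> mf; rewrite [LHS]integralE [RHS]integralE; congr (_ - _)%E;
  by rewrite ge0_integral_mrestr//;
    (exact: measurable_funepos || exact: measurable_funeneg).
Qed.

Lemma Rintegral_mrestr (f : X -> R) : measurable_fun setT f ->
  \int[mrestr mu mD]_x f x = \int[mu]_(x in D) f x.
Proof.
by move=> mf; rewrite /Rintegral integral_mrestr//; exact/measurable_EFinP.
Qed.

Lemma ae_mrestr (P : X -> Prop) :
  {ae mrestr mu mD, forall x, P x} <-> {ae mu, forall x, D x -> P x}.
Proof.
split=> -[N [mN N0 PN]].
  exists (N `&` D); split => //; first exact: measurableI.
  by move=> x /= /not_implyP[Dx nPx]; split => //; exact: PN.
exists (N `|` ~` D); split => //.
- by apply: measurableU => //; exact: measurableC.
- rewrite /mrestr setIUl setICl setU0; apply/eqP.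
  rewrite eq_le measure_ge0 andbT -N0; apply: le_measure; rewrite ?inE//.
  exact: measurableI.
- move=> x /= nPx; have [Dx|] := pselect (D x); last by right.
  by left; apply: PN => /= /(_ Dx).
Qed.

End restricted_measure.

(** * Forward and backward time *)

Section time_weights.
Context {R : realType}.
Variable T : R.
Hypothesis T0 : 0 < T.

Lemma itv_lty : (@lebesgue_measure R `]0%R, T[%classic < +oo)%E.
Proof. by rewrite lebesgue_measure_itv/=; case: ifP => _; rewrite ?ltry. Qed.

Definition time_measure : {finite_measure set (measurableTypeR R) -> \bar R} :=
  @mfrestr _ (measurableTypeR R) R _ (@lebesgue_measure R)
    (@measurable_itv R `]0%R, T[) itv_lty.

Definition before (t s : measurableTypeR R) : bool := s <= t.

Lemma measurable_before : measurable_fun setT (ind before).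
Proof.
rewrite (_ : ind before = \1_[set p | before p.1 p.2]); last first.
  by apply/funext => p; rewrite indicE mem_setE.
apply: measurable_indic; rewrite -[X in measurable X]setTI.
have : measurable_fun setT (fun p : measurableTypeR R * measurableTypeR R => p.2 <= p.1).
  by apply: measurable_fun_ler; [exact: measurable_snd|exact: measurable_fst].
by move=> /(_ measurableT [set true] I).
Qed.

Lemma integral_expR_affine (c d x y : R) : c != 0 -> x < y ->
  (\int[lebesgue_measure]_(t in `[x, y]) (expR (c * t + d))%:E =
   (c^-1 * (expR (c * y + d) - expR (c * x + d)))%:E)%E.
Proof.
move=> c0 xy; pose F t := c^-1 * expR (c * t + d).
have dF t : is_derive t (1 : R) F (expR (c * t + d)).
  rewrite /F; apply: is_derive_eq.
  by rewrite addr0 [c%:A]mulr1 [_ *: _]mulrC mulfK.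
rewrite (@continuous_FTC2 _ _ F)//.
- by rewrite /F mulrBr EFinB.
- apply: continuous_subspaceT => t; apply: (@continuous_comp _ _ _ (fun t => c * t + d) expR).
    by apply: continuousD; [apply: continuousM => //; exact: cvg_cst|exact: cvg_cst].
  exact: continuous_expR.
- have cF t : {for t, continuous F}.
    by apply: differentiable_continuous; apply/derivable1_diffP.
  split; first by move=> t _.
  + by apply: cvg_at_right_filter; exact: cF.
  + by apply: cvg_at_left_filter; exact: cF.
- by move=> t _; rewrite derive1E; apply: derive_val.
Qed.

(** Time ranges over the whole line, where an exponential has no positive lower and finite upper
    bound; freezing its argument outside [0, T] restores both. *)
Definition clamp (t : R) := Num.max 0 (Num.min t T).

Lemma clamp_homo : {homo clamp : x y / x <= y}.
Proof. by move=> x y xy; rewrite /clamp le_max2// le_min2. Qed.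

Lemma clamp_itv t : 0 <= clamp t <= T.
Proof. by rewrite /clamp le_max lexx /= ge_max ltW//= ge_min lexx orbT. Qed.

Lemma clamp_id t : 0 < t < T -> clamp t = t.
Proof. by move=> /andP[t0 tT]; rewrite /clamp (min_idPl (ltW tT)) (max_idPr (ltW t0)). Qed.

Lemma measurable_clamp : measurable_fun setT clamp.
Proof. by apply: measurable_maxr => //; exact: measurable_minr. Qed.

Lemma weight_integral (S : measurableTypeR R -> measurableTypeR R -> bool)
    (c d : R) (s x y : R) : c != 0 -> x <= y ->
  measurable_fun setT (ind S) ->
  (forall t, 0 < t < T -> S t s -> x <= t <= y) ->
  (\int[time_measure]_t (ind S (t, s) * expR (c * clamp t + d))%:E <=
   (c^-1 * (expR (c * y + d) - expR (c * x + d)))%:E)%E.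
Proof.
move=> c0 xy mS Sxy; have mc := measurable_clamp; have me := @measurable_expR R.
have mi : measurable_fun setT (fun t => ind S (t, s)) by mfun.
have mec : measurable_fun setT (fun t => expR (c * clamp t + d)).
  by apply: (measurableT_comp me); mfun.
rewrite [leLHS]ge0_integral_mrestr//; last 2 first.
- by apply/measurable_EFinP; exact: measurable_funM.
- by move=> t; rewrite lee_fin mulr_ge0 ?ind_ge0 ?expR_ge0.
have me' : measurable_fun setT (fun t : R => (expR (c * t + d))%:E).
  by apply/measurable_EFinP; apply: (measurableT_comp me); mfun.
have hle : (\int[lebesgue_measure]_(t in `]0%R, T[) (ind S (t, s) * expR (c * clamp t + d))%:E <=
    \int[lebesgue_measure]_(t in `[x, y]) (expR (c * t + d))%:E)%E.
  rewrite integral_mkcond [leRHS]integral_mkcond; apply: ge0_le_integral => //.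
  - by move=> t _; rewrite patchE; case: ifP => // _; rewrite lee_fin mulr_ge0 ?ind_ge0 ?expR_ge0.
  - apply/(measurable_restrictT _ _).1 => //; apply: measurable_funTS.
    by apply/measurable_EFinP; exact: measurable_funM.
  - by apply/(measurable_restrictT _ _).1 => //; exact: measurable_funTS.
  move=> t _; rewrite !patchE; case: ifPn => [tT|_]; last first.
    by case: ifP => // _; rewrite lee_fin expR_ge0.
  have {}tT : 0 < t < T by move: tT; rewrite inE/= in_itv.
  rewrite (clamp_id tT) /ind /=; case: (boolP (S t s)) => ts; last first.
    by rewrite mul0r; case: ifP => // _; rewrite lee_fin expR_ge0.
  by rewrite mul1r ifT// inE/= in_itv/=; exact: Sxy.
apply: (le_trans hle); move: xy; rewrite le_eqVlt => /predU1P[->|xy].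
  by rewrite set_itv1 integral_set1 subrr mulr0.
by rewrite integral_expR_affine.
Qed.

Lemma expR_weight (c d : R) (S : measurableTypeR R -> measurableTypeR R -> bool) delta :
  (forall t s, S t s -> expR (c * clamp t + d) <= expR (c * clamp s + d)) ->
  (forall s, (\int[time_measure]_t (ind S (t, s) * expR (c * clamp t + d))%:E <=
     (delta * expR (c * clamp s + d))%:E)%E) ->
  exists rho : measurableTypeR R -> R, [/\ measurable_fun setT rho,
    exists2 k, 0 < k & forall t, k <= rho t <= k^-1,
    forall t s, S t s -> rho t <= rho s &
    forall s, (\int[time_measure]_t (ind S (t, s) * rho t)%:E <= (delta * rho s)%:E)%E].
Proof.
move=> Srho irho; exists (fun t => expR (c * clamp t + d)); split => //.
  apply: (measurableT_comp (@measurable_expR R)); have := measurable_clamp => mc.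
  by mfun.
exists (expR (- (`|c| * T + `|d|))); first exact: expR_gt0.
move=> t; rewrite -expRN opprK !ler_expR -ler_norml.
apply: (le_trans (ler_normD _ _)); rewrite lerD2r normrM ler_wpM2l//.
by have /andP[c1 c2] := clamp_itv t; rewrite ger0_norm.
Qed.

(** The weight is exp(- t / delta): its integral from s to T is delta (rho(s) - rho(T)), at most
    delta rho(s). *)
Lemma before_weights : has_weights time_measure before.
Proof.
move=> delta d0; pose c := - delta^-1.
have cN0 : c != 0 by rewrite oppr_eq0 invr_eq0 gt_eqF.
apply: (@expR_weight c 0).
  move=> t s; rewrite /before => /clamp_homo st.
  by rewrite !addr0 ler_expR /c !mulNr lerN2 ler_wpM2l// invr_ge0 ltW.
move=> s; have /andP[cs0 csT] := clamp_itv s.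
apply: (le_trans (weight_integral 0 (s := s) (x := clamp s) (y := T) cN0 csT measurable_before _)).
  move=> t tT; rewrite /before => /clamp_homo; rewrite (clamp_id tT) => ->.
  by case/andP: tT => _ /ltW.
rewrite lee_fin /c invrN invrK mulNr -mulrN opprB; apply: ler_wpM2l.
  exact: ltW.
by rewrite gerBl expR_ge0.
Qed.

(** The mirror image: exp(t / delta), integrated from 0 to s. *)
Lemma after_weights : has_weights time_measure (flip before).
Proof.
move=> delta d0; pose c := delta^-1.
have cN0 : c != 0 by rewrite invr_eq0 gt_eqF.
apply: (@expR_weight c 0).
  move=> t s; rewrite /flip /before => /clamp_homo st.
  by rewrite !addr0 ler_expR ler_wpM2l// invr_ge0 ltW.
move=> s; have /andP[cs0 csT] := clamp_itv s.
apply: (le_trans (weight_integral 0 (s := s) (x := 0) (y := clamp s) cN0 cs0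
  (measurable_flip measurable_before) _)).
  move=> t tT; rewrite /flip /before => /clamp_homo; rewrite (clamp_id tT) => ->.
  by case/andP: tT => /ltW ->.
rewrite lee_fin /c invrK; apply: ler_wpM2l; first exact: ltW.
by rewrite gerBl expR_ge0.
Qed.

End time_weights.

(** * Integration in time and the vanishing costate *)

Section time_integral.
Context {dX} {X : measurableType dX} {R : realType}.
Variable m : {finite_measure set X -> \bar R}.
Variable T : R.
Hypothesis T0 : 0 < T.
Notation tm := (time_measure T).
Notation mt := (m \x tm)%E.
Implicit Types v w : X * measurableTypeR R -> R.

Lemma ae_time (P : R -> Prop) : (forall t, 0 < t < T -> P t) -> {ae tm, forall t, P t}.
Proof.
by move=> h; apply/ae_mrestr; apply: aeW => t; rewrite /= in_itv/=; exact: h.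
Qed.

Lemma ae_time_neq (t : R) : {ae tm, forall s, s != t}.
Proof.
apply/ae_mrestr; exists [set t]; split.
- exact: measurable_set1.
- exact: lebesgue_measure_set1.
- by move=> s /= /not_implyP[_ /negP]; rewrite negbK => /eqP.
Qed.

Lemma ae_time_exists (P : R -> Prop) (e : R) : 0 < e ->
  {ae tm, forall t, t < e -> P t} -> exists2 t, 0 < t < Num.min e T & P t.
Proof.
move=> e0 [N [mN N0 PN]]; have d0 : 0 < Num.min e T by rewrite lt_min e0.
apply: contrapT => nP.
have sub : `]0%R, Num.min e T[%classic `<=` N `&` `]0%R, T[%classic.
  move=> t; rewrite /= in_itv/= => /[dup] td; rewrite lt_min => /and3P[t0 te tT].
  split; last by rewrite in_itv/= t0.
  by apply: PN => /= h; apply: nP; exists t => //; exact: h.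
have mu1 : lebesgue_measure (`]0%R, Num.min e T[%classic : set R) = (Num.min e T)%:E.
  by rewrite lebesgue_measure_itv/= lte_fin d0 sube0.
have := le_measure (@lebesgue_measure R) (mem_set (@measurable_itv R `]0%R, Num.min e T[))
  (mem_set (measurableI _ _ mN (@measurable_itv R `]0%R, T[))) sub.
rewrite [leLHS]mu1 [leRHS]N0 lee_fin; by rewrite leNgt d0.
Qed.

Lemma total_before w z : measurable_fun setT w ->
  total tm w z = vol tm before w (z, T).
Proof.
move=> mw; rewrite /total /vol; have mb := @measurable_before R.
apply: Rintegral_ae_eq; [by mfun|by mfun|].
apply: aeS (ae_time (P := fun s => s <= T) _) => [s sT _|t /andP[_ /ltW]//].
by rewrite /ind /= /before sT mul1r.
Qed.

Lemma total_split w : sqint mt w -> {ae m, forall z, forall t,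
  total tm w z = vol tm before w (z, t) + vol tm (flip before) w (z, t)}.
Proof.
move=> /[dup] -[mw _] /sqint_slice_integrable; apply: aeS => z iw t.
have mb := @measurable_before R; have mf := measurable_flip mb.
rewrite /vol /total /= -RintegralD//; last 2 first.
- exact: (ind_integrable mb).
- exact: (ind_integrable mf).
apply: Rintegral_ae_eq; [by mfun|by mfun|].
(* Both orders are reflexive, so s = t is counted twice; it is a null set. *)
apply: aeS (ae_time_neq t) => s st _; rewrite /ind /= /before /flip.
rewrite -mulrDl; move: st; case: (ltgtP s t) => //=; by rewrite ?addr0 ?add0r mul1r.
Qed.

Lemma sqint_total w : sqint mt w -> sqint m (total tm w).
Proof.
move=> sw; have [mw _] := sw; have := sqint_vol (@measurable_before R) T sw.
by under eq_fun => z do rewrite -(total_before z mw).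
Qed.

Lemma sqi_total w : sqint mt w ->
  (sqi m (total tm w) <= tm setT * sqi mt w)%E.
Proof.
move=> [mw _]; have := slice_vol_le m tm (@measurable_before R) T mw.
by rewrite /slice; under eq_fun => z do rewrite -(total_before z mw).
Qed.

Section vanish.
Variables (b : X * X * measurableTypeR R -> R) (M : X * measurableTypeR R -> R).
Variables (q : X -> R) (k : R) (pi : X * measurableTypeR R -> R).
Hypotheses (mb : measurable_fun setT b) (mM : measurable_fun setT M).
Hypothesis ib : (\int[tm]_t energy m b t < +oo)%E.
Hypothesis Mk : forall p, `|M p| <= k.
Hypothesis sq : sqint m q.
Hypothesis pi_solves : solves m tm (flip before) id (fun=> 0) (transpose (scaled b M))
  (fun z => - q z) pi.

(* Backward uniqueness: the costate equation is linear, so it can also be solved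
   forwards in time from a time at which the costate vanishes. *)
Lemma costate_vanish (e : R) : 0 < e ->
  {ae tm, forall t, t < e -> {ae m, forall y, costate tm before q pi (y, t) = 0}} ->
  ae_eq m setT q (cst 0).
Proof.
move=> e0 c0; have [spi _] := pi_solves; have [mpi _] := spi.
have mbf := @measurable_before R; have [mq _] := sq.
have ceq := costate_eq mbf mb mM ib Mk sq pi_solves.
have mc := measurable_costate mbf sq pi_solves.
have mbT := measurable_transpose_scaled mb mM.
have pi0 : {ae tm, forall t, t < e -> slice m pi t = 0%E}.
  apply: aeI c0 ceq => t ct pt te; apply/sqi_eq0; first by mfun.
  apply: aeS pt => y -> _.
  rewrite (@app_ae_eq _ _ _ _ _ _ (fun=> 0))//; [|by mfun|].
    by rewrite /app; under eq_Rintegral do rewrite mulr0; rewrite /Rintegral integral0.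
  by apply: aeS (ct te) => z cz _.
have [t0 t0e ct0] := ae_time_exists e0 c0.
have t0e' : t0 < e by move: t0e; rewrite lt_min => /and3P[].
have vol0 : slice m (vol tm before pi) t0 = 0%E.
  apply/eqP; rewrite eq_le slice_ge0 andbT.
  apply: (le_trans (slice_vol m tm mbf t0 mpi)).
  have mi : measurable_fun setT (fun s => ind before (t0, s)) by mfun.
  have msp := measurable_slice m mpi.
  rewrite (ge0_ae_eq_integral (g := cst 0%E))//; last 3 first.
  - by mfun.
  - by move=> s _; rewrite mule_ge0 ?slice_ge0 ?lee_fin ?ind_ge0.
  - apply: aeS pi0 => s ps _; rewrite /ind /= /before.
    by case: (leP s t0) => st; rewrite ?mul0e// ps ?mule0// (le_lt_trans st).
  by rewrite integral0 mule0.
have mv := measurable_vol tm mbf mpi.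
have {}vol0 : {ae m, forall z, vol tm before pi (z, t0) = 0}.
  have mvt : measurable_fun setT (fun z => vol tm before pi (z, t0)) by mfun.
  by move/(sqi_eq0 _ mvt): vol0; apply: aeS => z /(_ I).
(* The costate is 0 at t0, so q is the integral of [pi] from t0 to T; as [pi] vanishes before t0,
   this is its integral over all times. *)
have qtot : {ae m, forall z, q z = total tm pi z}.
  have h := total_split spi; apply: aeI (h) _; last by apply: aeI ct0 vol0 => z; exact: conj.
  move=> z hz [+ vz]; rewrite /costate /= => /eqP; rewrite subr_eq0 => /eqP ->.
  by rewrite (hz t0) vz add0r.
have cvol t : {ae m, forall z, costate tm before q pi (z, t) = vol tm before pi (z, t)}.
  apply: aeI qtot (total_split spi) => z qz hz.
  by rewrite /costate /= qz (hz t) addrK.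
have piE : {ae tm, forall t, {ae m, forall y,
    pi (y, t) = app m (transpose (scaled b M)) (fun z => vol tm before pi (z, t)) y t}}.
  apply: aeS ceq => t; apply: aeS => y ->.
  apply: app_ae_eq => //; [by mfun|by mfun|].
  by apply: aeS (cvol t) => z cz _.
have mebT := measurable_energy m mbT.
have iebT := energy_transpose_scaled mb mM ib Mk.
(* The costate is now the forward integral of [pi], which therefore solves a homogeneous Volterra
   equation in the direct order of time; the Gronwall bound with source 0 gives [pi] = 0. *)
have [C C0 hC] := stability m mbf (before_weights T0) 1 mebT (fun t => sqi_ge0 _ _) iebT.
have s0 : sqint mt (fun=> 0) by exact: sqint0.
have /= := hC _ pi (fun=> 0) mbT (fun t => lexx _) spi s0.
rewrite [X in (_ * X)%E]sqi0 mule0 => h.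
have sqpi : sqi mt pi = 0%E.
  apply/eqP; rewrite eq_le sqi_ge0 andbT; apply: h.
  by apply: aeS piE => t; apply: aeS => y {1}->; rewrite normr0 add0r mul1r.
have : sqi m (total tm pi) = 0%E.
  apply/eqP; rewrite eq_le sqi_ge0 andbT; apply: (le_trans (sqi_total spi)).
  by rewrite sqpi mule0.
move=> /(sqi_eq0 _ (sqint_total spi).1) h0.
by apply: aeI qtot h0 => z -> /(_ I) ->.
Qed.

End vanish.
End time_integral.

Section existence.
Context {dX} {X : measurableType dX} {R : realType}.
Variable m : {finite_measure set X -> \bar R}.
Variable tm : {finite_measure set (measurableTypeR R) -> \bar R}.
Variable S : measurableTypeR R -> measurableTypeR R -> bool.
Hypothesis mS : measurable_fun setT (ind S).
Hypothesis wS : has_weights tm S.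

Lemma solution_exists (g : R -> R) (k : R) a b f0 :
  measurable_fun setT g -> (forall x y, `|g x - g y| <= k * `|x - y|) ->
  sqint (m \x tm)%E a -> measurable_fun setT b ->
  (\int[tm]_t energy m b t < +oo)%E -> sqint m f0 ->
  exists v, solves m tm S g a b f0 v.
Proof.
move=> mg lip sa mb ib s0; have [v [sv ve]] := picard mS wS mg lip sa mb ib s0.
by exists v; split => // -[y t]; exact: ve.
Qed.

End existence.

(** * Vanishing of the adjoint data at a stationary control *)

Section small_perturbation.
Context {R : realType} {N : nat}.

(** If x E = 0 then x = x (G - E) G^-1, and for E close to G this map at least halves the sum of the
    absolute values of the entries. *)
Lemma unitmx_perturb (G : 'M[R]_N) : G \in unitmx -> exists2 d : R, 0 < d &
  forall (E : 'M[R]_N) (x : 'rV[R]_N), (forall i j, `|E i j - G i j| <= d) ->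
    x *m E = 0 -> x = 0.
Proof.
move=> uG; pose c := \sum_i \sum_j `|invmx G i j|.
have c0 : 0 <= c by apply: sumr_ge0 => i _; apply: sumr_ge0.
(* c sums the absolute values of the entries of the inverse, so c * d <= 1/2; the 1 ensures a
   nonzero denominator. *)
exists (2 * (c + 1))^-1; first by rewrite invr_gt0 mulr_gt0// ltr_wpDl.
move=> E x Ed xE; set d := (_)^-1 in Ed.
have d0 : 0 < d by rewrite invr_gt0 mulr_gt0// ltr_wpDl.
have -> : x = x *m (G - E) *m invmx G by rewrite mulmxBr xE subr0 mulmxK.
set s := \sum_i `|x ord0 i|.
have s0 : 0 <= s by apply: sumr_ge0.
have y_le i : `|(x *m (G - E)) ord0 i| <= d * s.
  rewrite mxE; apply: (le_trans (ler_norm_sum _ _ _)); rewrite mulr_sumr.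
  apply: ler_sum => j _; rewrite normrM mulrC ler_wpM2r//.
  by rewrite !mxE distrC Ed.
have x_le : s <= c * (d * s).
  have xG : x = x *m (G - E) *m invmx G by rewrite mulmxBr xE subr0 mulmxK.
  rewrite {1}/s {1}xG; under eq_bigr do rewrite mxE.
  rewrite /c exchange_big/= mulr_suml; apply: ler_sum => i _.
  apply: (le_trans (ler_norm_sum _ _ _)); rewrite mulr_suml; apply: ler_sum => j _.
  by rewrite normrM mulrC ler_wpM2l.
have {x_le y_le} s00 : s = 0.
  apply/eqP; rewrite eq_le s0 andbT.
  have cd : c * d <= 2^-1.
    rewrite /d invfM mulrCA ler_piMr ?invr_ge0// ler_pdivrMr ?mul1r ?ltr_wpDl//.
    by rewrite lerDl.
  have : s <= 2^-1 * s.
    by apply: (le_trans x_le); rewrite mulrA ler_wpM2r.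
  lra.
have x0 : x = 0.
  apply/rowP => i; rewrite mxE; apply/normr0_eq0/eqP.
  rewrite eq_le normr_ge0 andbT -s00 /s (bigD1 i)//= lerDl.
  by apply: sumr_ge0.
by rewrite {1}x0 !mul0mx.
Qed.

End small_perturbation.

Lemma Rintegral_bigsum dX (X : measurableType dX) (R : realType)
    (m : {measure set X -> \bar R}) (I : Type) (r : seq I) (F : I -> X -> R) :
  (forall i, m.-integrable setT (fun x => (F i x)%:E)) ->
  \int[m]_x (\sum_(i <- r) F i x) = \sum_(i <- r) \int[m]_x F i x.
Proof.
move=> iF; rewrite /Rintegral; under eq_integral do rewrite -sumEFin.
rewrite integral_sum//.
rewrite (eq_bigr (fun i => (fine (\int[m]_x (F i x)%:E))%:E)); first by rewrite sumEFin.
by move=> i _; rewrite fineK//; exact: integrable_fin_num (iF i).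
Qed.

Section gram_matrix.
Context {dX} {X : measurableType dX} {R : realType} {N : nat}.
Variable m : {measure set X -> \bar R}.
Variable phi : 'I_N -> X -> R.
Hypothesis sphi : forall j, sqint m (phi j).

Lemma Rintegral_sumM (f : X -> R) (c : 'I_N -> R) : sqint m f ->
  \int[m]_z (f z * \sum_j c j * phi j z) = \sum_j c j * \int[m]_z (f z * phi j z).
Proof.
move=> sf; under eq_Rintegral => z _.
  rewrite mulr_sumr; under eq_bigr do rewrite mulrCA.
  over.
rewrite Rintegral_bigsum//=.
  apply: eq_bigr => j _; rewrite RintegralZl//; exact: sqintM_integrable.
move=> j; have /= := sqintM_integrable sf (sqintZ (c j) (sphi j)).
by under eq_fun do rewrite mulrCA.
Qed.

(* The quadratic form of this matrix at c is
   (\sum_j c j) ^+ 2 + |\sum_j c j phi j| ^+ 2. *)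
Lemma affine_gram_unit : weakly_independent m setT phi ->
  (\matrix_(i, j) (1 + \int[m]_z (phi i z * phi j z))) \in unitmx.
Proof.
move=> indep; rewrite -row_free_unit; apply: inj_row_free => c cG.
pose f z := \sum_j c ord0 j * phi j z.
have sf : sqint m f by apply: sqint_sum => j; exact: sqintZ.
have quad : (\sum_j c ord0 j) ^+ 2 + \int[m]_z (f z * f z) = 0.
  have /matrixP/(_ ord0 ord0) : c *m (\matrix_(i, j) (1 +
    \int[m]_z (phi i z * phi j z))) *m c^T = 0 by rewrite cG mul0mx.
  rewrite !mxE => h; apply: (etrans _ h); rewrite [X in _ + X](_ : _ =
    \sum_j c ord0 j * \int[m]_z (f z * phi j z)); last exact: Rintegral_sumM.
  rewrite expr2 mulr_sumr -big_split/=; apply: eq_bigr => j _.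
  rewrite mulrC -mulrDr !mxE mulrC; congr (_ * _).
  under [in RHS]eq_bigr do rewrite mxE mulrDr mulr1.
  rewrite big_split/=; congr (_ + _).
  under eq_Rintegral => z _ do rewrite mulrC.
  rewrite Rintegral_sumM//; apply: eq_bigr => i _; congr (_ * _).
  by apply: eq_Rintegral => z _; rewrite mulrC.
have f0 : 0 <= \int[m]_z (f z * f z).
  by apply: Rintegral_ge0 => z _; rewrite -expr2 sqr_ge0.
have [sum0 int0] : \sum_j c ord0 j = 0 /\ \int[m]_z (f z * f z) = 0.
  by move: quad; move: f0 (sqr_ge0 (\sum_j c ord0 j)) => f0 s0 /eqP;
  rewrite paddr_eq0// => /andP[]; rewrite sqrf_eq0 => /eqP -> /eqP ->; split.
by apply/rowP => j; rewrite mxE; exact: (indep _ (Rintegral_sqr_eq0 sf int0)).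
Qed.

End gram_matrix.

Lemma cvg_bigsum (R : realType) (T : Type) (F : set_system T) (FF : Filter F)
    (I : Type) (r : seq I) (f : I -> T -> R) (l : I -> R) :
  (forall i, f i x @[x --> F] --> l i) ->
  \sum_(i <- r) f i x @[x --> F] --> \sum_(i <- r) l i.
Proof.
move=> fl; elim: r => [|i r ih].
  by under eq_fun do rewrite big_nil; rewrite big_nil; exact: cvg_cst.
by under eq_fun do rewrite big_cons; rewrite big_cons; exact: cvgD.
Qed.

Section kernels.
Context {dX} {X : measurableType dX} {R : realType}.
Variable m : {finite_measure set X -> \bar R}.
Variable tm : {finite_measure set (measurableTypeR R) -> \bar R}.
Implicit Types b : X * X * measurableTypeR R -> R.

Lemma energyD_lty b b' (s : R) : `|s| <= 1 ->
  measurable_fun setT b -> measurable_fun setT b' ->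
  (\int[tm]_t energy m b t < +oo)%E -> (\int[tm]_t energy m b' t < +oo)%E ->
  (\int[tm]_t energy m (fun p => (b p + s * b' p)%R) t < +oo)%E.
Proof.
move=> s1 mb mb' ib ib'.
have me := measurable_energy m mb; have me' := measurable_energy m mb'.
have msum : measurable_fun setT (fun p => b p + s * b' p) by mfun.
have e0 c t : (0 <= energy m c t)%E by exact: sqi_ge0.
apply: (le_lt_trans _ (lty_double_sum ib ib')).
rewrite -(ge0_integral_double_sum tm me (e0 b) me' (e0 b')).
apply: ge0_le_integral; first exact: measurableT.
- by move=> t _; exact: e0.
- exact: measurable_energy.
- by apply: emeasurable_funD; exact: measurable_funeM.
- by move=> t _; exact: energyD.
Qed.

Variables (th : X * measurableTypeR R -> R) (f : X -> R).
Hypotheses (sth : sqint (m \x tm)%E th) (sf : sqint m f).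

(* Together with da = th this direction turns da - db g into th * (1 + <f, g>). *)
Definition rank_one (p : X * X * measurableTypeR R) : R :=
  - (th (p.1.1, p.2) * f p.1.2).

Lemma measurable_rank_one : measurable_fun setT rank_one.
Proof.
have [mth _] := sth; have [mf _] := sf.
by rewrite /rank_one; apply: measurableT_comp => //; mfun.
Qed.

Lemma energy_rank_one t : energy m rank_one t = (sqi m f * slice m th t)%E.
Proof.
have [mth _] := sth; have [mf _] := sf; have mr := measurable_rank_one.
have mtt : measurable_fun setT (fun y => th (y, t)) by mfun.
rewrite /energy sqi_prodE; last by mfun.
under eq_integral => y _.
  rewrite /rank_one /= (_ : (fun x => _) = (fun x => - f y * th (x, t))); last first.
    by apply/funext => x; rewrite mulNr mulrC.
  rewrite sqiZ// sqrrN; over.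
rewrite ge0_integralZr//; last by apply: sqi_ge0.
- by apply: measurable_sqr.
- by move=> z _; rewrite lee_fin sqr_ge0.
Qed.

Lemma energy_rank_one_lty : (\int[tm]_t energy m rank_one t < +oo)%E.
Proof.
have [mth lth] := sth; have ms := measurable_slice m mth.
under eq_integral do rewrite energy_rank_one.
rewrite ge0_integralZl//; last 2 first.
- by move=> t _; exact: slice_ge0.
- exact: sqi_ge0.
by rewrite integral_slice// (sqi_fineK sf) lte_mul_pinfty ?lee_fin ?fine_ge0 ?sqi_ge0.
Qed.

Lemma app_rank_one g y t : sqint m g ->
  app m rank_one g y t = - (th (y, t) * \int[m]_z (f z * g z)).
Proof.
move=> sg; rewrite /app /rank_one /=.
under eq_Rintegral => z _ do rewrite -mulNr -mulrA.
by rewrite RintegralZl ?mulNr//; exact: sqintM_integrable.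
Qed.

End kernels.

Lemma sqi_nested dX (X : measurableType dX) (R : realType)
    (m : {finite_measure set X -> \bar R})
    (tm : {finite_measure set (measurableTypeR R) -> \bar R}) th :
  measurable_fun setT th -> sqi (m \x tm)%E th = 0%E ->
  {ae tm, forall t, {ae m, forall y, th (y, t) = 0}}.
Proof.
move=> mth th0; have ms := measurable_slice m mth.
have : (\int[tm]_t `|slice m th t|)%E = 0%E.
  under eq_integral do rewrite gee0_abs ?slice_ge0//.
  by rewrite integral_slice.
move=> /(ae_eq_integral_abs tm measurableT ms); apply: aeS => t /(_ I) st.
have mtt : measurable_fun setT (fun y => th (y, t)) by mfun.
by move/(sqi_eq0 _ mtt): st; apply: aeS => y /(_ I).
Qed.

Section early_times.
Context {dX} {X : measurableType dX} {R : realType}.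
Variable m : {finite_measure set X -> \bar R}.
Variable T : R.
Notation tm := (time_measure T).
Notation mt := (m \x tm)%E.
Implicit Types v w : X * measurableTypeR R -> R.

(** v itself is read as a Hilbert-Schmidt kernel applied to the function g of time. With g an
    indicator, or a difference of two, this bounds trajectories at small times and their
    increments. *)
Lemma sqi_time_weight v (g : measurableTypeR R -> R) :
  measurable_fun setT v -> measurable_fun setT g ->
  (sqi m (fun y => \int[tm]_s (g s * v (y, s))%R)%R <= sqi mt v * sqi tm g)%E.
Proof.
move=> mv mg; under eq_fun => y.
  under eq_Rintegral => s _ do rewrite mulrC.
  over.
exact: (sqi_kernel m tm mv mg).
Qed.

Lemma sqi_before (t : R) : 0 <= t -> (sqi tm (fun s => ind before (t, s)) <= t%:E)%E.
Proof.
move=> t0; have mb := @measurable_before R.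
rewrite /sqi ge0_integral_mrestr; last 2 first.
- by mfun.
- by move=> s; rewrite lee_fin sqr_ge0.
have -> : t%:E = (\int[lebesgue_measure]_(s in `]0%R, t]) 1)%E.
  rewrite integral_cst//= mul1e lebesgue_measure_itv/= lte_fin sube0.
  by case: ltgtP t0 => // <-.
rewrite integral_mkcond [leRHS]integral_mkcond; apply: ge0_le_integral => //.
- by move=> s _; apply: erestrict_ge0 => r _; rewrite lee_fin sqr_ge0.
- by apply/(measurable_restrictT _ _).1 => //; apply: measurable_funTS; mfun.
- by apply/(measurable_restrictT _ _).1 => //; exact: measurable_cst.
move=> s _; rewrite /patch; case: ifPn => [|_]; last by case: ifP.
rewrite inE/= in_itv/= => /andP[s0 _].
rewrite /ind /= /before; case: (leP s t) => st.
  by rewrite ifT ?lee_fin ?expr1n// inE/= in_itv/= s0.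
by rewrite expr0n; case: ifP => _; rewrite lee_fin.
Qed.

Lemma slice_before v t : measurable_fun setT v -> 0 <= t ->
  (slice m (vol tm before v) t <= sqi mt v * t%:E)%E.
Proof.
move=> mv t0; have mb := @measurable_before R.
have mi : measurable_fun setT (fun s => ind before (t, s)) by mfun.
apply: (le_trans (sqi_time_weight mv mi)).
by rewrite lee_wpmul2l ?sqi_ge0// sqi_before.
Qed.

End early_times.

Section controllability.
Context {dX} {X : measurableType dX} {R : realType} {N : nat}.
Variable m : {finite_measure set X -> \bar R}.
Variable T : R.
Hypothesis T0 : 0 < T.
Notation tm := (time_measure T).
Notation mt := (m \x tm)%E.
Variables (sigma : R -> R) (k : R).
Hypothesis k_lip : forall x y, `|sigma x - sigma y| <= k * `|x - y|.
Hypothesis sigma_derivable : forall x : R, derivable sigma x 1.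
Hypothesis dsigma_continuous : continuous (derive1 sigma).
Hypothesis dsigma_gt0 : forall x : R, 0 < derive1 sigma x.
Variables (a : X * measurableTypeR R -> R) (b : X * X * measurableTypeR R -> R).
Variables (fI q : 'I_N -> X -> R) (v : 'I_N -> X * measurableTypeR R -> R).
Hypotheses (sa : sqint mt a) (mb : measurable_fun setT b).
Hypothesis ib : (\int[tm]_t energy m b t < +oo)%E.
Hypothesis sf : forall j, sqint m (fI j).
Hypothesis sq : forall j, sqint m (q j).
Hypothesis v_solves : forall j, solves m tm before sigma a b (fI j) (v j).
Hypothesis indep : weakly_independent m setT fI.
Hypothesis stationary : forall (da : X * measurableTypeR R -> R)
    (db : X * X * measurableTypeR R -> R)
    (w : 'I_N -> nat -> X * measurableTypeR R -> R),
  sqint mt da -> measurable_fun setT db -> (\int[tm]_t energy m db t < +oo)%E ->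
  (forall j n, solves m tm before sigma (fun p => a p + 4^-1 ^+ n * da p)
    (fun p => b p + 4^-1 ^+ n * db p) (fI j) (w j n)) ->
  (4^-1 ^+ n)^-1 * (\sum_j \int[m]_z (q j z * total tm (fun p => w j n p - v j p) z))
    @[n --> \oo] --> (0 : R).

Let mbf := @measurable_before R.
Let wbf : has_weights tm before := before_weights T0.
Let M j p : R := derive1 sigma (field m tm before a b (fI j) (v j) p).

Let sv j : sqint mt (v j). Proof. by case: (v_solves j). Qed.

Let mM j : measurable_fun setT (M j).
Proof.
have [mz _] := sqint_field mbf (sf j) sa mb ib (sv j).
by apply: (measurableT_comp _ mz); exact: continuous_measurable_fun.
Qed.

Let Mk j p : `|M j p| <= k.
Proof. exact: dsigma_bound. Qed.

Let costate_exists j : exists pi, solves m tm (flip before) id (fun=> 0)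
  (transpose (scaled b (M j))) (fun z => - q j z) pi.
Proof.
apply: (@solution_exists _ _ _ _ _ _ (measurable_flip mbf) (after_weights T0) _ 1).
- exact: measurable_id.
- by move=> x y; rewrite mul1r.
- exact: sqint0.
- exact: measurable_transpose_scaled.
- exact: (energy_transpose_scaled mb (mM j) ib (Mk j)).
- by have := sqintZ (-1) (sq j); under eq_fun do rewrite mulN1r.
Qed.

Let pi j := sval (cid (costate_exists j)).
Let pi_solves j := svalP (cid (costate_exists j)).
Let P j := costate tm before (q j) (pi j).

Let sP j : sqint mt (P j).
Proof. exact: (sqint_costate mbf (sq j) (pi_solves j)). Qed.

Let sPM j : sqint mt (fun p => P j p * M j p).
Proof.
have [mP _] := sP j; have mMj := mM j.
apply: (sqint_le _ (sqintZ k (sP j))) => [|p]; first by mfun.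
rewrite normrM mulrC normrM (ger0_norm (lip_ge0 k_lip)) ler_wpM2r//.
Qed.

(** The same sequence of quotients has two limits: 0 by stationarity, and the costate formula by
    [directional_derivative]. *)
Let adjoint_identity (da : X * measurableTypeR R -> R)
    (db : X * X * measurableTypeR R -> R) :
  sqint mt da -> measurable_fun setT db -> (\int[tm]_t energy m db t < +oo)%E ->
  \sum_j \int[mt]_p (P j p * (M j p * field m tm before da db (fI j) (v j) p)) = 0.
Proof.
move=> sda mdb idb.
have step1 n : `|4^-1 ^+ n| <= 1 :> R.
  by rewrite normrX exprn_ile1// ger0_norm ?invr_ge0// invf_le1// ler1n.
have exw j n : exists w, solves m tm before sigma (fun p => a p + 4^-1 ^+ n * da p)
    (fun p => b p + 4^-1 ^+ n * db p) (fI j) w.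
  apply: (solution_exists mbf wbf (k := k)).
  - exact: sigma_measurable.
  - exact: k_lip.
  - exact: (sqintD sa (sqintZ _ sda)).
  - by mfun.
  - exact: (energyD_lty (step1 n) mb mdb ib idb).
  - exact: sf.
pose w j n := sval (cid (exw j n)).
have w_solves j n := svalP (cid (exw j n)).
have := stationary sda mdb idb w_solves.
have : (4^-1 ^+ n)^-1 * (\sum_j \int[m]_z (q j z * total tm (fun p => w j n p - v j p) z))
    @[n --> \oo] --> \sum_j \int[mt]_p (P j p * (M j p * field m tm before da db (fI j) (v j) p)).
  under eq_fun do rewrite mulr_sumr.
  apply: cvg_bigsum => j.
  exact: (directional_derivative mbf wbf k_lip sigma_derivable dsigma_continuous
    sa sda mb mdb ib idb (sf j) (v_solves j) (w_solves j) (sq j) (pi_solves j)).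
by move=> h1 h2; exact: (cvg_unique _ h1 h2).
Qed.

Let E i j t := 1 + \int[m]_z (fI i z * traj tm before (fI j) (v j) (z, t)).

Let mE i j : measurable_fun setT (E i j).
Proof.
have [mfi _] := sf i; have [mfj _] := sf j; have [mvj _] := sv j.
have mt' := measurable_traj tm mbf mfj mvj.
apply: measurable_funD; first exact: measurable_cst.
apply: (@measurable_integralr _ _ _ _ _ m (fun p => fI i p.2 *
  traj tm before (fI j) (v j) (p.2, p.1))).
by mfun.
Qed.

Let E_bound i j : exists C, forall t, `|E i j t| <= C.
Proof.
have [C hC] := slice_traj_bound mbf (sf j) (sv j).
exists (1 + Num.sqrt (fine (sqi m (fI i)) * C)) => t.
apply: (le_trans (ler_normD _ _)); rewrite normr1 lerD2l.
rewrite -sqrtr_sqr ler_wsqrtr//.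
have st := sqint_traj mbf t (sf j) (sv j).
apply: (le_trans (Rcauchy_schwarz (sf i) st)).
rewrite ler_wpM2l ?fine_ge0 ?sqi_ge0// -lee_fin -sqi_fineK//.
exact: hC.
Qed.

Let sterm i j : sqint mt (fun p => (P j p * M j p) * E i j p.2).
Proof.
have [C hC] := E_bound i j; have mEij := mE i j.
apply: (sqintMr (C := C) (sPM j)) => [|p]; last exact: hC.
exact: (measurableT_comp mEij measurable_snd).
Qed.

Let theta i p := \sum_j (P j p * M j p) * E i j p.2.

Let stheta i : sqint mt (theta i).
Proof. by apply: sqint_sum => j; exact: sterm. Qed.

Let theta0 i : sqi mt (theta i) = 0%E.
Proof.
have st := stheta i.
have := adjoint_identity st (measurable_rank_one st (sf i)) (energy_rank_one_lty st (sf i)).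
(* In this direction the field along the trajectory j is theta_i E_ij, so the sum over j reproduces
   a second factor theta_i. *)
rewrite (_ : \sum_j _ = \int[mt]_p (theta i p * theta i p)); last first.
  under [in RHS]eq_Rintegral => p _ do rewrite {2}/theta mulr_sumr.
  rewrite Rintegral_bigsum; last first.
    by move=> j; exact: (sqintM_integrable st (sterm i j)).
  apply: eq_bigr => j _; apply: eq_Rintegral => p _.
  rewrite mulrA mulrCA; congr (_ * _).
  rewrite /field app_rank_one; [|exact: sf|exact: sqint_traj].
  by rewrite opprK -surjective_pairing /E mulrDr mulr1.
move=> int0; rewrite sqi_fineK// /sqi; congr EFin; rewrite -int0 /Rintegral.
by congr fine; apply: eq_integral => p _; rewrite expr2.
Qed.

Let theta_ae i : {ae tm, forall t, {ae m, forall y, theta i (y, t) = 0}}.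
Proof.
have [mth _] := stheta i; exact: sqi_nested mth (theta0 i).
Qed.

Theorem stationary_adjoint0 j : ae_eq m setT (q j) (cst 0).
Proof.
have Gu := affine_gram_unit sf indep.
have [d d0 hd] := unitmx_perturb Gu.
(* E_ij(t) differs from its initial value by the scalar product of fI_i with the time integral of
   v_j, whose squared norm is at most t |v_j|^2. Hence C t bounds every squared difference, and t <
   e makes it at most d^2. *)
pose C := \sum_i \sum_j fine (sqi m (fI i)) * fine (sqi mt (v j)).
have C0 : 0 <= C.
  by apply: sumr_ge0 => i _; apply: sumr_ge0 => l _; rewrite mulr_ge0// fine_ge0// sqi_ge0.
pose e := d ^+ 2 / (C + 1).
have e0 : 0 < e by rewrite divr_gt0 ?exprn_gt0// ltr_wpDl.
have close i l t : 0 < t < e -> `|E i l t - (1 + \int[m]_z (fI i z * fI l z))| <= d.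
  move=> /andP[t0 te].
  have st := sqint_traj mbf t (sf l) (sv l).
  have svl := sqint_vol mbf t (sv l).
  rewrite /E opprD addrACA subrr add0r -RintegralB//; last 2 first.
  - exact: (sqintM_integrable (sf i) st).
  - exact: (sqintM_integrable (sf i) (sf l)).
  under eq_Rintegral => z _ do rewrite /traj -mulrBr addrC addKr.
  rewrite -(@ler_pXn2r _ 2)// ?nnegrE ?(ltW d0)//.
  rewrite real_normK ?num_real//.
  apply: (le_trans (Rcauchy_schwarz (sf i) svl)).
  have : fine (sqi m (fun z => vol tm before (v l) (z, t))) <= fine (sqi mt (v l)) * t.
    rewrite -lee_fin EFinM -!sqi_fineK//.
    by apply: slice_before; [exact: (sv l).1|exact: ltW].
  move=> h; apply: (@le_trans _ _ (C * t)).
    apply: (le_trans (ler_wpM2l (fine_ge0 (sqi_ge0 _ _)) h)); rewrite mulrA.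
    apply: ler_wpM2r; first exact: ltW.
    rewrite /C (bigD1 i)//= (bigD1 l)//= -addrA lerDl addr_ge0//.
      by apply: sumr_ge0 => ? _; rewrite mulr_ge0// fine_ge0// sqi_ge0.
    by apply: sumr_ge0 => ? _; apply: sumr_ge0 => ? _; rewrite mulr_ge0// fine_ge0// sqi_ge0.
  apply: (@le_trans _ _ (C * e)); first by rewrite ler_wpM2l// ltW.
  rewrite /e mulrCA ler_piMr ?sqr_ge0// ler_pdivrMr ?ltr_wpDl//.
  by rewrite mul1r lerDl.
apply: (costate_vanish T0 mb (mM j) ib (Mk j) (sq j) (pi_solves j) e0).
have all0 : {ae tm, forall t, {ae m, forall y, forall i, theta i (y, t) = 0}}.
  have h : {ae tm, forall t, forall i, {ae m, forall y, theta i (y, t) = 0}}.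
    by apply: filter_forall => i; exact: theta_ae.
  by apply: aeS h => t h; apply: filter_forall.
have tpos : {ae tm, forall t, 0 < t < T} by apply: (@ae_time _ T (fun t => 0 < t < T)).
apply: aeI tpos all0 => t t0T h te.
apply: aeS h => y h.
(* At a fixed point and time the equations theta_i = 0 say that this row is annihilated by the
   invertible matrix E(t). *)
pose x : 'rV[R]_N := \row_l (P l (y, t) * M l (y, t)).
have x0 : x = 0.
  apply: (hd (\matrix_(l, i) E i l t)) => [l i|].
    rewrite !mxE; under eq_Rintegral => z _ do rewrite mulrC.
    by apply: close; move: t0T => /andP[-> _].
  apply/rowP => i; rewrite !mxE -[RHS](h i) /theta; apply: eq_bigr => l _.
  by rewrite !mxE.
have /rowP/(_ j) := x0; rewrite !mxE => /eqP; rewrite mulf_eq0 => /orP[/eqP//|].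
by rewrite (gt_eqF (dsigma_gt0 _)).
Qed.

End controllability.

(** * Solutions of the forward problem *)

Section continuous_version.
Context {dX} {X : measurableType dX} {R : realType}.
Variable m : {finite_measure set X -> \bar R}.
Variable T : R.
Hypothesis T0 : 0 < T.
Variable F : R -> X -> R.
Hypothesis sF : forall t, 0 <= t <= T -> sqint m (F t).
Hypothesis cF : forall t, 0 <= t <= T ->
  fine (sqi m (fun y => F s y - F t y)) @[s --> within `[0, T] (nbhs t)] --> (0 : R).

(** The Heine-Cantor argument on the compact [0, T], with squared distances: these satisfy the
    triangle inequality only up to a factor 2, hence the e / 4 at the intermediate point. *)
Lemma uniform_modulus (e : R) : 0 < e -> exists2 d : R, 0 < d &
  forall s t, 0 <= s <= T -> 0 <= t <= T -> `|s - t| < d ->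
    fine (sqi m (fun y => F s y - F t y)) <= e.
Proof.
move=> e0.
have := @segment_compact R 0 T; move/compact_near_coveringP.
pose P (d x : R) := 0 <= x <= T -> forall s, 0 <= s <= T -> `|s - x| < d ->
  fine (sqi m (fun y => F s y - F x y)) <= e.
move=> /(_ R^o (0^'+) P _); case.
- move=> x; rewrite /= in_itv/= => x0T.
  have e4 : 0 < e / 4 by rewrite divr_gt0.
  have := cF x0T; move/cvgr0Pnorm_le => /(_ _ e4).
  rewrite near_withinE => -[r /= r0 hr].
  exists (ball x (r / 2), [set d | 0 < d < r / 2]).
    split; first by apply: nbhsx_ballx; rewrite divr_gt0.
    by near=> d; apply/andP; split; near: d; [exact: nbhs_right_gt|
      apply: nbhs_right_lt; rewrite divr_gt0].
  move=> [y d] [/= bxy /andP[d0 dr]] y0T s s0T sy.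
  have hx z : 0 <= z <= T -> `|x - z| < r -> fine (sqi m (fun y => F z y - F x y)) <= e / 4.
    move=> z0T xz; apply: le_trans (ler_norm _) _.
    by apply: hr => //=; rewrite in_itv.
  have h1 : fine (sqi m (fun z => F s z - F x z)) <= e / 4.
    apply: hx => //; rewrite distrC; apply: (le_lt_trans (ler_distD y _ _)).
    rewrite [r]splitr ltrD//; first exact: lt_trans dr.
    by rewrite distrC.
  have h2 : fine (sqi m (fun z => F y z - F x z)) <= e / 4.
    by apply: hx => //; apply: (lt_trans bxy); rewrite ltr_pdivrMr// ltr_pMr// ltr1n.
  have ss := sqintB (sF s0T) (sF x0T); have sy' := sqintB (sF y0T) (sF x0T).
  have sd := sqintB (sF s0T) (sF y0T).
  have := sqiB m ss.1 sy'.1.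
  under [in X in (X <= _)%E -> _]eq_fun do rewrite opprB addrA subrK.
  rewrite (sqi_fineK ss) (sqi_fineK sy') (sqi_fineK sd) -!EFinM -EFinD lee_fin.
  move=> /le_trans; apply; lra.
move=> d /= d0 hd; exists (d / 2); first by rewrite divr_gt0.
move=> s t s0T t0T st; apply: (hd (d / 2)) => //=.
- by rewrite sub0r normrN ger0_norm ?divr_ge0 ?(ltW d0)// ltr_pdivrMr// ltr_pMr// ltr1n.
- by rewrite divr_gt0.
Unshelve. all: by end_near. Qed.

Let cell (h t : R) (i : nat) : bool := i%:R * h <= t < i.+1%:R * h.

Let cell_exists h t K : 0 <= t < K%:R * h -> exists2 i, (i < K)%N & cell h t i.
Proof.
elim: K => [|K ih] /andP[t0 tK]; first by move: tK; rewrite mul0r ltNge t0.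
have [tlt|tge] := ltP t (K%:R * h).
  by have [|i iK ci] := ih; [rewrite t0|exists i => //; exact: ltnW].
by exists K => //; rewrite /cell tge.
Qed.

Let cell_uniq h t i j : 0 < h -> cell h t i -> cell h t j -> i = j.
Proof.
move=> h0 /andP[ti it] /andP[tj jt].
have : i%:R * h < j.+1%:R * h by exact: le_lt_trans jt.
have : j%:R * h < i.+1%:R * h by exact: le_lt_trans it.
rewrite !ltr_pM2r// !ltr_nat !ltnS => ji ij.
by apply/eqP; rewrite eqn_leq ij ji.
Qed.

Let steps (h : R) (K : nat) (p : X * measurableTypeR R) : R :=
  \sum_(i < K) (cell h p.2 i)%:R * F (i%:R * h) p.1.

Let stepsE h K t i y : 0 < h -> (i < K)%N -> cell h t i ->
  steps h K (y, t) = F (i%:R * h) y.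
Proof.
move=> h0 iK ci; rewrite /steps (bigD1 (Ordinal iK))//= ci mul1r big1 ?addr0// => j ji.
case cj : (cell h t j); last by rewrite mul0r.
by move: ji; rewrite -val_eqE/= (cell_uniq h0 ci cj) eqxx.
Qed.

Let in_range (h : R) K i : 0 < h -> K%:R * h = T -> (i < K)%N -> 0 <= i%:R * h <= T.
Proof.
move=> h0 hK iK; rewrite mulr_ge0 ?(ltW h0)//= -hK.
by apply: ler_wpM2r; [exact: ltW|rewrite ler_nat; exact: ltnW].
Qed.

Let msteps h K : 0 < h -> K%:R * h = T -> measurable_fun setT (steps h K).
Proof.
move=> h0 hK; apply: measurable_sum => i.
have [mFi _] := sF (in_range h0 hK (ltn_ord i)).
apply: measurable_funM; last by mfun.
have mc : measurable_fun setT (fun t : measurableTypeR R => (cell h t i)%:R : R).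
  rewrite (_ : (fun t => _) = \1_(`[i%:R * h, i.+1%:R * h[%classic : set R)).
    exact: measurable_indic.
  apply/funext => t; rewrite indicE; congr (nat_of_bool _)%:R.
  by apply/idP/idP; rewrite inE/= in_itv.
by apply: (measurableT_comp mc); exact: measurable_snd.
Qed.

(* A path in L^2 is only a family of functions, one for each time; it needs a
   jointly measurable representative before Fubini can be used. *)
Lemma continuous_version : exists G : X * measurableTypeR R -> R,
  [/\ measurable_fun setT G,
      exists C : R, forall t, (slice m G t <= C%:E)%E &
      forall t, 0 < t < T -> ae_eq m setT (fun y => G (y, t)) (F t)].
Proof.
(* A mesh finer than the modulus for 4^-n makes the step functions approach F t geometrically at
   each t, which yields convergence almost everywhere in y. *)
have grid (n : nat) : exists hK : R * nat, [/\ 0 < hK.1, hK.2%:R * hK.1 = T &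
    forall t, 0 < t < T -> (sqi m (fun y => (steps hK.1 hK.2 (y, t) - F t y)%R)
      <= (4^-1 ^+ n)%:E)%E].
  have [|d d0 hd] := @uniform_modulus (4^-1 ^+ n); first by rewrite exprn_gt0.
  pose K := (Num.truncn (T / d)).+1; have K0 : 0 < K%:R :> R by rewrite ltr0n.
  have hd' : T / K%:R < d.
    rewrite ltr_pdivrMr// mulrC -ltr_pdivrMr//; exact: truncnS_gt.
  have h0 : 0 < T / K%:R by rewrite divr_gt0.
  have hK : K%:R * (T / K%:R) = T by rewrite mulrC divfK// gt_eqF.
  exists (T / K%:R, K); split=> //= t /andP[t0 tT].
  have [|i iK ci] := @cell_exists (T / K%:R) t K; first by rewrite ltW//= hK.
  under eq_fun => y do rewrite (stepsE _ h0 iK ci).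
  have iT := in_range h0 hK iK.
  have tT' : 0 <= t <= T by rewrite !ltW.
  rewrite sqi_fineK ?lee_fin; last exact: (sqintB (sF iT) (sF tT')).
  apply: hd => //; move: ci => /andP[it ti].
  rewrite distrC ger0_norm ?subr_ge0// ltrBlDr.
  by apply: (lt_le_trans ti); rewrite -natr1 mulrDl mul1r addrC lerD2r ltW.
pose hK n := sval (cid (grid n)).
pose u n := steps (hK n).1 (hK n).2.
have hKP n := svalP (cid (grid n)).
have mu n : measurable_fun setT (u n) by case: (hKP n) => h0 hT _; exact: msteps.
have uF n t : 0 < t < T -> (sqi m (fun y => (u n (y, t) - F t y)%R) <= (4^-1 ^+ n)%:E)%E.
  by case: (hKP n) => _ _; exact.
(* The upper limit exists and is jointly measurable even where the step functions diverge; [fine]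
   turns infinite values into 0. *)
pose L p : R := fine (limn_esup (fun n => (u n p)%:E)).
have mL : measurable_fun setT L.
  apply: measurableT_comp => //; apply: measurable_fun_limn_esup => n.
  exact/measurable_EFinP.
pose S : set R := `]0, T[%classic.
have mS : measurable_fun setT (fun p : X * measurableTypeR R => \1_S p.2 : R).
  have mi : measurable_fun setT (\1_S : measurableTypeR R -> R).
    by apply: measurable_indic; exact: measurable_itv.
  exact: (measurableT_comp mi measurable_snd).
have GF t : 0 < t < T -> ae_eq m setT (fun y => \1_S t * L (y, t)) (F t).
  move=> t0T; have t0T' : 0 <= t <= T by case/andP: t0T => *; rewrite !ltW.
  have [mFt _] := sF t0T'.
  have St : \1_S t = 1 :> R by rewrite indicE mem_set//= in_itv.
  have md n : measurable_fun setT (fun y => u n (y, t) - F t y).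
    by have := mu n => mun; mfun.
  have : {ae m, forall y, (u n (y, t) - F t y) @[n --> \oo] --> (0 : R)}.
    apply: (@ae_cvg0 _ _ _ _ _ 1) => // n; rewrite mul1r; exact: uF.
  apply: aeS => y cy _; rewrite St mul1r /L.
  have c : (u n (y, t))%:E @[n --> \oo] --> (F t y)%:E.
    apply: cvg_EFin; first exact: nearW.
    rewrite (_ : fine \o _ = (fun n => (u n (y, t) - F t y) + F t y)); last first.
      by apply/funext => n /=; rewrite subrK.
    by rewrite -[X in _ --> X]add0r; apply: cvgD => //; exact: cvg_cst.
  by have [_ ->] := cvg_limn_einf_sup c.
exists (fun p => \1_S p.2 * L p); split.
- by mfun.
(* Every F t lies within distance 1 in L^2 of one of the finitely many grid values of the mesh for n
   = 0, so the bound is uniform in t. *)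
- pose C := \sum_(i < (hK 0%N).2) fine (sqi m (F (i%:R * (hK 0%N).1))).
  have Ci i : (i < (hK 0%N).2)%N -> fine (sqi m (F (i%:R * (hK 0%N).1))) <= C.
    move=> iK; rewrite /C (bigD1 (Ordinal iK))//= lerDl.
    by apply: sumr_ge0 => j _; rewrite fine_ge0 ?sqi_ge0.
  have C0 : 0 <= C by apply: sumr_ge0 => j _; rewrite fine_ge0 ?sqi_ge0.
  exists (2 * 1 + 2 * C) => t.
  have mGt : measurable_fun setT (fun y => \1_S t * L (y, t)) by mfun.
  have [t0T|t0T] := boolP (0 < t < T); last first.
    rewrite /slice /= indicE memNset; last by rewrite /S/= in_itv; exact/negP.
    under eq_fun do rewrite mul0r.
    by rewrite sqi0 lee_fin addr_ge0// mulr_ge0.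
  have t0T' : 0 <= t <= T by case/andP: t0T => *; rewrite !ltW.
  have sFt := sF t0T'; have [mFt _] := sFt.
  rewrite /slice /= (ae_eq_sqi mGt mFt (GF t t0T)).
  have mun := mu 0%N; have mut : measurable_fun setT (fun y => u 0%N (y, t)) by mfun.
  have mudt : measurable_fun setT (fun y => u 0%N (y, t) - F t y) by mfun.
  have := sqiB m mut mudt; under [in X in (X <= _)%E -> _]eq_fun do rewrite opprB addrC subrK.
  move=> /le_trans; apply.
  rewrite [leRHS](_ : _ = 2%:E * C%:E + 2%:E * 1%:E)%E; last by rewrite -!EFinM -EFinD addrC.
  apply: leeD; last by rewrite lee_wpmul2l//; exact: (uF 0%N).
  rewrite lee_wpmul2l//; have [h0 hT _] := hKP 0%N; move: t0T => /andP[t0 tT].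
  have [|i iK ci] := @cell_exists (hK 0%N).1 t (hK 0%N).2; first by rewrite ltW//= hT.
  under eq_fun => y do rewrite /u (stepsE _ h0 iK ci).
  by rewrite sqi_fineK ?lee_fin ?Ci//; exact: sF (in_range h0 hT iK).
- by move=> t t0T; exact: GF.
Qed.

End continuous_version.

(* Replacing w by the right-hand side of its equation changes it on a null set
   only and makes the equation hold everywhere. *)
Lemma solution_modify dX (X : measurableType dX) (R : realType)
    (m : {finite_measure set X -> \bar R}) (T : R) (sigma : R -> R) (k : R)
    (a : X * measurableTypeR R -> R) b f0 w :
  (forall x y, `|sigma x - sigma y| <= k * `|x - y|) -> measurable_fun setT sigma ->
  sqint (m \x time_measure T)%E a -> measurable_fun setT b ->
  (\int[time_measure T]_t energy m b t < +oo)%E -> sqint m f0 ->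
  sqint (m \x time_measure T)%E w ->
  {ae m, forall y, forall t, 0 < t < T ->
    w (y, t) = sigma (field m (time_measure T) before a b f0 w (y, t))} ->
  exists v, solves m (time_measure T) before sigma a b f0 v /\
    {ae m, forall y, forall t, 0 < t < T -> v (y, t) = w (y, t)}.
Proof.
move=> lip msigma sa mb ib sf0 sw wE; have mbf := @measurable_before R.
have sz := sqint_field mbf sf0 sa mb ib sw.
pose v p := sigma (field m (time_measure T) before a b f0 w p).
have sv : sqint (m \x time_measure T)%E v by exact: (sqint_lipschitz msigma lip sz).
have [mv _] := sv; have [mw _] := sw.
have tp : {ae time_measure T, forall t, 0 < t < T} by apply: (@ae_time _ T (fun t => 0 < t < T)).
have volE : {ae m, forall y, forall t,
    vol (time_measure T) before v (y, t) = vol (time_measure T) before w (y, t)}.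
  apply: aeS wE => y wy t.
  have mi : measurable_fun setT (fun s => ind before (t, s)) by mfun.
  have mvy : measurable_fun setT (fun s => v (y, s)) by clear -mv; clearbody v; mfun.
  have mwy : measurable_fun setT (fun s => w (y, s)) by clear -mw; mfun.
  rewrite /vol /=; apply: Rintegral_ae_eq; [exact: measurable_funM|exact: measurable_funM|].
  by apply: aeS tp => s sT _; rewrite /v -wy.
exists v; split.
  split; first exact: sv.
  move=> [y t]; rewrite [LHS]/v /field; congr (sigma (_ - _)).
  have mtv := measurable_traj (time_measure T) mbf sf0.1 mv.
  have mtw := measurable_traj (time_measure T) mbf sf0.1 mw.
  apply: app_ae_eq; first exact: mb.
  - by clear -mtw; move: (traj _ _ _ _) mtw => g mg; mfun.
  - by clear -mtv; move: (traj _ _ _ _) mtv => g mg; mfun.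
  by apply: aeS volE => z vz _; rewrite /traj vz.
by apply: aeS wE => y wy t tT; rewrite wy.
Qed.

Section forward_problem.
Context {dX} {X : measurableType dX} {R : realType}.
Variable m : {finite_measure set X -> \bar R}.
Variable T : R.
Hypothesis T0 : 0 < T.
Notation tm := (time_measure T).
Notation mt := (m \x tm)%E.
Implicit Types v w : X * measurableTypeR R -> R.

(** The forward problem integrates over a closed interval, while h is identified with the measurable
    h' only inside ]0, T[. The function [g] corrects h' at 0 and T, two null points at which h may
    take any value. *)
Lemma Rintegral_before (h h' : measurableTypeR R -> R) t : 0 <= t <= T ->
  measurable_fun setT h' -> (forall s, 0 < s < T -> h s = h' s) ->
  \int[lebesgue_measure]_(s in `[0, t]) h s = \int[tm]_s (ind before (t, s) * h' s).
Proof.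
move=> /andP[t0 tT] mh' hh'; have mb := @measurable_before R.
pose g (s : measurableTypeR R) : R := h' s + \1_[set 0 : R] s * (h 0 - h' 0) +
  \1_[set T] s * (h T - h' T).
have m1 (x : R) : measurable_fun setT (\1_[set x] : measurableTypeR R -> R).
  by apply: measurable_indic; exact: measurable_set1.
have mg : measurable_fun setT g.
  by do 2 (apply: measurable_funD; last by
    apply: measurable_funM; [exact: m1|exact: measurable_cst]).
have gE s : 0 < s < T -> g s = h' s.
  move=> /andP[s0 sT]; rewrite /g !indicE !memNset ?mul0r ?addr0//= => /eqP.
    by rewrite lt_eqF.
  by rewrite gt_eqF.
have hg s : s \in `[0, t]%classic -> h s = g s.
  rewrite inE/= in_itv/= => /andP[s0 st].
  move: s0; rewrite le_eqVlt => /predU1P[<-|s0].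
    rewrite /g !indicE mem_set// memNset/=; last by move/eqP; rewrite lt_eqF.
    by rewrite mul1r mul0r addr0 addrC subrK.
  have : s <= T by exact: le_trans tT.
  rewrite le_eqVlt => /predU1P[->|sT]; last by rewrite hh' ?gE ?s0.
  rewrite /g !indicE memNset/=; last by move/eqP; rewrite gt_eqF.
  rewrite mem_set//.
  by rewrite mul1r mul0r addr0 addrC subrK.
have -> : \int[lebesgue_measure]_(s in `[0, t]) h s =
    \int[lebesgue_measure]_(s in `[0, t]) g s by exact: eq_Rintegral.
rewrite Rintegral_mrestr; last by mfun.
rewrite Rintegral_mkcond [RHS]Rintegral_mkcond.
apply: Rintegral_ae_eq.
- by apply/(measurable_restrictT _ _).1 => //; exact: measurable_funTS.
- by apply/(measurable_restrictT _ _).1 => //; apply: measurable_funTS; mfun.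
have ne (x : R) : {ae @lebesgue_measure R, forall s, s != x}.
  exists [set x]; split; [exact: measurable_set1|exact: lebesgue_measure_set1|].
  by move=> s /= /negP; rewrite negbK => /eqP.
apply: aeI (ne 0) (ne T) => s s0 sT _; rewrite /patch !mem_setE !in_itv/=.
rewrite /ind /= /before le_eqVlt (eq_sym 0) (negbTE s0)/=.
have [s0'|s0'] := ltP 0 s; rewrite //=.
case: (leP s t) => st /=; last by rewrite mul0r; case: ifP.
rewrite (lt_neqAle s T) sT (le_trans st tT)/= mul1r gE// s0' lt_neqAle sT.
exact: le_trans tT.
Qed.

Lemma sqi_before_diff (s t : R) :
  (sqi tm (fun r => (ind before (s, r) - ind before (t, r))%R) <= `|s - t|%:E)%E.
Proof.
have mb := @measurable_before R.
wlog ts : s t / t <= s.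
  move=> h; have [|/ltW st] := leP t s; first exact: h.
  rewrite distrC; apply: le_trans (h _ _ st).
  by apply: le_sqi => [||r]; [mfun|mfun|rewrite distrC].
rewrite ger0_norm ?subr_ge0// /sqi ge0_integral_mrestr; last 2 first.
- by mfun.
- by move=> r; rewrite lee_fin sqr_ge0.
have -> : (s - t)%:E = (\int[lebesgue_measure]_(r in `]t, s]) 1)%E.
  rewrite integral_cst//= mul1e lebesgue_measure_itv/= lte_fin.
  by case: ltgtP ts => [|//|->] _; rewrite ?subrr// EFinB.
rewrite integral_mkcond [leRHS]integral_mkcond; apply: ge0_le_integral => //.
- by move=> r _; apply: erestrict_ge0 => ? _; rewrite lee_fin sqr_ge0.
- by apply/(measurable_restrictT _ _).1 => //; apply: measurable_funTS; mfun.
- by apply/(measurable_restrictT _ _).1 => //; exact: measurable_cst.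
move=> r _; rewrite /patch !mem_setE !in_itv/=.
rewrite /ind /= /before; case: (leP r t) => rt.
  by rewrite (le_trans rt ts) subrr expr0n; case: ifP.
by case: (leP r s) => rs; case: ifP => _; rewrite lee_fin ?subr0 ?expr1n ?expr0n/=.
Qed.

(** Cauchy-Schwarz in time between s and t: trajectories are Hölder continuous of exponent 1/2 in
    L^2. *)
Lemma traj_lipschitz f0 v s t : sqint m f0 -> sqint mt v ->
  fine (sqi m (fun y => traj tm before f0 v (y, s) - traj tm before f0 v (y, t))) <=
  fine (sqi mt v) * `|s - t|.
Proof.
move=> sf0 sv; have mb := @measurable_before R; have [mv _] := sv.
have ss := sqint_traj mb s sf0 sv; have st := sqint_traj mb t sf0 sv.
have sd := sqintB ss st.
have mi : measurable_fun setT (fun r => ind before (s, r) - ind before (t, r)) by mfun.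
rewrite -lee_fin EFinM -!sqi_fineK//.
apply: (@le_trans _ _ (sqi mt v * sqi tm (fun r => (ind before (s, r) -
    ind before (t, r))%R))%E); last first.
  by rewrite lee_wpmul2l ?sqi_ge0// sqi_before_diff.
apply: le_trans (sqi_time_weight m T mv mi).
have mw : measurable_fun setT (fun y => \int[tm]_r ((ind before (s, r) -
    ind before (t, r)) * v (y, r))).
  apply: (@measurable_integralr _ _ _ _ _ tm (fun p => (ind before (s, p.2) -
    ind before (t, p.2)) * v p)).
  by mfun.
apply: le_sqi_ae => //; first by case: sd.
apply: aeS (sqint_slice_integrable sv) => y iv.
rewrite /traj /= opprD addrACA subrr add0r /vol /= -RintegralB//; last 2 first.
- exact: (ind_integrable mb).
- exact: (ind_integrable mb).
by under eq_Rintegral => r _ do rewrite -mulrBl.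
Qed.

Lemma traj_continuous f0 v t : sqint m f0 -> sqint mt v ->
  fine (sqi m (fun y => traj tm before f0 v (y, s) - traj tm before f0 v (y, t)))
    @[s --> within `[0, T] (nbhs t)] --> (0 : R).
Proof.
move=> sf0 sv; apply: cvg_within_filter.
set C := fine (sqi mt v); have C0 : 0 <= C by rewrite fine_ge0 ?sqi_ge0.
apply: (@squeeze_cvgr _ _ _ _ (fun=> 0) (fun s => C * `|s - t|)).
- by apply: nearW => s; rewrite fine_ge0 ?sqi_ge0//= traj_lipschitz.
- exact: cvg_cst.
- rewrite [X in _ --> X](_ : _ = C * `|t - t|); last by rewrite subrr normr0 mulr0.
  apply: cvgM; first exact: cvg_cst.
  by apply: cvg_norm; apply: cvgB; [exact: cvg_id|exact: cvg_cst].
Qed.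

Variables (sigma : R -> R) (k : R).
Hypothesis k_lip : forall x y, `|sigma x - sigma y| <= k * `|x - y|.
Hypothesis msigma : measurable_fun setT sigma.
Variables (a : X * measurableTypeR R -> R) (b : X * X * measurableTypeR R -> R).
Variable (f0 : X -> R).
Hypotheses (sa : sqint mt a) (mb : measurable_fun setT b).
Hypothesis ib : (\int[tm]_t energy m b t < +oo)%E.
Hypothesis sf0 : sqint m f0.

(** A jointly measurable version of the path turns the right-hand side into a square integrable
    velocity V. The integral equation says that F is the trajectory of V, so V solves the velocity
    equation inside ]0, T[, and a modification on a null set makes this hold everywhere. *)
Lemma solution_of_trajectory (F : R -> X -> R) (H : X -> R -> R) :
  (forall t, 0 <= t <= T -> sqint m (F t)) ->
  (forall t, 0 <= t <= T -> fine (sqi m (fun y => F s y - F t y))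
    @[s --> within `[0, T] (nbhs t)] --> (0 : R)) ->
  {ae m, forall y, forall s, 0 < s < T -> H y s = sigma (a (y, s) - app m b (F s) y s)} ->
  (forall t, 0 <= t <= T -> {ae m, forall y,
    F t y = f0 y + \int[lebesgue_measure]_(s in `[0, t]) H y s}) ->
  exists v, solves m tm before sigma a b f0 v /\ forall t, 0 <= t <= T ->
    ae_eq m setT (F t) (fun y => traj tm before f0 v (y, t)).
Proof.
move=> sF cF HE FE; have mbf := @measurable_before R.
have [G [mG [C GC] GF]] := continuous_version T0 sF cF.
have sapp := sqint_app mb ib mG GC.
pose V p := sigma (a p - app m b (fun z => G (z, p.2)) p.1 p.2).
have sV : sqint mt V by exact: (sqint_lipschitz msigma k_lip (sqintB sa sapp)).
have [mV _] := sV.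
have itvW t : 0 < t < T -> 0 <= t <= T by case/andP => *; rewrite !ltW.
have appG y t : 0 < t < T -> app m b (fun z => G (z, t)) y t = app m b (F t) y t.
  move=> tT; have [mFt _] := sF t (itvW t tT).
  by apply: app_ae_eq => //; [by mfun|exact: GF].
have FV t : 0 <= t <= T -> ae_eq m setT (F t) (fun y => traj tm before f0 V (y, t)).
  move=> tT; apply: aeI HE (FE t tT) => y Hy -> _; congr (_ + _).
  rewrite (@Rintegral_before _ (fun s => V (y, s)))//; first by mfun.
  by move=> s sT; rewrite Hy// /V /= appG.
have [|v [vs vV]] := solution_modify k_lip msigma sa mb ib sf0 sV.
  apply: aeW => y t tT; rewrite /V /field; congr (sigma (_ - _)).
  have [mtV _] := sqint_traj mbf t sf0 sV.
  apply: app_ae_eq; [exact: mb|by mfun|exact: mtV|].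
  by apply: aeI (GF t tT) (FV t (itvW t tT)) => z h1 h2 hz; rewrite h1// h2.
exists v; split=> // t tT; apply: aeI (FV t tT) vV => y Fy vVy yT; rewrite Fy// /traj /vol.
have [[mv _] _] := vs.
have mi : measurable_fun setT (fun s => ind before (t, s)) by mfun.
have mvy : measurable_fun setT (fun s => v (y, s)) by mfun.
have mVy : measurable_fun setT (fun s => V (y, s)) by clear -mV; clearbody V; mfun.
congr (_ + _); apply: Rintegral_ae_eq; [exact: measurable_funM|exact: measurable_funM|].
have tp : {ae tm, forall t, 0 < t < T} by apply: (@ae_time _ T (fun t => 0 < t < T)).
by apply: aeS tp => s sT _; rewrite vVy.
Qed.

Lemma trajectory_of_solution v (H : X -> R -> R) y t :
  solves m tm before sigma a b f0 v -> 0 <= t <= T ->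
  (forall s, 0 < s < T -> H y s =
    sigma (a (y, s) - app m b (fun z => traj tm before f0 v (z, s)) y s)) ->
  traj tm before f0 v (y, t) = f0 y + \int[lebesgue_measure]_(s in `[0, t]) H y s.
Proof.
move=> [[mv _] vE] tT HE; rewrite /traj /=; congr (_ + _).
rewrite (@Rintegral_before _ (fun s => v (y, s)))//; first by mfun.
by move=> s sT; rewrite HE// vE.
Qed.

End forward_problem.

(** * L^2 over a set and square integrability for the restricted measure *)

Section L2_square_integrable.
Context {dX} {X : measurableType dX} {R : realType}.
Variables (mu : {measure set X -> \bar R}).

Lemma Lnorm2_sqr (f : X -> R) : ('N[mu]_2%:E[EFin \o f] `^ 2 = sqi mu f)%E.
Proof.
rewrite poweR_Lnorm//; apply: eq_integral => x _ /=.
by rewrite (powR_mulrn 2)// real_normK// num_real.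
Qed.

Lemma Lnorm2E (f : X -> R) : fine 'N[mu]_2%:E[EFin \o f] = Num.sqrt (fine (sqi mu f)).
Proof.
rewrite -Lnorm2_sqr; have := Lnorm_ge0 mu 2%:E (EFin \o f).
case: ('N[mu]_2%:E[EFin \o f])%E => [r| |]//=.
- by rewrite lee_fin => r0; rewrite (powR_mulrn 2)// sqrtr_sqr ger0_norm.
- by rewrite pnatr_eq0/= sqrtr0.
Qed.

Lemma LfunE (f : X -> R) : f \in Lfun mu 2%:E <-> sqint mu f.
Proof.
have h : ('N[mu]_2%:E[EFin \o f] < +oo)%E <-> (sqi mu f < +oo)%E.
  rewrite -Lnorm2_sqr; have := Lnorm_ge0 mu 2%:E (EFin \o f).
  by case: ('N[mu]_2%:E[EFin \o f])%E => [r| |]//=; rewrite ?ltry// pnatr_eq0.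
split=> [/andP[]|[mf lf]].
  by rewrite !inE/= => mf lf; split=> //; exact/h.
by rewrite !inE/=; apply/andP; split; rewrite inE//=; exact/h.
Qed.

Variables (D : set X) (mD : measurable D) (Doo : (mu D < +oo)%E).
Notation m := (mfrestr mD Doo).

Lemma sqi_restrict (f : X -> R) : measurable_fun setT (f \_ D) ->
  sqi m (f \_ D) = sqi mu (f \_ D).
Proof.
move=> mf; rewrite /sqi ge0_integral_mrestr; last 2 first.
- exact: measurable_sqr.
- by move=> x; rewrite lee_fin sqr_ge0.
rewrite integral_mkcond; apply: eq_integral => x _.
rewrite /patch; case: ifPn => xD; first by rewrite xD.
by rewrite [RHS](_ : _ = ((0 : R) ^+ 2)%:E)// expr0n.
Qed.

Lemma L2E (f : X -> R) : L2 mu D f <-> sqint m (f \_ D).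
Proof.
split=> [/LfunE[mf lf]|[mf lf]]; first by split; rewrite ?sqi_restrict.
by apply/LfunE; split=> //; rewrite -sqi_restrict.
Qed.

Lemma sqint_restrict (f : X -> R) : sqint m f -> sqint m (f \_ D).
Proof.
move=> sf; apply: (sqint_le _ sf) => [|x].
  by apply/(measurable_restrictT _ _).1 => //; apply: measurable_funTS; case: sf.
by rewrite /patch; case: ifP => //; rewrite normr0.
Qed.

Lemma L2_of_sqint (f : X -> R) : sqint m f -> L2 mu D f.
Proof. by move=> sf; apply/L2E/sqint_restrict. Qed.

Lemma L2normE (f : X -> R) : L2 mu D f ->
  L2norm mu D f = Num.sqrt (fine (sqi m (f \_ D))).
Proof. by move=> /LfunE[mf _]; rewrite /L2norm Lnorm2E sqi_restrict. Qed.

Lemma Rintegral_restrict (f : X -> R) : measurable_fun setT (f \_ D) ->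
  \int[m]_x (f \_ D) x = \int[mu]_(x in D) f x.
Proof.
move=> mf; rewrite Rintegral_mrestr//; apply: eq_Rintegral => x xD.
by rewrite /patch xD.
Qed.

Lemma restrictM (f g : X -> R) x : ((fun x => f x * g x) \_ D) x = (f \_ D) x * (g \_ D) x.
Proof. by rewrite /patch; case: ifP => //; rewrite mulr0. Qed.

Lemma L2dotE (f g : X -> R) : L2 mu D f -> L2 mu D g ->
  L2dot mu D f g = \int[m]_x ((f \_ D) x * (g \_ D) x).
Proof.
move=> /L2E[mf _] /L2E[mg _]; rewrite /L2dot -Rintegral_restrict.
  by apply: eq_Rintegral => x _; rewrite restrictM.
rewrite (_ : _ \_ D = fun x => (f \_ D) x * (g \_ D) x); first by mfun.
by apply/funext => x; exact: restrictM.
Qed.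

Lemma ae_restrict (P : X -> Prop) :
  {ae m, forall x, P x} <-> {ae mu, forall x, D x -> P x}.
Proof. exact: ae_mrestr. Qed.

Lemma restrict_ae_eq (f : X -> R) : ae_eq m setT (f \_ D) f.
Proof. by apply/ae_restrict; apply: aeW => x Dx _; rewrite /patch mem_set. Qed.

Lemma ae_eq_restrict (f g : X -> R) :
  ae_eq mu D f g <-> ae_eq m setT (f \_ D) (g \_ D).
Proof.
split.
  move=> h; apply/ae_restrict; apply: aeS h => x h Dx _.
  by rewrite /patch mem_set// h.
move=> /ae_restrict; apply: aeS => x h Dx; have := h Dx I.
by rewrite /patch mem_set.
Qed.

Lemma restrict_sum n (c : 'I_n -> R) (phi : 'I_n -> X -> R) :
  (fun x => \sum_j c j * phi j x) \_ D = fun x => \sum_j c j * (phi j \_ D) x.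
Proof.
apply/funext => x; rewrite /patch; case: ifP => // _.
by rewrite big1// => j _; rewrite mulr0.
Qed.

Lemma weakly_independent_restrict n (phi : 'I_n -> X -> R) :
  weakly_independent mu D phi -> weakly_independent m setT (fun j => phi j \_ D).
Proof.
move=> indep c c0 s0; apply: indep => //; apply/ae_eq_restrict.
by rewrite restrict_sum; apply: aeS c0 => x + _ => /(_ I) ->; rewrite /patch; case: ifP.
Qed.

End L2_square_integrable.

Section product_restriction.
Context {dX dY} {X : measurableType dX} {Y : measurableType dY} {R : realType}.
Variables (mu : {sigma_finite_measure set X -> \bar R}).
Variables (nu : {sigma_finite_measure set Y -> \bar R}).
Variables (D : set X) (mD : measurable D) (Doo : (mu D < +oo)%E).
Variables (E : set Y) (mE : measurable E) (Eoo : (nu E < +oo)%E).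
Notation m := (mfrestr mD Doo).
Notation n := (mfrestr mE Eoo).

Lemma restrict_eq (Z : Type) (A : set Z) (f : Z -> R) :
  (forall x, ~ A x -> f x = 0) -> f \_ A = f.
Proof.
move=> f0; apply/funext => x; rewrite /patch; case: ifPn => // /negP xA.
by rewrite f0// => Ax; apply: xA; rewrite inE.
Qed.

(** Only functions that vanish outside the rectangle are compared, slice by slice, so the product of
    the restricted measures need not be identified with a restriction of the product measure. *)
Lemma sqi_prod_restrict (f : X * Y -> R) :
  measurable_fun setT (f \_ (D `*` E)) ->
  sqi (m \x n)%E (f \_ (D `*` E)) = sqi (mu \x nu)%E (f \_ (D `*` E)).
Proof.
move=> mf; set g := f \_ _ in mf *; rewrite !sqi_prodE//.
have ms := measurable_sqi m mf.
rewrite (ge0_integral_mrestr nu mE ms (fun y => sqi_ge0 m _)).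
rewrite integral_mkcond; apply: eq_integral => y _; rewrite /patch; case: ifPn => yE.
  have gD : (fun x => g (x, y)) \_ D = (fun x => g (x, y)).
    by apply: restrict_eq => x nDx; rewrite /g /patch memNset// => -[].
  by rewrite -gD sqi_restrict// gD; mfun.
rewrite (_ : (fun x => _) = cst 0) ?sqi0//; apply/funext => x.
by rewrite /g /patch memNset// => -[_ /mem_set]; exact/negP.
Qed.

Lemma L2_prodE (f : X * Y -> R) :
  L2 (mu \x nu)%E (D `*` E) f <-> sqint (m \x n)%E (f \_ (D `*` E)).
Proof.
split=> [/LfunE[mf lf]|[mf lf]]; first by split; rewrite ?sqi_prod_restrict.
by apply/LfunE; split=> //; rewrite -sqi_prod_restrict.
Qed.

End product_restriction.

Section product_sigma_finite.
Context {dX dY} {X : measurableType dX} {Y : measurableType dY} {R : realType}.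
Variables (mu : {sigma_finite_measure set X -> \bar R}).
Variables (nu : {sigma_finite_measure set Y -> \bar R}).

(** A name to which sigma-finiteness is attached, so that Tonelli applies to the triple product on
    which b lives. *)
Definition sigma_finite_prod : set (X * Y) -> \bar R := (mu \x nu)%E.

HB.instance Definition _ := Measure.on sigma_finite_prod.

Let sigma_finite_prod_sigma_finite : sigma_finite setT sigma_finite_prod.
Proof.
have /sigma_finiteP[F [TF ndF Foo]] := sigma_finiteT mu.
have /sigma_finiteP[G [TG ndG Goo]] := sigma_finiteT nu.
exists (fun n => F n `*` G n).
  rewrite -setXTT TF TG predeqE => -[x y]; split.
    move=> [/= [n _ Fnx] [k _ Gky]]; exists (maxn n k) => //; split.
    - by move: x Fnx; exact/subsetPset/ndF/leq_maxl.
    - by move: y Gky; exact/subsetPset/ndG/leq_maxr.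
  by move=> [n _ []/= ? ?]; split; exists n.
move=> k; have [? ?] := Foo k; have [? ?] := Goo k.
split; first exact: measurableX.
by rewrite /sigma_finite_prod product_measure1E// lte_mul_pinfty// ge0_fin_numE.
Qed.

HB.instance Definition _ := Measure_isSigmaFinite.Build _ _ _ sigma_finite_prod
  sigma_finite_prod_sigma_finite.

End product_sigma_finite.

Section control_spaces.
Context {R : realType} {d : nat}.
Variables (Y : set (Rn R d)) (T : R).
Hypothesis mY : measurable Y.
Hypothesis Yoo : (tuple_lebesgue d Y < +oo)%E.
Notation leb := (tuple_lebesgue _).
Notation m := (mfrestr mY Yoo).
Notation tm := (time_measure T).
Notation mt := (m \x tm)%E.

Lemma L2YtE a : L2Yt Y T a <-> sqint mt (a \_ (Y `*` `]0, T[)).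
Proof. exact: L2_prodE. Qed.

Lemma L2UYE l (U : set (Rn R l)) (mU : measurable U) (Uoo : (leb U < +oo)%E) w :
  L2UY Y U w <-> sqint (mfrestr mU Uoo \x m)%E (w \_ (U `*` Y)).
Proof. exact: L2_prodE. Qed.

Let Q := Y `*` Y `*` `]0, T[%classic.

Lemma L2YYtE b : L2YYt Y T b <-> measurable_fun setT (b \_ Q) /\
  (\int[tm]_t energy m (b \_ Q) t < +oo)%E.
Proof.
have h : measurable_fun setT (b \_ Q) ->
    sqi ((leb \x leb) \x @lebesgue_measure R)%E (b \_ Q) =
    (\int[tm]_t energy m (b \_ Q) t)%E.
  set g := b \_ Q => mg.
  transitivity (\int[@lebesgue_measure R]_t sqi (sigma_finite_prod leb leb) (fun x => g (x, t)))%E.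
    exact: (sqi_prodE (sigma_finite_prod (tuple_lebesgue d) (tuple_lebesgue d)) lebesgue_measure mg).
  rewrite ge0_integral_mrestr; last 2 first.
  - exact: measurable_energy.
  - by move=> t; exact: sqi_ge0.
  rewrite integral_mkcond [RHS]integral_mkcond; apply: eq_integral => t _.
  rewrite {1}/patch mem_setT /patch; case: ifPn => tT.
    have gD : (fun x => g (x, t)) \_ (Y `*` Y) = (fun x => g (x, t)).
      by apply: restrict_eq => x nDx; rewrite /g /patch memNset// => -[].
    rewrite /energy -gD sqi_prod_restrict// gD; mfun.
  rewrite (_ : (fun x => _) = cst 0) ?sqi0//; apply/funext => x.
  by rewrite /g /patch memNset// => -[_ /mem_set]; exact/negP.
rewrite /L2YYt /L2; split=> [/LfunE[mb lb]|[mb lb]].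
  by split; rewrite -?h.
by apply/LfunE; split=> //; rewrite h.
Qed.

End control_spaces.

(** * The forward problem as a Volterra equation *)

Section forward_representation.
Context {R : realType} {d : nat}.
Variables (Y : set (Rn R d)) (T : R).
Hypothesis mY : measurable Y.
Hypothesis Yoo : (tuple_lebesgue d Y < +oo)%E.
Hypothesis T0 : 0 < T.
Notation leb := (tuple_lebesgue _).
Notation m := (mfrestr mY Yoo).
Notation tm := (time_measure T).
Variables (sigma : R -> R) (k : R).
Hypothesis k_lip : forall x y, `|sigma x - sigma y| <= k * `|x - y|.
Hypothesis msigma : measurable_fun setT sigma.
Variables (a : Rn R d * measurableTypeR R -> R).
Variables (b : Rn R d * Rn R d * measurableTypeR R -> R) (f0 : Rn R d -> R).
Hypotheses (La : L2Yt Y T a) (Lb : L2YYt Y T b) (Lf0 : L2 leb Y f0).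
Let ra := a \_ (Y `*` `]0, T[).
Let rb := b \_ (Y `*` Y `*` `]0, T[).
Let rf0 := f0 \_ Y.
Let sa : sqint (m \x tm)%E ra. Proof. exact/L2YtE. Qed.
Let mb : measurable_fun setT rb. Proof. by have /L2YYtE[] := Lb. Qed.
Let ib : (\int[tm]_t energy m rb t < +oo)%E.
Proof. by have /(L2YYtE T mY Yoo)[] := Lb. Qed.
Let sf0 : sqint m rf0. Proof. exact/L2E. Qed.

Let fieldE (f : Rn R d -> R) y t : measurable_fun setT (f \_ Y) -> Y y -> 0 < t < T ->
  a (y, t) - \int[leb]_(z in Y) (b (y, z, t) * f z) = ra (y, t) - app m rb (f \_ Y) y t.
Proof.
move=> mf Yy tT; have tT' : t \in `]0, T[ by rewrite in_itv.
congr (_ - _); first by rewrite /ra /patch mem_set.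
have E z : ((fun z => b (y, z, t) * f z) \_ Y) z = rb (y, z, t) * (f \_ Y) z.
  rewrite /rb /patch; case: ifPn => Yz; last by rewrite mulr0.
  by rewrite mem_set//; split=> //; split=> //; exact: set_mem.
rewrite /app -(Rintegral_restrict mY Yoo); last first.
  rewrite (_ : _ \_ Y = fun z => rb (y, z, t) * (f \_ Y) z); first by mfun.
  by apply/funext => z; exact: E.
by apply: eq_Rintegral => z _; rewrite E.
Qed.

Let restrictB (f g : Rn R d -> R) : (f \- g) \_ Y = fun y => (f \_ Y) y - (g \_ Y) y.
Proof. by apply/funext => y; rewrite /patch; case: ifP => //=; rewrite subr0. Qed.

Let L2normB (f g : Rn R d -> R) : L2 leb Y f -> L2 leb Y g ->
  L2norm leb Y (f \- g) = Num.sqrt (fine (sqi m (fun y => (f \_ Y) y - (g \_ Y) y))).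
Proof.
move=> /(L2E _ Yoo) sf /(L2E _ Yoo) sg.
rewrite (L2normE mY Yoo) ?restrictB//; apply/(L2E mY Yoo).
by rewrite restrictB; exact: sqintB.
Qed.

Let forward_solution_exists : exists f, forward_solution Y T sigma a b f0 f.
Proof.
have mbf := @measurable_before R.
have [v vs] := solution_exists mbf (before_weights T0) msigma k_lip sa mb ib sf0.
have [sv _] := vs.
pose F t y := traj tm before rf0 v (y, t).
have sF t : sqint m (F t) by exact: sqint_traj.
pose f t := F t \_ Y.
have fF t : f t \_ Y = f t.
  by apply: restrict_eq => y nYy; rewrite /f /patch memNset.
have fFae t : ae_eq m setT (f t) (F t).
  by apply/ae_restrict => //; apply: aeW => y Yy _; rewrite /f /patch mem_set.
have mf t : measurable_fun setT (f t).
  by apply/(measurable_restrictT _ _).1 => //; apply: measurable_funTS; case: (sF t).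
have sf t : sqint m (f t) by apply: sqint_ae_eq (sF t) (fFae t).
have Lf t : L2 leb Y (f t) by apply/(L2E mY Yoo); rewrite fF.
exists f; split => // t tT.
- have -> : (fun s => L2norm leb Y (f s \- f t)) = fun s =>
      Num.sqrt (fine (sqi m (fun y => F s y - F t y))).
    apply/funext => s; rewrite L2normB// !fF; congr (Num.sqrt (fine _)).
    apply: ae_eq_sqi.
    + by apply: measurable_funB; exact: mf.
    + by apply: measurable_funB; [case: (sF s)|case: (sF t)].
    + by apply: aeI (fFae s) (fFae t) => y h1 h2 yT; rewrite h1// h2.
  rewrite -[X in _ --> X](@sqrtr0 R).
  apply: continuous_cvg; first exact: sqrt_continuous.
  exact: traj_continuous.
- apply/(ae_eq_restrict mY Yoo)/(ae_restrict mY Yoo); apply: aeW => y Yy _.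
  rewrite fF [LHS]/f [LHS]/patch mem_set// [RHS]/patch mem_set//.
  have -> : f0 y = rf0 y by rewrite /rf0 /patch mem_set.
  have tT' : 0 <= t <= T by rewrite in_itv in tT.
  have h := trajectory_of_solution (H := fun y s => sigma (a (y, s) -
    \int[leb]_(z in Y) (b (y, z, s) * f s z))) (y := y) T0 vs tT'.
  apply: h => s sT.
  rewrite (fieldE _ Yy sT) ?fF//; congr (sigma (_ - _)).
  apply: app_ae_eq => //; first by case: (sF s).
Qed.

(** [forward] is a choice that means something only if a solution exists. Existence comes from the
    Volterra equation, and [solution_of_trajectory] brings the chosen path back to a velocity,
    whatever representative was chosen. *)
Theorem forward_representation : exists v,
  [/\ solves m tm before sigma ra rb rf0 v,
      L2 leb Y (forward Y T sigma a b f0 T) &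
      ae_eq m setT (forward Y T sigma a b f0 T \_ Y) (fun y => rf0 y + total tm v y)].
Proof.
have := xgetPex (fun=> cst 0) forward_solution_exists.
rewrite -/(forward Y T sigma a b f0); set f := forward _ _ _ _ _ _ => -[Lf cf fE].
pose F t := f t \_ Y.
have itvE t : 0 <= t <= T -> t \in `[0, T] by rewrite in_itv.
have sF t : 0 <= t <= T -> sqint m (F t) by move=> /itvE /Lf /(L2E mY Yoo).
have [||||v [vs Fv]] := @solution_of_trajectory _ _ _ m T T0 sigma k k_lip msigma ra rb
  rf0 sa mb ib sf0 F (fun y s => sigma (a (y, s) - \int[leb]_(z in Y) (b (y, z, s) * f s z))).
- exact: sF.
- move=> t tT.
  have h := cf t (itvE t tT).
  have h2 : L2norm leb Y (f s \- f t) * L2norm leb Y (f s \- f t)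
      @[s --> within `[0, T] (nbhs t)] --> (0 : R).
    by rewrite -[X in _ --> X](mulr0 0); exact: cvgM.
  apply: cvg_trans h2; apply: near_eq_cvg; rewrite near_withinE; apply: nearW => s sT /=.
  have {}sT : 0 <= s <= T by move: sT; rewrite /= in_itv.
  rewrite (L2normB (Lf _ (itvE _ sT)) (Lf _ (itvE _ tT))) -expr2 sqr_sqrtr//.
  by rewrite fine_ge0// sqi_ge0.
- apply/ae_restrict => //; apply: aeW => y Yy s sT.
  rewrite (fieldE _ Yy sT)//; have [] := sF s => //.
  by move: sT => /andP[? ?]; rewrite !ltW.
- move=> t tT; have /(ae_eq_restrict mY Yoo)/(ae_restrict mY Yoo) := fE t (itvE t tT).
  move=> h; apply/(ae_restrict mY Yoo); apply: aeS h => y h Yy.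
  have := h Yy I; rewrite /F /patch mem_set// => ->.
  by rewrite /rf0 /patch mem_set.
have TT : 0 <= T <= T by rewrite lexx ltW.
exists v; split => //; first exact/Lf/itvE.
apply: aeS (Fv T TT) => y h yT; rewrite /F in h; rewrite h// /traj total_before//.
by case: vs => -[].
Qed.

End forward_representation.

(** * Open and bounded sets of tuples *)

Section euclidean_sets.
Context {R : realType} {n : nat}.
Variable Y : set (Rn R n).

Let box (a b : 'I_n -> R) := [set x : Rn R n | forall i, tnth x i \in `[a i, b i]].

(** The topology sits on row vectors and the sigma-algebra on tuples. Boxes with rational corners
    contained in Y link the two: they are measurable, countable in number, and cover Y when it is
    open. *)
Lemma measurable_open_row_set : open (row_set Y) -> measurable Y.
Proof.
move=> oY.
pose I : countType := {ffun 'I_n -> rat * rat}.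
pose B (q : I) := box (fun i => ratr (q i).1) (fun i => ratr (q i).2).
pose F (q : I) := if `[< B q `<=` Y >] then B q else set0.
suff -> : Y = \bigcup_q F q.
  apply: countable_bigcupT_measurable; first exact: countableP.
  by move=> q; rewrite /F; case: ifP => _ //; exact: measurable_box.
apply/seteqP; split=> [y Yy|y [q _]]; last first.
  by rewrite /F; case: ifP => // /asboolP; exact.
pose v : 'rV[R]_n := \row_i tnth y i.
have vE (u : 'rV[R]_n) : row_set Y u = Y [tuple u ord0 i | i < n] by [].
have Yv : row_set Y v.
  rewrite vE; have -> // : [tuple v ord0 i | i < n] = y.
  by apply: eq_from_tnth => i; rewrite tnth_mktuple mxE.
have /nbhs_ballP[e /= e0 eY] := open_nbhs_nbhs (conj oY Yv).
have lo i : exists q : rat, ratr q \in `]tnth y i - e, tnth y i[.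
  by apply: rat_in_itvoo; rewrite ltrBlDr ltrDl.
have hi i : exists q : rat, ratr q \in `]tnth y i, tnth y i + e[.
  by apply: rat_in_itvoo; rewrite ltrDl.
pose q : I := [ffun i => (sval (cid (lo i)), sval (cid (hi i)))].
have qlo i : tnth y i - e < ratr (q i).1 < tnth y i.
  by rewrite ffunE/=; case: cid => r /=; rewrite in_itv.
have qhi i : tnth y i < ratr (q i).2 < tnth y i + e.
  by rewrite ffunE/=; case: cid => r /=; rewrite in_itv.
exists q => //; rewrite /F ifT; last first.
  apply/asboolP => z Bz.
  pose u : 'rV[R]_n := \row_i tnth z i.
  have : row_set Y u.
    apply: eY; rewrite mx_norm_ball /ball_ /= [ltLHS]/Num.norm/= mx_normrE.
    apply/bigmax_ltP; split => // -[i j] _ /=; rewrite !mxE ltr_distl.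
    have := Bz j; rewrite in_itv/= => /andP[h1 h2].
    have /andP[l1 l2] := qlo j; have /andP[u1 u2] := qhi j.
    apply/andP; split; lra.
  rewrite vE; have -> // : [tuple u ord0 i | i < n] = z.
  by apply: eq_from_tnth => i; rewrite tnth_mktuple mxE.
move=> i; rewrite in_itv/=; have /andP[_ /ltW ->] := qlo i.
by have /andP[/ltW -> _] := qhi i.
Qed.

Lemma tuple_lebesgue_lty : measurable Y -> bounded_set (row_set Y) ->
  (tuple_lebesgue n Y < +oo)%E.
Proof.
move=> mY [M [_ hM]].
pose K := `|M| + 1; have MK : M < K by rewrite (le_lt_trans (ler_norm _))// ltrDl.
have YB : Y `<=` box (fun=> - K) (fun=> K).
  move=> y Yy i; rewrite in_itv/= -ler_norml.
  pose v : 'rV[R]_n := \row_i tnth y i.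
  have /(hM K MK) : row_set Y v.
    rewrite /row_set /=; have -> // : [tuple v ord0 i | i < n] = y.
    by apply: eq_from_tnth => j; rewrite tnth_mktuple mxE.
  rewrite /= [leLHS]/Num.norm/= mx_normrE; apply: le_trans.
  by have := le_bigmax 0 (fun i : 'I_1 * 'I_n => `|v i.1 i.2|) (ord0, i); rewrite mxE.
apply: (@le_lt_trans _ _ (tuple_lebesgue n (box (fun=> - K) (fun=> K)))).
  by apply: le_measure => //; rewrite inE//; exact: measurable_box.
rewrite tuple_lebesgue_box ?ltry// => i.
have : 0 <= K by rewrite addr_ge0.
lra.
Qed.

End euclidean_sets.

(** * First variation of the loss *)

Section residual_expansion.
Context {dX dV} {X : measurableType dX} {V : measurableType dV} {R : realType}.
Variables (m : {finite_measure set X -> \bar R}) (n : {finite_measure set V -> \bar R}).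

Definition integral_operator (k : V * X -> R) (f : X -> R) u : R :=
  \int[m]_y (k (u, y) * f y).

Lemma sqint_operator k f : sqint (n \x m)%E k -> sqint m f ->
  sqint n (integral_operator k f).
Proof.
move=> [mk lk] [mf lf]; split.
  apply: (measurable_integralr m (f := fun p => k p * f p.2)); mfun.
apply: (le_lt_trans (sqi_kernel n m mk mf)).
by rewrite lte_mul_pinfty ?sqi_ge0// ge0_fin_numE ?sqi_ge0.
Qed.

Lemma operator_bound k f : sqint (n \x m)%E k -> sqint m f ->
  fine (sqi n (integral_operator k f)) <= fine (sqi (n \x m)%E k) * fine (sqi m f).
Proof.
move=> sk sf; have so := sqint_operator sk sf.
rewrite -lee_fin EFinM -!sqi_fineK//; apply: sqi_kernel; [exact: sk.1|exact: sf.1].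
Qed.

Lemma sqint_adjoint k g : sqint (n \x m)%E k -> sqint n g ->
  sqint m (fun y => \int[n]_u (k (u, y) * g u)).
Proof.
move=> [mk lk] [mg lg]; split.
  by apply: (measurable_integralr n (f := fun q => k (q.2, q.1) * g q.2)); mfun.
have h := sqi_kernel m n (b := fun q => k (q.2, q.1)) _ mg.
apply: (@le_lt_trans _ _ (sqi (m \x n) (fun q => k (q.2, q.1)) * sqi n g)%E).
  by apply: h; mfun.
have -> : sqi (m \x n)%E (fun q => k (q.2, q.1)) = sqi (n \x m)%E k.
  rewrite (sqi_prodE n m mk) /sqi fubini_tonelli1//=.
    by apply: measurable_sqr; mfun.
  by move=> q; rewrite lee_fin sqr_ge0.
by rewrite lte_mul_pinfty ?sqi_ge0// ge0_fin_numE ?sqi_ge0.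
Qed.

Variables (k dk : V * X -> R) (mu dmu p : V -> R) (f : X -> R).
Hypotheses (sk : sqint (n \x m)%E k) (sdk : sqint (n \x m)%E dk).
Hypotheses (smu : sqint n mu) (sdmu : sqint n dmu) (sp : sqint n p) (sf : sqint m f).

Definition residual (k : V * X -> R) (mu p : V -> R) (f : X -> R) u : R :=
  integral_operator k f u + mu u - p u.

Definition adjoint_residual y : R := \int[n]_u (k (u, y) * residual k mu p f u).

Let r := residual k mu p f.
Let B u := integral_operator dk f u + dmu u.

Lemma sqint_residual : sqint n r.
Proof. by apply: sqintB => //; apply: sqintD => //; exact: sqint_operator. Qed.

Lemma sqint_adjoint_residual : sqint m adjoint_residual.
Proof. exact: (sqint_adjoint sk sqint_residual). Qed.

(** The new residual is r + L with L = A + s (B + G), where A and G apply k and dk to f' - f. In |r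
    + L|^2 the terms s <r, G> and |L|^2 are O(s^2), and <r, A> moves to the adjoint. Only the size
    of f' - f is used, so f' need not be differentiable in s. *)
Lemma residual_expansion (C0 : R) : 0 <= C0 -> exists2 C : R, 0 <= C &
  forall s f', `|s| <= 1 -> sqint m f' ->
    fine (sqi m (fun y => f' y - f y)) <= C0 * s ^+ 2 ->
    `|fine (sqi n (residual (fun q => k q + s * dk q) (fun u => mu u + s * dmu u) p f'))
      - fine (sqi n r)
      - 2 * (\int[m]_y (adjoint_residual y * (f' y - f y)) + s * \int[n]_u (r u * B u))|
    <= C * s ^+ 2.
Proof.
move=> C00; have sr := sqint_residual.
have sB : sqint n B by apply: sqintD => //; exact: sqint_operator.
pose nk := fine (sqi (n \x m)%E k); pose ndk := fine (sqi (n \x m)%E dk).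
pose nr := fine (sqi n r); pose nB := fine (sqi n B).
have nk0 : 0 <= nk by rewrite fine_ge0 ?sqi_ge0.
have ndk0 : 0 <= ndk by rewrite fine_ge0 ?sqi_ge0.
have nr0 : 0 <= nr by rewrite fine_ge0 ?sqi_ge0.
have nB0 : 0 <= nB by rewrite fine_ge0 ?sqi_ge0.
(* The first summand bounds 2 s <r, G> by Cauchy-Schwarz, the second bounds |L|^2. *)
exists (2 * Num.sqrt (nr * (ndk * C0)) + (2 * (nk * C0) + 2 * (2 * nB + 2 * (ndk * C0)))).
  by rewrite !(addr_ge0, mulr_ge0, sqrtr_ge0).
move=> s f' s1 sf' hf'.
have s2 : s ^+ 2 <= 1 by rewrite -real_normK ?num_real// expr_le1.
have s20 : 0 <= s ^+ 2 by exact: sqr_ge0.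
pose D y := f' y - f y; have sD : sqint m D by exact: sqintB.
pose A := integral_operator k D; pose G := integral_operator dk D.
have sA : sqint n A by exact: sqint_operator.
have sG : sqint n G by exact: sqint_operator.
have nA : fine (sqi n A) <= nk * C0 * s ^+ 2.
  by apply: (le_trans (operator_bound sk sD)); rewrite -mulrA ler_wpM2l.
have nG : fine (sqi n G) <= ndk * C0 * s ^+ 2.
  by apply: (le_trans (operator_bound sdk sD)); rewrite -mulrA ler_wpM2l.
pose L u := A u + s * (B u + G u).
have sBG := sqintD sB sG; have sL : sqint n L by exact: (sqintD sA (sqintZ s sBG)).
have sks : sqint (n \x m)%E (fun q => k q + s * dk q) by exact: (sqintD sk (sqintZ s sdk)).
have rE : ae_eq n setT (residual (fun q => k q + s * dk q) (fun u => mu u + s * dmu u) p f')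
    (fun u => r u + L u).
  apply: aeI (sqint_slice1 sk) (sqint_slice1 sdk) => u ku dku _.
  rewrite /residual /L /r /B /A /G /residual /integral_operator.
  have E (g : X -> R) : sqint m g -> \int[m]_y ((k (u, y) + s * dk (u, y)) * g y) =
      \int[m]_y (k (u, y) * g y) + s * \int[m]_y (dk (u, y) * g y).
    move=> sg; rewrite -RintegralZl//; last exact: sqintM_integrable.
    rewrite -RintegralD//; first by apply: eq_Rintegral => y _; rewrite mulrDl mulrA.
      exact: sqintM_integrable.
    have := sqintM_integrable (sqintZ s dku) sg.
    by under eq_fun do rewrite -mulrA.
  have ED (h : X -> R) : sqint m h -> \int[m]_y (h y * D y) =
      \int[m]_y (h y * f' y) - \int[m]_y (h y * f y).
    move=> sh; rewrite -RintegralB//; last 2 first.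
    - exact: sqintM_integrable.
    - exact: sqintM_integrable.
    by apply: eq_Rintegral => y _; rewrite mulrBr.
  by rewrite E// !ED//; ring.
have sres : sqint n (residual (fun q => k q + s * dk q) (fun u => mu u + s * dmu u) p f').
  apply: sqintB => //; apply: sqintD; first exact: sqint_operator.
  by apply: sqintD => //; exact: sqintZ.
have srL := sqintD sr sL.
rewrite (ae_eq_sqi sres.1 srL.1 rE) -Rintegral_sqr.
have irL := sqintM_integrable sr sL; have iLL := sqintM_integrable sL sL.
have irr := sqintM_integrable sr sr.
have -> : \int[n]_u ((r u + L u) * (r u + L u)) =
    \int[n]_u (r u * r u) + 2 * \int[n]_u (r u * L u) + \int[n]_u (L u * L u).
  rewrite -RintegralZl// -!RintegralD//; last 2 first.
  - have i2 := sqintM_integrable sr (sqintD sr (sqintZ 2 sL)).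
    by move: i2; under eq_fun do rewrite mulrDr mulrCA.
  - by have := sqintM_integrable (sqintZ 2 sr) sL; under eq_fun do rewrite -mulrA.
  by apply: eq_Rintegral => u _; ring.
have -> : \int[n]_u (r u * L u) = \int[m]_y (adjoint_residual y * D y) +
    s * \int[n]_u (r u * B u) + s * \int[n]_u (r u * G u).
  have -> : \int[m]_y (adjoint_residual y * D y) = \int[n]_u (r u * A u).
    rewrite (kernel_adjoint sk sr sD); apply: eq_Rintegral => y _; exact: mulrC.
  have i1 := sqintM_integrable sr sA; have i2 := sqintM_integrable sr sB.
  have i3 := sqintM_integrable sr sG.
  have i2' := sqintM_integrable sr (sqintZ s sB); have i3' := sqintM_integrable sr (sqintZ s sG).
  have i12 := sqintM_integrable sr (sqintD sA (sqintZ s sB)).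
  rewrite -!RintegralZl// -!RintegralD//; last 3 first.
  - by move: i12; under eq_fun do rewrite mulrDr mulrCA.
  - by move: i3'; under eq_fun do rewrite mulrCA.
  - by move: i2'; under eq_fun do rewrite mulrCA.
  by apply: eq_Rintegral => u _; rewrite /L; ring.
rewrite (Rintegral_sqr n r) (Rintegral_sqr n L).
set x := \int[m]_y _; set y := s * _; set z := \int[n]_u (r u * G u); set t := fine (sqi n L).
rewrite (_ : _ - 2 * (x + y) = 2 * (s * z) + t); last by rewrite /nr /r; ring.
have t0 : 0 <= t by rewrite fine_ge0 ?sqi_ge0.
have zle : `|s * z| <= Num.sqrt (nr * (ndk * C0)) * s ^+ 2.
  have zz : z ^+ 2 <= nr * (ndk * C0) * s ^+ 2.
    apply: (le_trans (Rcauchy_schwarz sr sG)).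
    by rewrite -mulrA ler_wpM2l.
  rewrite normrM -[X in _ <= _ * X]real_normK ?num_real// expr2 mulrCA ler_wpM2l//.
  rewrite -sqrtr_sqr (le_trans (ler_wsqrtr zz))// sqrtrM ?mulr_ge0//.
  by rewrite sqrtr_sqr.
have tle : t <= (2 * (nk * C0) + 2 * (2 * nB + 2 * (ndk * C0))) * s ^+ 2.
  apply: (le_trans (fine_sqiD sA (sqintZ s sBG))); rewrite (fine_sqiZ s sBG).
  have h1 := fine_sqiD sB sG.
  have h2 : fine (sqi n (fun u => B u + G u)) <= 2 * nB + 2 * (ndk * C0).
    apply: (le_trans h1); rewrite lerD2l ler_wpM2l//; apply: (le_trans nG).
    by rewrite -[leRHS]mulr1 ler_wpM2l ?mulr_ge0.
  have h3 : s ^+ 2 * fine (sqi n (fun u => B u + G u)) <=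
      (2 * nB + 2 * (ndk * C0)) * s ^+ 2 by rewrite mulrC ler_wpM2r.
  by rewrite [leRHS]mulrDl -!(mulrA 2); apply: lerD; rewrite ler_wpM2l.
apply: (le_trans (ler_normD _ _)); rewrite (ger0_norm t0) normrM ger0_norm//.
by rewrite [leRHS]mulrDl -(mulrA 2); apply: lerD => //; rewrite ler_wpM2l.
Qed.

End residual_expansion.

Section uniqueness.
Context {dX} {X : measurableType dX} {R : realType}.
Variable m : {finite_measure set X -> \bar R}.
Variable T : R.
Hypothesis T0 : 0 < T.
Notation tm := (time_measure T).
Notation mt := (m \x tm)%E.
Implicit Types v w : X * measurableTypeR R -> R.

Lemma totalB v w : sqint mt v -> sqint mt w ->
  ae_eq m setT (total tm (fun p => w p - v p)) (fun y => total tm w y - total tm v y).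
Proof.
move=> sv sw.
apply: aeI (sqint_slice_integrable sv) (sqint_slice_integrable sw) => y iv iw _.
by rewrite /total RintegralB.
Qed.

(** The perturbation bound in the zero direction with s = 0. *)
Lemma solution_unique (sigma : R -> R) (k : R) a b f0 v w :
  (forall x y, `|sigma x - sigma y| <= k * `|x - y|) -> sqint mt a ->
  measurable_fun setT b -> (\int[tm]_t energy m b t < +oo)%E -> sqint m f0 ->
  solves m tm before sigma a b f0 v -> solves m tm before sigma a b f0 w ->
  sqi mt (fun p => w p - v p) = 0%E.
Proof.
move=> lip sa mb ib sf0 vs ws.
have m0 : measurable_fun setT ((fun=> 0) : X * X * measurableTypeR R -> R) by exact: measurable_cst.
have i0 : (\int[tm]_t energy m (fun=> 0%R) t < +oo)%E.
  by under eq_integral do rewrite [energy _ _ _]sqi0; rewrite integral0.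
have [C _ hC] := perturbation_bound (@measurable_before R) (before_weights T0) lip
  (sqint0 mt) mb m0 ib i0 sf0 vs.
apply/eqP; rewrite eq_le sqi_ge0 andbT.
have a0 : (fun p => a p + 0 * 0) = a by apply/funext => p; rewrite mulr0 addr0.
have b0 : (fun p => b p + 0 * 0) = b by apply/funext => p; rewrite mulr0 addr0.
have := hC 0 w; rewrite normr0 a0 b0 => /(_ ler01 ws).
by rewrite (_ : C * 0 ^+ 2 = 0)// expr0n mulr0.
Qed.

Lemma total_ae_eq v w : sqint mt v -> sqint mt w ->
  sqi mt (fun p => w p - v p) = 0%E -> ae_eq m setT (total tm w) (total tm v).
Proof.
move=> sv sw wv0; have sd := sqintB sw sv.
have : sqi m (total tm (fun p => w p - v p)) = 0%E.
  apply/eqP; rewrite eq_le sqi_ge0 andbT; apply: (le_trans (sqi_total sd)).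
  by rewrite wv0 mule0.
move=> /(sqi_eq0 _ (sqint_total sd).1) h.
apply: aeI h (totalB sv sw) => y h1 h2 yT; apply/eqP; rewrite -subr_eq0.
by rewrite -h2// h1.
Qed.

End uniqueness.

Section derivative_at_0.
Context {R : realType}.
Variable f : R -> R.

Lemma is_derive0_quadratic (C : R) :
  (forall s : R, `|s| <= 1 -> `|f s - f 0| <= C * s ^+ 2) -> is_derive (0 : R) (1 : R) f 0.
Proof.
move=> fC.
have C0 : 0 <= C.
  have := fC 1; rewrite normr1 lexx expr1n mulr1 => /(_ isT); exact: le_trans.
have h : (fun h : R => h^-1 *: (f (h *: 1 + 0) - f 0)) x @[x --> 0^'] --> (0 : R).
  apply/cvgr0Pnorm_le => e e0.
  exists (Num.min 1 (e / (C + 1))); first by rewrite /= lt_min ltr01 divr_gt0// ltr_wpDl.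
  move=> x /=; rewrite sub0r normrN lt_min => /andP[x1 xe] x0.
  rewrite addr0 [x *: 1]mulr1 normrM normfV ler_pdivrMl ?normr_gt0//.
  apply: (le_trans (fC _ (ltW x1))); rewrite -real_normK ?num_real// expr2 mulrCA.
  rewrite ler_wpM2l//; move: xe; rewrite ltr_pdivlMr ?ltr_wpDl// => /ltW; apply: le_trans.
  by rewrite mulrC ler_wpM2l// lerDl.
apply: DeriveDef; first by apply/cvg_ex; exists 0.
exact: cvg_lim h.
Qed.

Lemma is_derive0_seq : is_derive (0 : R) (1 : R) f 0 ->
  (4^-1 ^+ n)^-1 * (f (4^-1 ^+ n) - f 0) @[n --> \oo] --> (0 : R).
Proof.
move=> [df dE].
have h : (fun h : R => h^-1 *: (f (h *: 1 + 0) - f 0)) x @[x --> 0^'] --> (0 : R).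
  by rewrite [X in _ --> X](_ : _ = 'D_1 f 0)//; exact: df.
apply/cvgr0Pnorm_le => e e0; move/cvgr0Pnorm_le : h => /(_ e e0)[d /= d0 hd].
have s0 : (4^-1 ^+ n : R) @[n --> \oo] --> (0 : R).
  by apply: cvg_expr; rewrite ger0_norm// invf_lt1// ltr1n.
move/cvgr0Pnorm_lt : s0 => /(_ d d0); apply: filterS => n nd.
have n0 : (4^-1 ^+ n : R) != 0 by rewrite expf_neq0// invr_eq0 pnatr_eq0.
have := hd (4^-1 ^+ n); rewrite /= sub0r normrN addr0 [_ *: 1]mulr1; exact.
Qed.

End derivative_at_0.

Lemma ae_prod_setX dX dY (X : measurableType dX) (Z : measurableType dY) (R : realType)
    (m : {finite_measure set X -> \bar R}) (n : {finite_measure set Z -> \bar R})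
    (D : set X) (E : set Z) : measurable D -> measurable E ->
  m (~` D) = 0%E -> n (~` E) = 0%E -> {ae (m \x n)%E, forall p, (D `*` E) p}.
Proof.
move=> mD mE mD0 nE0; exists (~` (D `*` E)); split => //.
  by apply: measurableC; exact: measurableX.
have -> : ~` (D `*` E) = (~` D `*` setT) `|` (setT `*` ~` E).
  apply/seteqP; split=> [[x y] /= nDE|[x y] /= [[nD _] []//|[_ nE] []//]].
  by have [Dx|nDx] := pselect (D x); [right; split=> // Ey; exact: nDE|left].
apply/eqP; rewrite eq_le measure_ge0 andbT.
have mDc := measurableC mD; have mEc := measurableC mE.
have e1 : (m \x n)%E (~` D `*` setT) = 0%E.
  by rewrite product_measure1E//= ?mD0 ?mul0e.
have e2 : (m \x n)%E (setT `*` ~` E) = 0%E.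
  by rewrite product_measure1E//= ?nE0 ?mule0.
apply: (le_trans (measureU2 _ _ _)).
- by apply: measurableX => //; exact: measurableC.
- by apply: measurableX => //; exact: measurableC.
by rewrite [X in (X + _ <= _)%E]e1 [X in (_ + X <= _)%E]e2 adde0.
Qed.

(** * The loss along a direction and its critical points *)

Section loss_of_solution.
Context {R : realType} {d l N : nat}.
Variables (Y : set (Rn R d)) (U : set (Rn R l)) (T : R).
Hypotheses (mY : measurable Y) (Yoo : (tuple_lebesgue d Y < +oo)%E).
Hypotheses (mU : measurable U) (Uoo : (tuple_lebesgue l U < +oo)%E).
Hypothesis T0 : 0 < T.
Notation leb := (tuple_lebesgue _).
Notation m := (mfrestr mY Yoo).
Notation n := (mfrestr mU Uoo).
Notation tm := (time_measure T).
Notation mt := (m \x tm)%E.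
Notation QY := (Y `*` `]0, T[%classic).
Notation QYY := (Y `*` Y `*` `]0, T[%classic).
Variables (sigma h : R -> R) (k : R).
Hypothesis k_lip : forall x y, `|sigma x - sigma y| <= k * `|x - y|.
Hypothesis msigma : measurable_fun setT sigma.
Hypothesis hE : forall x, h x = x.
Variables (fI : 'I_N -> Rn R d -> R) (P : 'I_N -> Rn R l -> R).
Hypothesis LfI : forall j, L2 leb Y (fI j).
Hypothesis LP : forall j, L2 leb U (P j).

Definition solution_of (a : Rn R d * measurableTypeR R -> R)
    (b : Rn R d * Rn R d * measurableTypeR R -> R) j v :=
  solves m tm before sigma (a \_ QY) (b \_ QYY) (fI j \_ Y) v.

Definition terminal j v y : R := (fI j \_ Y) y + total tm v y.

Lemma sqint_terminal j v : sqint mt v -> sqint m (terminal j v).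
Proof. by move=> sv; apply: sqintD; [exact/L2E|exact: sqint_total]. Qed.

Lemma solution_of_exists a b j : L2Yt Y T a -> L2YYt Y T b ->
  exists v, solution_of a b j v.
Proof.
move=> /(L2YtE T mY Yoo) sa /(L2YYtE T mY Yoo)[mb ib].
apply: (solution_exists (@measurable_before R) (before_weights T0) msigma k_lip) => //.
exact/L2E.
Qed.

Lemma forward_terminal a b j v : L2Yt Y T a -> L2YYt Y T b -> solution_of a b j v ->
  L2 leb Y (forward Y T sigma a b (fI j) T) /\
  ae_eq m setT (forward Y T sigma a b (fI j) T \_ Y) (terminal j v).
Proof.
move=> La Lb vs.
have [w [ws Lf fw]] := forward_representation mY Yoo T0 k_lip msigma La Lb (LfI j).
split=> //; have /(L2YtE T mY Yoo) sa := La; have /(L2YYtE T mY Yoo)[mb ib] := Lb.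
have sf0 : sqint m (fI j \_ Y) by exact/L2E.
have vw := solution_unique T0 k_lip sa mb ib sf0 vs ws.
apply: aeI fw (total_ae_eq vs.1 ws.1 vw) => y -> // wv _.
by rewrite /terminal wv.
Qed.

Lemma kernel_operator_restrict w (f g : Rn R d -> R) u : U u ->
  measurable_fun setT (w \_ (U `*` Y)) -> measurable_fun setT (f \_ Y) ->
  measurable_fun setT g -> ae_eq m setT (f \_ Y) g ->
  kernel_operator leb Y w f u = integral_operator m (w \_ (U `*` Y)) g u.
Proof.
move=> Uu mw mf mg fg; rewrite /kernel_operator /integral_operator.
set rw := w \_ _ in mw *.
have E z : ((fun z => w (u, z) * f z) \_ Y) z = rw (u, z) * (f \_ Y) z.
  rewrite /rw /patch; case: ifPn => Yz; last by rewrite mulr0.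
  by rewrite mem_set//; split=> //; exact: set_mem.
have EE : (fun z => w (u, z) * f z) \_ Y = fun z => rw (u, z) * (f \_ Y) z.
  by apply/funext => z; exact: E.
rewrite -(Rintegral_restrict mY Yoo); last by rewrite EE; mfun.
apply: Rintegral_ae_eq; [by rewrite EE; mfun|by mfun|].
by apply: aeS fg => z fgz _; rewrite E fgz.
Qed.

Lemma loss_solution a b w mu (v : 'I_N -> _) : control_space Y U T (a, b, w, mu) ->
  (forall j, solution_of a b j (v j)) ->
  loss Y U T sigma h fI P (a, b, w, mu) = (2 * N%:R)^-1 *
    \sum_j fine (sqi n (residual m (w \_ (U `*` Y)) (mu \_ U) (P j \_ U) (terminal j (v j)))).
Proof.
move=> [La Lb Lw Lmu] vs; rewrite /loss; congr (_ * _); apply: eq_bigr => j _.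
have sw : sqint (n \x m)%E (w \_ (U `*` Y)) by exact/L2UYE.
have smu : sqint n (mu \_ U) by exact/L2E.
have sP : sqint n (P j \_ U) by exact/L2E.
have sF : sqint m (terminal j (v j)) by apply: sqint_terminal; case: (vs j).
have [Lf fE] := forward_terminal La Lb (vs j).
have sr : sqint n (residual m (w \_ (U `*` Y)) (mu \_ U) (P j \_ U) (terminal j (v j))).
  exact: sqint_residual.
have [mr _] := sr.
rewrite -Rintegral_sqr Rintegral_mrestr; last by mfun.
apply: eq_Rintegral => u /set_mem Uu; rewrite hE real_normK ?num_real// expr2.
have /(L2E mY Yoo)[mf _] := Lf.
rewrite /output (kernel_operator_restrict Uu sw.1 mf sF.1 fE) /residual.
by rewrite /patch !(mem_set Uu).
Qed.

Lemma restrict_affine (Z : Type) (D : set Z) (f g : Z -> R) (s : R) :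
  (fun z => f z + s * g z) \_ D = fun z => (f \_ D) z + s * (g \_ D) z.
Proof. by apply/funext => z; rewrite /patch; case: ifP => // _; rewrite mulr0 addr0. Qed.

Definition shift Z (f g : Z -> R) (s : R) : Z -> R := fun z => f z + s * g z.

Lemma control_space_shift a b w mu da db dw dmu (s : R) : `|s| <= 1 ->
  control_space Y U T (a, b, w, mu) -> control_space Y U T (da, db, dw, dmu) ->
  control_space Y U T (shift a da s, shift b db s, shift w dw s, shift mu dmu s).
Proof.
move=> s1 [La Lb Lw Lmu] [Lda Ldb Ldw Ldmu]; split.
- apply/(L2YtE T mY Yoo); rewrite restrict_affine.
  by apply: sqintD; [|apply: sqintZ]; exact/L2YtE.
- apply/(L2YYtE T mY Yoo); rewrite restrict_affine.
  have /(L2YYtE T mY Yoo)[mb ib] := Lb; have /(L2YYtE T mY Yoo)[mdb idb] := Ldb.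
  split; first by mfun.
  exact: (energyD_lty s1 mb mdb ib idb).
- apply/(L2UYE mY Yoo mU Uoo); rewrite restrict_affine.
  by apply: sqintD; [|apply: sqintZ]; exact/L2UYE.
- apply/(L2E mU Uoo); rewrite restrict_affine.
  by apply: sqintD; [|apply: sqintZ]; exact/L2E.
Qed.

Variables (a : Rn R d * measurableTypeR R -> R).
Variables (b : Rn R d * Rn R d * measurableTypeR R -> R).
Variables (w : Rn R l * Rn R d -> R) (mu : Rn R l -> R).
Hypothesis xE : control_space Y U T (a, b, w, mu).
Variable v : 'I_N -> Rn R d * measurableTypeR R -> R.
Hypothesis vs : forall j, solution_of a b j (v j).

Definition terminal_state j := terminal j (v j).
Definition terminal_residual j :=
  residual m (w \_ (U `*` Y)) (mu \_ U) (P j \_ U) (terminal_state j).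
Definition terminal_adjoint j :=
  adjoint_residual m n (w \_ (U `*` Y)) (mu \_ U) (P j \_ U) (terminal_state j).

Let sw : sqint (n \x m)%E (w \_ (U `*` Y)). Proof. by case: xE => _ _ Lw _; exact/L2UYE. Qed.
Let smu : sqint n (mu \_ U). Proof. by case: xE => _ _ _ Lmu; exact/L2E. Qed.
Let sP j : sqint n (P j \_ U). Proof. exact/L2E. Qed.
Let sv j : sqint mt (v j). Proof. by case: (vs j). Qed.

Lemma sqint_terminal_state j : sqint m (terminal_state j).
Proof. exact: sqint_terminal. Qed.
Let sF := sqint_terminal_state.

Lemma sqint_terminal_residual j : sqint n (terminal_residual j).
Proof. exact: (sqint_residual sw smu (sP j) (sF j)). Qed.

Lemma sqint_terminal_adjoint j : sqint m (terminal_adjoint j).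
Proof. exact: (sqint_adjoint_residual sw smu (sP j) (sF j)). Qed.

Section direction.
Variables (da : Rn R d * measurableTypeR R -> R).
Variables (db : Rn R d * Rn R d * measurableTypeR R -> R).
Variables (dw : Rn R l * Rn R d -> R) (dmu : Rn R l -> R).
Hypothesis dxE : control_space Y U T (da, db, dw, dmu).

Definition residual_variation j : R := \int[n]_u (terminal_residual j u *
  (integral_operator m (dw \_ (U `*` Y)) (terminal_state j) u + (dmu \_ U) u)).

Definition perturbed s j z := solves m tm before sigma
  (fun p => (a \_ QY) p + s * (da \_ QY) p) (fun p => (b \_ QYY) p + s * (db \_ QYY) p)
  (fI j \_ Y) z.

Let F (s : R) := loss Y U T sigma h fI P ((a, b, w, mu) + s *: ((da, db, dw, dmu) : controls)).

(** The factor 1/N is the 2 of the squared residual against the 1/(2N) of the loss. The adjoints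
    remain paired with true differences of velocities: the pairing disappears when the adjoints
    vanish, and at a critical point its difference quotients acquire a known limit. *)
Lemma loss_first_variation : exists C : R, forall s z, `|s| <= 1 ->
  (forall j, perturbed s j (z j)) ->
  `|F s - F 0 - N%:R^-1 * \sum_j (\int[m]_y (terminal_adjoint j y *
      total tm (fun p => z j p - v j p) y) + s * residual_variation j)| <= C * s ^+ 2.
Proof.
have [La Lb Lw Lmu] := xE; have [Lda Ldb Ldw Ldmu] := dxE.
have /(L2YtE T mY Yoo) sa := La; have /(L2YYtE T mY Yoo)[mb ib] := Lb.
have /(L2YtE T mY Yoo) sda := Lda; have /(L2YYtE T mY Yoo)[mdb idb] := Ldb.
have sdw : sqint (n \x m)%E (dw \_ (U `*` Y)) by exact/L2UYE.
have sdmu : sqint n (dmu \_ U) by exact/L2E.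
have sfI j : sqint m (fI j \_ Y) by exact/L2E.
pose tT := fine (tm setT).
have tTE : tm setT = tT%:E by rewrite /tT fineK// fin_num_measure.
have tT0 : 0 <= tT by rewrite fine_ge0.
have bound j : exists2 C : R, 0 <= C & forall s z, `|s| <= 1 -> perturbed s j z ->
  fine (sqi m (fun y => terminal j z y - terminal_state j y)) <= C * s ^+ 2.
  have [C C0 hC] := perturbation_bound (@measurable_before R) (before_weights T0) k_lip
    sda mb mdb ib idb (sfI j) (vs j).
  exists (tT * C); first by rewrite mulr_ge0.
  move=> s z s1 zs; have [sz _] := zs.
  have st := sqintB (sqint_terminal j sz) (sF j).
  rewrite -lee_fin -sqi_fineK// -mulrA EFinM -tTE.
  have sd := sqintB sz (sv j).
  apply: (@le_trans _ _ (sqi m (total tm (fun p => z p - v j p)))).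
    apply: le_sqi_ae; [by case: st|by have [] := sqint_total sd|].
    apply: aeS (totalB (sv j) sz) => y /(_ I) ->.
    by rewrite /terminal_state /terminal opprD addrACA subrr add0r.
  apply: (le_trans (sqi_total sd)).
  by apply: lee_wpmul2l; [exact: measure_ge0|exact: hC].
have expansion j : exists2 C : R, 0 <= C & forall s z, `|s| <= 1 -> perturbed s j z ->
  `|fine (sqi n (residual m (fun q => (w \_ (U `*` Y)) q + s * (dw \_ (U `*` Y)) q)
      (fun u => (mu \_ U) u + s * (dmu \_ U) u) (P j \_ U) (terminal j z)))
    - fine (sqi n (terminal_residual j))
    - 2 * (\int[m]_y (terminal_adjoint j y * total tm (fun p => z p - v j p) y) +
           s * residual_variation j)| <= C * s ^+ 2.
  have [C0 C00 hC0] := bound j.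
  have [C C0' hC] := residual_expansion sw sdw smu sdmu (sP j) (sF j) C00.
  exists C => // s z s1 zs; have [sz _] := zs.
  have := hC s (terminal j z) s1 (sqint_terminal j sz) (hC0 s z s1 zs).
  rewrite (_ : \int[m]_y (_ * (terminal j z y - _)) = \int[m]_y (terminal_adjoint j y *
    total tm (fun p => z p - v j p) y))//.
  have [mq _] := sqint_terminal_adjoint j.
  have [mz _] := sqint_terminal j sz; have [mFj _] := sF j.
  have [mt' _] := sqint_total (sqintB sz (sv j)).
  apply: Rintegral_ae_eq.
  - by apply: measurable_funM => //; exact: measurable_funB.
  - exact: measurable_funM.
  apply: aeS (totalB (sv j) sz) => y /(_ I) -> _; congr (_ * _).
  by rewrite /terminal_state /terminal opprD addrACA subrr add0r.
pose C j := sval (cid2 (expansion j)).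
have CE j := s2valP' (cid2 (expansion j)).
exists ((2 * N%:R)^-1 * \sum_j C j) => s z s1 zs.
have F0 : F 0 = (2 * N%:R)^-1 * \sum_j fine (sqi n (terminal_residual j)).
  by rewrite /F scale0r addr0; exact: loss_solution.
have Fs : F s = (2 * N%:R)^-1 * \sum_j fine (sqi n (residual m
      (fun q => (w \_ (U `*` Y)) q + s * (dw \_ (U `*` Y)) q)
      (fun u => (mu \_ U) u + s * (dmu \_ U) u) (P j \_ U) (terminal j (z j)))).
  have hs j : solution_of (shift a da s) (shift b db s) j (z j).
    by rewrite /solution_of /shift !restrict_affine; exact: zs.
  have := loss_solution (control_space_shift s1 xE dxE) hs.
  rewrite /shift !restrict_affine => <-.
  by rewrite /F.
rewrite Fs F0 -mulrBr -sumrB.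
have -> : N%:R^-1 = (2 * N%:R)^-1 * 2 :> R by rewrite invfM mulrAC mulVf ?mul1r// pnatr_eq0.
rewrite -[X in _ - X]mulrA [X in _ - _ * X]mulr_sumr -mulrBr -sumrB normrM.
rewrite ger0_norm ?invr_ge0 ?mulr_ge0// -mulrA; apply: ler_wpM2l.
  by rewrite invr_ge0 mulr_ge0.
rewrite mulr_suml; apply: (le_trans (ler_norm_sum _ _ _)); apply: ler_sum => j _.
exact: (CE j s (z j) s1 (zs j)).
Qed.

Lemma sum_residual_variation : \sum_j residual_variation j =
  \int[(n \x m)%E]_p ((dw \_ (U `*` Y)) p *
    \sum_j terminal_residual j p.1 * terminal_state j p.2) +
  \int[n]_u ((dmu \_ U) u * \sum_j terminal_residual j u).
Proof.
have [Lda Ldb Ldw Ldmu] := dxE.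
have sdw : sqint (n \x m)%E (dw \_ (U `*` Y)) by exact/L2UYE.
have sdmu : sqint n (dmu \_ U) by exact/L2E.
under [in RHS]eq_Rintegral => p _ do rewrite mulr_sumr.
under [X in _ = _ + X]eq_Rintegral => p _ do rewrite mulr_sumr.
rewrite !Rintegral_bigsum; last 2 first.
- by move=> j; exact: (sqintM_integrable sdmu (sqint_terminal_residual j)).
- by move=> j; exact: (kernel_integrable sdw (sqint_terminal_residual j) (sF j)).
rewrite -big_split; apply: eq_bigr => j _; rewrite /residual_variation /=.
have sr := sqint_terminal_residual j.
have ik := kernel_integrable sdw sr (sF j).
rewrite (Rintegral_prod1 ik)/=.
rewrite (_ : \int[n]_x \int[m]_y _ = \int[n]_u (terminal_residual j u *
  integral_operator m (dw \_ (U `*` Y)) (terminal_state j) u)).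
  rewrite -RintegralD//; last 2 first.
  - by apply: (sqintM_integrable sr); exact: sqint_operator.
  - exact: (sqintM_integrable sdmu sr).
  by apply: eq_Rintegral => u _; rewrite mulrDr; congr (_ + _); exact: mulrC.
have [mr _] := sr; have [mFj _] := sF j; have [mdw _] := sdw.
apply: Rintegral_ae_eq.
- apply: (measurable_integralr m (f := fun p => (dw \_ (U `*` Y)) p *
    (terminal_residual j p.1 * terminal_state j p.2))).
  by move: (_ \_ _) (terminal_residual j) (terminal_state j) mr mFj mdw => g1 g2 g3 ? ? ?; mfun.
- apply: measurable_funM => //; exact: (sqint_operator sdw (sF j)).1.
apply: aeS (sqint_slice1 sdw) => u su _; rewrite /integral_operator -RintegralZl//.
  by apply: eq_Rintegral => y _; rewrite mulrCA.
exact: (sqintM_integrable su (sF j)).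
Qed.

Lemma perturbed_exists s j : `|s| <= 1 -> exists z, perturbed s j z.
Proof.
move=> s1; have [Ls Lb' _ _] := control_space_shift s1 xE dxE.
have [z zs] := solution_of_exists j Ls Lb'.
by exists z; move: zs; rewrite /solution_of /perturbed /shift !restrict_affine.
Qed.

(** With zero adjoints the state enters the loss at second order only, and the part linear in s is
    killed by the two residual conditions; a quadratic remainder is left. *)
Lemma stationary_of_conditions :
  (forall j, ae_eq m setT (terminal_adjoint j) (cst 0)) ->
  ae_eq n setT (fun u => \sum_j terminal_residual j u) (cst 0) ->
  ae_eq (n \x m)%E setT
    (fun p => \sum_j terminal_residual j p.1 * terminal_state j p.2) (cst 0) ->
  is_derive (0 : R) (1 : R) F 0.
Proof.
move=> q0 r0 rF0; have [C hC] := loss_first_variation.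
apply: (is_derive0_quadratic (C := C)) => s s1.
have [z zs] : exists z, forall j, perturbed s j (z j).
  exists (fun j => sval (cid (perturbed_exists j s1))) => j.
  exact: (svalP (cid (perturbed_exists j s1))).
have := hC s z s1 zs.
rewrite (_ : \sum_j _ = 0) ?mulr0 ?subr0// big_split/=.
rewrite big1 ?add0r -?mulr_sumr; last first.
  move=> j _; have [mz _] := zs j; have [mt' _] := sqint_total (sqintB mz (sv j)).
  have [mq _] := sqint_terminal_adjoint j.
  transitivity (\int[m]_y (0 : R)); last by rewrite /Rintegral integral0.
  apply: Rintegral_ae_eq; [exact: measurable_funM|exact: measurable_cst|].
  by apply: aeS (q0 j) => y /(_ I) -> _; rewrite mul0r.
have [_ _ Ldw Ldmu] := dxE.
have [mdw _] : sqint (n \x m)%E (dw \_ (U `*` Y)) by exact/L2UYE.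
have [mdmu _] : sqint n (dmu \_ U) by exact/L2E.
have mr j : measurable_fun setT (terminal_residual j) by case: (sqint_terminal_residual j).
have mF j : measurable_fun setT (terminal_state j) by case: (sF j).
rewrite sum_residual_variation (_ : \int[(n \x m)%E]_p _ = 0) ?add0r.
  rewrite (_ : \int[n]_u _ = 0) ?mulr0//.
  transitivity (\int[n]_y (0 : R)); last by rewrite /Rintegral integral0.
  apply: Rintegral_ae_eq; [|exact: measurable_cst|].
    by apply: measurable_funM => //; exact: measurable_sum.
  by apply: aeS r0 => y /(_ I) -> _; rewrite mulr0.
transitivity (\int[(n \x m)%E]_y (0 : R)); last by rewrite /Rintegral integral0.
apply: Rintegral_ae_eq; [|exact: measurable_cst|].
  apply: measurable_funM => //; apply: measurable_sum => j.
  by move: (terminal_residual j) (terminal_state j) (mr j) (mF j) => g1 g2 ? ?; mfun.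
by apply: aeS rF0 => y /(_ I) -> _; rewrite mulr0.
Qed.

(** The quotient of the loss tends to 0 and differs by O(4^-i) from the mean of pairings and
    residual variations, so their sum tends to 0; multiplication by N isolates the pairings. *)
Lemma variation_cvg (z : 'I_N -> nat -> _) : (0 < N)%N -> is_derive (0 : R) (1 : R) F 0 ->
  (forall j i, perturbed (4^-1 ^+ i) j (z j i)) ->
  (4^-1 ^+ i)^-1 * (\sum_j \int[m]_y (terminal_adjoint j y *
    total tm (fun p => z j i p - v j p) y)) @[i --> \oo] --> - \sum_j residual_variation j.
Proof.
move=> N0 dF zs; have [C hC] := loss_first_variation.
set G := fun i => _ * _; set V := \sum_j _.
have s1 i : `|4^-1 ^+ i| <= 1 :> R.
  by rewrite normrX exprn_ile1// ger0_norm ?invr_ge0// invf_le1// ler1n.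
have s0 i : 0 < 4^-1 ^+ i :> R by rewrite exprn_gt0// invr_gt0.
have Nn0 : N%:R != 0 :> R by rewrite pnatr_eq0 -lt0n.
have key (x y c u e : R) : e != 0 ->
  x - c * (y + e * u) = e * (e^-1 * x - c * (e^-1 * y + u)) by move=> e0; field.
pose H i := (4^-1 ^+ i)^-1 * (F (4^-1 ^+ i) - F 0).
have bound i : `|H i - N%:R^-1 * (G i + V)| <= C * 4^-1 ^+ i.
  have := hC _ _ (s1 i) (fun j => zs j i).
  rewrite /H /G big_split -mulr_sumr -/V; set S := \sum_j _; set e := _ ^+ i in s0 *.
  have e0 := s0 i.
  rewrite (key _ _ _ _ _ (lt0r_neq0 e0)).
  by rewrite normrM gtr0_norm ?s0// mulrC expr2 mulrA ler_pM2r// s0.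
have step0 : (4^-1 ^+ i : R) @[i --> \oo] --> (0 : R).
  by apply: cvg_expr; rewrite ger0_norm// invf_lt1// ltr1n.
have diff0 : H i - N%:R^-1 * (G i + V) @[i --> \oo] --> (0 : R).
  apply/cvgr0Pnorm_le => e e0.
  have Cs0 : C * 4^-1 ^+ i @[i --> \oo] --> C * 0 by apply: cvgM => //; exact: cvg_cst.
  rewrite mulr0 in Cs0; move/cvgr0Pnorm_le : Cs0 => /(_ e e0); apply: filterS => i ie.
  exact: (le_trans (bound i) (le_trans (ler_norm _) ie)).
have H0 : H i @[i --> \oo] --> (0 : R) by exact: is_derive0_seq.
have -> : G = fun i => N%:R * (H i - (H i - N%:R^-1 * (G i + V))) - V.
  by apply/funext => i; rewrite subKr mulrA mulfV// mul1r addrK.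
rewrite -[X in _ --> X]add0r; apply: cvgB; last exact: cvg_cst.
rewrite -[X in _ --> X](mulr0 N%:R); apply: cvgM; first exact: cvg_cst.
by rewrite -[X in _ --> X](subr0 0); exact: cvgB.
Qed.

End direction.

Lemma L2Yt_of_sqint da : sqint mt da -> L2Yt Y T da.
Proof.
move=> sda; apply/(L2YtE T mY Yoo); apply: (sqint_le _ sda) => [|p].
  apply/(measurable_restrictT _ _).1; first exact: measurableX.
  by apply: measurable_funTS; case: sda.
by rewrite /patch; case: ifP => //; rewrite normr0.
Qed.

Lemma L2YYt_of_energy db : measurable_fun setT db ->
  (\int[tm]_t energy m db t < +oo)%E -> L2YYt Y T db.
Proof.
move=> mdb idb; apply/(L2YYtE T mY Yoo).
have mr : measurable_fun setT (db \_ QYY).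
  apply/(measurable_restrictT _ _).1; last exact: measurable_funTS.
  by apply: measurableX => //; exact: measurableX.
split; first exact: mr.
apply: le_lt_trans idb; apply: ge0_le_integral; first exact: measurableT.
- by move=> t _; exact: sqi_ge0.
- exact: measurable_energy.
- exact: measurable_energy.
move=> t _; apply: le_sqi.
- by clear -mr; move: (_ \_ _) mr => g mg; mfun.
- by clear -mdb; mfun.
by move=> p; rewrite /patch; case: ifP => //; rewrite normr0.
Qed.

Lemma L2UY_of_sqint dw : sqint (n \x m)%E dw -> L2UY Y U dw.
Proof.
move=> sdw; apply/(L2UYE mY Yoo mU Uoo); apply: (sqint_le _ sdw) => [|p].
  apply/(measurable_restrictT _ _).1; first exact: measurableX.
  by apply: measurable_funTS; case: sdw.
by rewrite /patch; case: ifP => //; rewrite normr0.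
Qed.

Hypothesis N0 : (0 < N)%N.
Hypothesis sigma_derivable : forall x : R, derivable sigma x 1.
Hypothesis dsigma_continuous : continuous (derive1 sigma).
Hypothesis dsigma_gt0 : forall x : R, 0 < derive1 sigma x.
Hypothesis indep : weakly_independent leb Y fI.

(** [stationary_adjoint0] tests with directions that need not vanish outside the domain, whereas the
    loss sees their zero extensions. The two perturbed equations agree on the domain, so their
    solutions have the same terminal displacement almost everywhere. *)
Lemma perturbed_restrict da db s j z : sqint mt da -> measurable_fun setT db ->
  (\int[tm]_t energy m db t < +oo)%E -> `|s| <= 1 ->
  solves m tm before sigma (fun p => (a \_ QY) p + s * da p)
    (fun p => (b \_ QYY) p + s * db p) (fI j \_ Y) z ->
  exists z', perturbed da db s j z' /\ ae_eq m setT (total tm z') (total tm z).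
Proof.
move=> sda mdb idb s1 [sz zE]; have [La Lb _ _] := xE.
have /(L2YtE T mY Yoo) sa := La; have /(L2YYtE T mY Yoo)[mb ib] := Lb.
have /(L2YtE T mY Yoo) srda := L2Yt_of_sqint sda.
have /(L2YYtE T mY Yoo)[mrdb irdb] := L2YYt_of_energy mdb idb.
have sfI : sqint m (fI j \_ Y) by exact/L2E.
have sas := sqintD sa (sqintZ s srda).
have mbs : measurable_fun setT (fun p => (b \_ QYY) p + s * (db \_ QYY) p) by mfun.
have ibs := energyD_lty s1 mb mrdb ib irdb.
have [|z' [z's z'z]] := solution_modify k_lip msigma sas mbs ibs sfI sz; last first.
  exists z'; split=> //; apply: aeS z'z => y z'y _.
  have [[mz' _] _] := z's; have [mz _] := sz.
  rewrite /total; apply: Rintegral_ae_eq; [by mfun|by mfun|].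
  by apply: aeS (@ae_time _ T (fun t => 0 < t < T) (fun t tT => tT)) => r rT _; rewrite z'y.
apply/ae_restrict => //; apply: aeW => y Yy t tT; rewrite zE /field /=.
have tT' : t \in `]0, T[ by rewrite in_itv.
congr (sigma (_ - _)).
  by congr (_ + s * _); rewrite [RHS]/patch mem_set.
have [mtr _] := sqint_traj (@measurable_before R) t sfI sz.
apply: Rintegral_ae_eq.
- by apply: measurable_funM => //; clear -mb mdb; move: (b \_ _) mb => g mg; mfun.
- by apply: measurable_funM => //; clear -mb mrdb; move: (b \_ _) (db \_ _) mb mrdb => g1 g2 ? ?; mfun.
apply/ae_restrict => //; apply: aeW => x Yx _.
by congr ((_ + s * _) * _); rewrite [RHS]/patch mem_set.
Qed.

Let control0 : L2UY Y U (fun=> 0) /\ L2 leb U (fun=> 0).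
Proof.
by split; [apply: L2UY_of_sqint|apply: L2_of_sqint]; exact: sqint0.
Qed.

(** For necessity, directions in (a, b) alone make the adjoints vanish. In a direction (dw, dmu) the
    state does not really move and the pairings are 0, so the residual variation itself must
    vanish. *)
Theorem critical_point_iff :
  critical_point (control_space Y U T) (loss Y U T sigma h fI P) (a, b, w, mu) <->
  [/\ forall j, ae_eq m setT (terminal_adjoint j) (cst 0),
      ae_eq n setT (fun u => \sum_j terminal_residual j u) (cst 0) &
      ae_eq (n \x m)%E setT
        (fun p => \sum_j terminal_residual j p.1 * terminal_state j p.2) (cst 0)].
Proof.
split=> [[_ crit]|[q0 r0 rF0]]; last first.
  split=> // -[[[da db] dw] dmu] dxE.
  exact: (stationary_of_conditions dxE q0 r0 rF0).
have [L0 L0'] := control0.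
have s1 i : `|4^-1 ^+ i| <= 1 :> R.
  by rewrite normrX exprn_ile1// ger0_norm ?invr_ge0// invf_le1// ler1n.
have sr := sqint_terminal_residual; have sq := sqint_terminal_adjoint.
have restr0 (Z : Type) (D : set Z) (z : Z) : ((fun=> 0 : R) \_ D) z = 0.
  by rewrite /patch; case: ifP.
have q0 j : ae_eq m setT (terminal_adjoint j) (cst 0).
  have [La Lb _ _] := xE.
  have /(L2YtE T mY Yoo) sa := La; have /(L2YYtE T mY Yoo)[mb ib] := Lb.
  have sfI i : sqint m (fI i \_ Y) by exact/L2E.
  have rindep : weakly_independent m setT (fun i => fI i \_ Y).
    exact: weakly_independent_restrict.
  apply: (stationary_adjoint0 T0 k_lip sigma_derivable dsigma_continuous dsigma_gt0
    sa mb ib sfI sq vs rindep).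
  move=> da db z sda mdb idb zs.
  have dxE : control_space Y U T (da, db, fun=> 0, fun=> 0).
    by split=> //; [exact: L2Yt_of_sqint|exact: L2YYt_of_energy].
  have ex i e := perturbed_restrict sda mdb idb (s1 e) (zs i e).
  pose z' i e := sval (cid (ex i e)); have z'E i e := svalP (cid (ex i e)).
  have := variation_cvg dxE (z := z') N0 (crit _ dxE) (fun i e => (z'E i e).1).
  have -> : - \sum_i residual_variation (fun=> 0) (fun=> 0) i = 0.
    rewrite big1 ?oppr0// => i _; rewrite /residual_variation.
    transitivity (\int[n]_u (0 : R)); last by rewrite /Rintegral integral0.
    apply: eq_Rintegral => u _; rewrite /integral_operator.
    rewrite (_ : \int[m]_y _ = 0); last first.
      transitivity (\int[m]_y (0 : R)); last by rewrite /Rintegral integral0.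
      by apply: eq_Rintegral => y _; rewrite restr0 mul0r.
    by rewrite add0r restr0 mulr0.
  have cvg_eq (u u' : nat -> R) c : u =1 u' -> u @ \oo --> c -> u' @ \oo --> c.
    by move=> /funext ->.
  apply: cvg_eq => e; congr (_ * _).
  apply: eq_bigr => i _.
  have [sz _] := zs i e; have [[sz' _] zz'] := z'E i e.
  have [svi _] := vs i; have [mq _] := sq i.
  have [mt1 _] := sqint_total (sqintB sz' svi); have [mt2 _] := sqint_total (sqintB sz svi).
  apply: Rintegral_ae_eq; [exact: measurable_funM|exact: measurable_funM|].
  apply: aeI (totalB svi sz') _; last by apply: aeI zz' (totalB svi sz) => y; exact: conj.
  move=> y /(_ I) h1 [/(_ I) h2 /(_ I) h3] _.
  by rewrite h1 h3 h2.
have varE dw dmu : sqint (n \x m)%E dw -> sqint n dmu ->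
    \int[(n \x m)%E]_p ((dw \_ (U `*` Y)) p *
      \sum_j terminal_residual j p.1 * terminal_state j p.2) +
    \int[n]_u ((dmu \_ U) u * \sum_j terminal_residual j u) = 0.
  move=> sdw sdmu.
  have dxE : control_space Y U T (fun=> 0, fun=> 0, dw, dmu).
    split.
    - by apply: L2Yt_of_sqint; exact: sqint0.
    - apply: L2YYt_of_energy; first exact: measurable_cst.
      by under eq_integral do rewrite [energy _ _ _]sqi0; rewrite integral0.
    - exact: L2UY_of_sqint.
    - exact: L2_of_sqint.
  rewrite -(sum_residual_variation dxE); apply/oppr_inj; rewrite oppr0.
  have ex j i := perturbed_exists dxE j (s1 i).
  pose z j i := sval (cid (ex j i)); have zE j i := svalP (cid (ex j i)).
  have := variation_cvg dxE (z := z) N0 (crit _ dxE) zE.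
  set G := fun i => _ * _.
  have -> : G = fun=> 0.
    apply/funext => i; rewrite /G big1 ?mulr0// => j _.
    transitivity (\int[m]_y (0 : R)); last by rewrite /Rintegral integral0.
    have [sz _] := zE j i; have [svj _] := vs j; have [mq _] := sq j.
    have [mt1 _] := sqint_total (sqintB sz svj).
    apply: Rintegral_ae_eq; [exact: measurable_funM|exact: measurable_cst|].
    by apply: aeS (q0 j) => y /(_ I) -> _; rewrite mul0r.
  have h2 : 0 @[_ --> \oo] --> (0 : R) by exact: cvg_cst.
  by move=> h1; exact: (cvg_unique _ h1 h2).
have sS : sqint n (fun u => \sum_j terminal_residual j u) by exact: sqint_sum.
have sSF : sqint (n \x m)%E (fun p => \sum_j terminal_residual j p.1 * terminal_state j p.2).
  by apply: sqint_sum => j; exact: (sqint_tensor (sr j) (sF j)).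
split=> //.
(* The summed residual is tested against itself as the direction dmu; the next case does the same
   with dw. *)
- apply: (Rintegral_sqr_eq0 sS); rewrite -[RHS](varE (fun=> 0) _ (sqint0 _) sS).
  rewrite (_ : \int[(n \x m)%E]_p _ = 0) ?add0r; last first.
    transitivity (\int[(n \x m)%E]_y (0 : R)); last by rewrite /Rintegral integral0.
    by apply: eq_Rintegral => p _; rewrite restr0 mul0r.
  apply: Rintegral_ae_eq.
  + by apply: measurable_funM; case: sS.
  + apply: measurable_funM; last by case: sS.
    by apply/(measurable_restrictT _ _).1 => //; apply: measurable_funTS; case: sS.
  + by apply/ae_restrict => //; apply: aeW => u Uu _; rewrite /patch mem_set.
- apply: (Rintegral_sqr_eq0 sSF); rewrite -[RHS](varE _ (fun=> 0) sSF (sqint0 _)).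
  rewrite (_ : \int[n]_u _ = 0) ?addr0; last first.
    transitivity (\int[n]_y (0 : R)); last by rewrite /Rintegral integral0.
    by apply: eq_Rintegral => p _; rewrite restr0 mul0r.
  apply: Rintegral_ae_eq.
  + by apply: measurable_funM; case: sSF.
  + apply: measurable_funM; last by case: sSF.
    apply/(measurable_restrictT _ _).1; first exact: measurableX.
    by apply: measurable_funTS; case: sSF.
  + have : {ae (n \x m)%E, forall p, (U `*` Y) p}.
      apply: ae_prod_setX => //.
        by transitivity (tuple_lebesgue l (~` U `&` U)); rewrite // setICl measure0.
      by transitivity (tuple_lebesgue d (~` Y `&` Y)); rewrite // setICl measure0.
    by apply: aeS => p UYp _; rewrite /patch mem_set.
Qed.

End loss_of_solution.

(** * Least squares *)

Section normal_equations.
Context {R : realType} {N K : nat}.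
Hypothesis N0 : (0 < N)%N.
Let e := unit_diag R N.
Let s : R := Num.sqrt N%:R.
Let s0 : s != 0. Proof. by rewrite gt_eqF// sqrtr_gt0 ltr0n. Qed.

Lemma unit_diag_norm : e^T *m e = 1%:M.
Proof.
apply/matrixP => i j; rewrite !mxE !ord1 eqxx; under eq_bigr do rewrite !mxE.
rewrite sumr_const card_ord -expr2 exprVn sqr_sqrtr ?ler0n//.
by rewrite -[LHS]mulr_natr mulVf// pnatr_eq0 -lt0n.
Qed.

Lemma unit_diag_dot (r : 'cV[R]_N) : (e^T *m r) ord0 ord0 = s^-1 * \sum_j r j ord0.
Proof. by rewrite mxE mulr_sumr; apply: eq_bigr => j _; rewrite !mxE. Qed.

Let Q : 'M[R]_N := 1%:M - e *m e^T.

Let trQ : Q^T = Q.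
Proof. by rewrite /Q linearB/= trmx1 trmx_mul trmxK. Qed.

Let QQ : Q *m Q = Q.
Proof.
rewrite /Q mulmxBr mulmx1 mulmxBl mul1mx -(mulmxA e) (mulmxA e^T e) unit_diag_norm mul1mx.
by rewrite subrr subr0.
Qed.

(** The constant vector is mu sqrt(N) times the unit vector e, so a zero sum of r determines mu and
    leaves r = Q (Omega x - P), with Q the projection orthogonal to e. As Q is symmetric and
    idempotent, Omega^T r = 0 becomes the normal equation for A = Q Omega. *)
Lemma normal_equations (Omega : 'M[R]_(N, K)) (x : 'cV[R]_K) (mu : R) (P : 'cV[R]_N) :
  let r := Omega *m x + const_mx mu - P in
  let A := (1%:M - e *m e^T) *m Omega in
  (\sum_j r j ord0 = 0 /\ Omega^T *m r = 0) <->
  (A^T *m A *m x = A^T *m P /\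
   mu = s^-1 * ((P^T *m e) ord0 ord0 - (e^T *m Omega *m x) ord0 ord0)).
Proof.
move=> r A; pose q := Omega *m x - P.
have rE : r = q + (mu * s) *: e.
  rewrite /r /q addrAC; congr (_ + _); apply/matrixP => i j; rewrite !mxE.
  by rewrite mulfK.
have er : s^-1 * (\sum_j r j ord0) = (e^T *m q) ord0 ord0 + mu * s.
  rewrite -unit_diag_dot rE mulmxDr -scalemxAr unit_diag_norm mxE; congr (_ + _).
  by rewrite !mxE eqxx mulr1.
have eq_e : (P^T *m e) ord0 ord0 - (e^T *m Omega *m x) ord0 ord0 = - (e^T *m q) ord0 ord0.
  have -> : (P^T *m e) ord0 ord0 = (e^T *m P) ord0 ord0.
    by rewrite -[P^T *m e]trmxK trmx_mul trmxK mxE.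
  by rewrite /q mulmxBr mulmxA [in RHS]mxE [X in _ = - (_ + X)]mxE opprB.
have muE : \sum_j r j ord0 = 0 <->
    mu = s^-1 * ((P^T *m e) ord0 ord0 - (e^T *m Omega *m x) ord0 ord0).
  rewrite eq_e; split=> [r0|muH].
    by move: er; rewrite r0 mulr0 => /esym/addr0_eq ->; rewrite mulrC mulfK.
  by apply/(mulfI (invr_neq0 s0)); rewrite er mulr0 muH mulrAC mulVf// mul1r subrr.
have rQ : \sum_j r j ord0 = 0 -> r = Q *m q.
  move=> r0; rewrite rE /Q mulmxBl mul1mx -mulmxA; congr (_ + _).
  apply/matrixP => i j; rewrite !mxE big_ord1 !mxE ord1.
  rewrite -mulrN mulrC; congr (_ * _).
  by move: er; rewrite r0 mulr0 (ord1 j) => /esym/addr0_eq <-; rewrite [in LHS]mxE.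
have AtQ : A^T = Omega^T *m Q by rewrite /A trmx_mul -/Q trQ.
have AA : A^T *m A *m x - A^T *m P = Omega^T *m (Q *m q).
  by rewrite AtQ /A -/Q !mulmxA -(mulmxA _ Q Q) QQ -!mulmxA -!mulmxBr.
split=> [[r0 Or]|[An muH]].
  split; last exact/muE.
  by apply/eqP; rewrite -subr_eq0 AA -rQ// Or.
have r0 : \sum_j r j ord0 = 0 by exact/muE.
by split=> //; rewrite rQ// -AA An subrr.
Qed.

End normal_equations.

Section product_ae.
Context {dX dY} {X : measurableType dX} {Z : measurableType dY} {R : realType}.
Variables (m : {finite_measure set X -> \bar R}) (n : {finite_measure set Z -> \bar R}).

Lemma ae_prod_fst (P : X -> Prop) : {ae m, forall x, P x} -> {ae (m \x n)%E, forall p, P p.1}.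
Proof.
move=> [A [mA A0 PA]]; exists (A `*` setT); split.
- exact: measurableX.
- by rewrite product_measure1E// [X in (X * _)%E](_ : _ = 0%E)// mul0e.
- by move=> p nP; split=> //; exact: PA.
Qed.

Lemma ae_prod_snd (P : Z -> Prop) : {ae n, forall z, P z} -> {ae (m \x n)%E, forall p, P p.2}.
Proof.
move=> [A [mA A0 PA]]; exists (setT `*` A); split.
- exact: measurableX.
- by rewrite product_measure1E// [X in (_ * X)%E](_ : _ = 0%E)// mule0.
- by move=> p nP; split=> //; exact: PA.
Qed.

End product_ae.

Section orthonormal_expansion.
Context {dX dV} {X : measurableType dX} {V : measurableType dV} {R : realType} {N K : nat}.
Variables (m : {finite_measure set X -> \bar R}) (n : {finite_measure set V -> \bar R}).
Variables (phi : 'I_K -> X -> R) (F : 'I_N -> X -> R) (c : 'I_N -> 'I_K -> R).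
Hypothesis sphi : forall k, sqint m (phi k).
Hypothesis sF : forall j, sqint m (F j).
Hypothesis ortho : forall i k, \int[m]_y (phi i y * phi k y) = (i == k)%:R.
Hypothesis FE : forall j, ae_eq m setT (F j) (fun y => \sum_k c j k * phi k y).

Lemma Rintegral_expansion (f : X -> R) j : sqint m f ->
  \int[m]_y (f y * F j y) = \sum_k c j k * \int[m]_y (f y * phi k y).
Proof.
move=> sf; rewrite -(Rintegral_sumM sphi (c j) sf).
have [mf _] := sf; have [mFj _] := sF j.
have [ms _] : sqint m (fun y => \sum_k c j k * phi k y).
  by apply: sqint_sum => k; exact: sqintZ.
apply: Rintegral_ae_eq; [exact: measurable_funM|exact: measurable_funM|].
by apply: aeS (FE j) => y h _; rewrite h.
Qed.

Lemma expansion_coefficient j k : \int[m]_y (F j y * phi k y) = c j k.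
Proof.
under eq_Rintegral do rewrite mulrC.
rewrite Rintegral_expansion// (bigD1 k)//= ortho eqxx mulr1 big1 ?addr0// => i ik.
by rewrite ortho eq_sym (negbTE ik) mulr0.
Qed.

Variable w : V * X -> R.
Hypothesis sw : sqint (n \x m)%E w.

Lemma operator_expansion : {ae n, forall u, forall j,
  integral_operator m w (F j) u = \sum_k c j k * integral_operator m w (phi k) u}.
Proof.
by apply: aeS (sqint_slice1 sw) => u su j; exact: Rintegral_expansion.
Qed.

(** The sum is a finite-rank kernel: applying it to phi_k extracts the k-th moment, because c_jk is
    the scalar product of F_j and phi_k, and conversely expanding every F_j in the basis writes the
    kernel through these moments. *)
Lemma moments_iff (r : 'I_N -> V -> R) : (forall j, sqint n (r j)) ->
  ae_eq (n \x m)%E setT (fun p => \sum_j r j p.1 * F j p.2) (cst 0) <->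
  {ae n, forall u, forall k, \sum_j c j k * r j u = 0}.
Proof.
move=> sr; pose S (p : V * X) := \sum_j r j p.1 * F j p.2.
have sS : sqint (n \x m)%E S by apply: sqint_sum => j; exact: sqint_tensor.
split=> [S0|r0].
  have /(sqi_eq0 _ sS.1) S00 := S0.
  apply: filter_forall => k.
  have so := sqint_operator sS (sphi k).
  have : sqi n (integral_operator m S (phi k)) = 0%E.
    apply/eqP; rewrite eq_le sqi_ge0 andbT.
    by apply: (le_trans (sqi_kernel n m sS.1 (sphi k).1)); rewrite S00 mul0e.
  move=> /(sqi_eq0 _ so.1); apply: aeS => u /(_ I) h.
  transitivity (integral_operator m S (phi k) u); last exact: h.
  rewrite /integral_operator /S; under [in RHS]eq_Rintegral do rewrite mulrC.
  rewrite (Rintegral_sumM sF (fun j => r j u) (sphi k)); apply: eq_bigr => j _.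
  by rewrite mulrC -expansion_coefficient; congr (_ * _); apply: eq_Rintegral => y _; rewrite mulrC.
have FE' : {ae (n \x m)%E, forall p, forall j, F j p.2 = \sum_k c j k * phi k p.2}.
  apply: (@ae_prod_snd _ _ _ _ _ n m (fun y => forall j, F j y = \sum_k c j k * phi k y)).
  by apply: filter_forall => j; apply: aeS (FE j) => y /(_ I).
apply: aeI FE' (ae_prod_fst m r0) => -[u y] /= Fy ru _.
under eq_bigr => j _ do rewrite Fy mulr_sumr.
rewrite exchange_big/= big1// => k _.
by under eq_bigr => j _ do rewrite mulrCA mulrA; rewrite -mulr_suml ru mul0r.
Qed.

End orthonormal_expansion.

(** * The Hilbert-space adjoint of the kernel operator *)

Section adjoint_operator.
Context {R : realType} {d l : nat}.
Variables (Y : set (Rn R d)) (U : set (Rn R l)).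
Hypotheses (mY : measurable Y) (Yoo : (tuple_lebesgue d Y < +oo)%E).
Hypotheses (mU : measurable U) (Uoo : (tuple_lebesgue l U < +oo)%E).
Notation leb := (tuple_lebesgue _).
Notation m := (mfrestr mY Yoo).
Notation n := (mfrestr mU Uoo).
Variable w : Rn R l * Rn R d -> R.
Hypothesis Lw : L2UY Y U w.
Let rw := w \_ (U `*` Y).
Let sw : sqint (n \x m)%E rw. Proof. exact/L2UYE. Qed.

Definition adjoint_operator (psi : Rn R l -> R) y : R := \int[n]_u (rw (u, y) * psi u).

Lemma sqint_adjoint_operator psi : sqint n psi -> sqint m (adjoint_operator psi).
Proof. exact: sqint_adjoint. Qed.

Lemma kernel_operator_L2 f : L2 leb Y f ->
  (kernel_operator leb Y w f) \_ U = (integral_operator m rw (f \_ Y)) \_ U.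
Proof.
move=> Lf; have /(L2E mY Yoo) sf := Lf.
apply/funext => u; rewrite [LHS]/patch [RHS]/patch; case: ifPn => // /set_mem Uu.
by apply: (kernel_operator_restrict Uu sw.1 sf.1 sf.1); exact: aeW.
Qed.

Lemma L2_kernel_operator f : L2 leb Y f -> L2 leb U (kernel_operator leb Y w f).
Proof.
move=> Lf; apply/(L2E mU Uoo); rewrite kernel_operator_L2//.
apply: sqint_restrict.
by apply: sqint_operator => //; exact/L2E.
Qed.

Lemma kernel_operator_dual f psi : L2 leb Y f -> L2 leb U psi ->
  L2dot leb U (kernel_operator leb Y w f) psi =
  \int[m]_y ((f \_ Y) y * adjoint_operator (psi \_ U) y).
Proof.
move=> Lf Lpsi; rewrite (L2dotE mU Uoo)//; last exact: L2_kernel_operator.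
have /(L2E mY Yoo) sf := Lf; have /(L2E mU Uoo) sp := Lpsi.
have so := sqint_operator sw sf; have sor := sqint_restrict so.
rewrite -(kernel_adjoint sw sp sf) kernel_operator_L2//.
have [mp _] := sp; have [mo _] := so; have [mor _] := sor.
apply: Rintegral_ae_eq; [exact: measurable_funM|exact: measurable_funM|].
by apply: aeS (restrict_ae_eq mU Uoo (integral_operator m rw (f \_ Y))) => u /(_ I) -> _; rewrite mulrC.
Qed.

(** [L2adjoint] is a choice: the transposed kernel shows that a candidate exists, and testing the
    difference of the chosen and the explicit adjoint against itself shows that they agree almost
    everywhere. *)
Lemma L2adjointE psi : L2 leb U psi ->
  ae_eq m setT (L2adjoint leb Y leb U (kernel_operator leb Y w) psi \_ Y)
    (adjoint_operator (psi \_ U)).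
Proof.
move=> Lpsi; have /(L2E mU Uoo) sp := Lpsi.
have sa := sqint_adjoint_operator sp; set A := adjoint_operator _ in sa *.
have restY f := @sqint_restrict _ _ _ _ Y mY Yoo f.
have restYae := restrict_ae_eq mY Yoo.
have LA : L2 leb Y A by apply/(L2E mY Yoo); exact: restY.
have ex : exists g, L2 leb Y g /\ forall phi, L2 leb Y phi ->
    L2dot leb U (kernel_operator leb Y w phi) psi = L2dot leb Y phi g.
  exists A; split=> // f Lf; rewrite kernel_operator_dual// (L2dotE mY Yoo)//.
  have /(L2E mY Yoo)[mf _] := Lf; have [mA _] := sa; have [mrA _] := restY _ sa.
  apply: Rintegral_ae_eq; [exact: measurable_funM|exact: measurable_funM|].
  by apply: aeS (restYae A) => y /(_ I) -> _.
have := xgetPex (cst 0) ex; rewrite -/(L2adjoint leb Y leb U (kernel_operator leb Y w) psi).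
set g := L2adjoint _ _ _ _ _ _ => -[Lg gE].
have /(L2E mY Yoo) sg := Lg.
have sD := sqintB sg sa; set D := fun y => (g \_ Y) y - A y in sD.
have LD : L2 leb Y D by apply/(L2E mY Yoo); exact: restY.
have DD : \int[m]_y (D y * D y) = 0.
  have := gE D LD; rewrite kernel_operator_dual// (L2dotE mY Yoo)// => /esym/eqP.
  rewrite -subr_eq0 -RintegralB//; last 2 first.
  - exact: (sqintM_integrable (restY _ sD) sg).
  - exact: (sqintM_integrable (restY _ sD) sa).
  move=> /eqP <-; have [mD _] := sD; have [mrD _] := restY _ sD.
  have [mg _] := sg; have [mA _] := sa.
  apply: Rintegral_ae_eq; [exact: measurable_funM| |].
    by apply: measurable_funB; exact: measurable_funM.
  by apply: aeS (restYae D) => y /(_ I) -> _; rewrite -mulrBr.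
by apply: aeS (Rintegral_sqr_eq0 sD DD) => y /(_ I) /eqP; rewrite subr_eq0 => /eqP.
Qed.

End adjoint_operator.

Lemma ae_and dX (X : measurableType dX) (R : realType)
    (m : {measure set X -> \bar R}) (P Q : X -> Prop) :
  {ae m, forall x, P x} -> {ae m, forall x, Q x} -> {ae m, forall x, P x /\ Q x}.
Proof. by apply: aeI => x; exact: conj. Qed.

Section least_squares_decomposition.
Context {R : realType} {d l K : nat}.
Variables (Y : set (Rn R d)) (U : set (Rn R l)).
Hypotheses (mY : measurable Y) (Yoo : (tuple_lebesgue d Y < +oo)%E).
Hypotheses (mU : measurable U) (Uoo : (tuple_lebesgue l U < +oo)%E).
Notation leb := (tuple_lebesgue _).
Notation m := (mfrestr mY Yoo).
Notation n := (mfrestr mU Uoo).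
Variable w : Rn R l * Rn R d -> R.
Hypothesis Lw : L2UY Y U w.
Let rw := w \_ (U `*` Y).
Let sw : sqint (n \x m)%E rw. Proof. exact/L2UYE. Qed.

(** By linearity of the explicit adjoint, the difference of the two sides is the adjoint applied to
    the residual. *)
Lemma adjoint_equation_iff f F mu P : L2 leb Y f -> sqint m F ->
  ae_eq m setT (f \_ Y) F -> L2 leb U mu -> L2 leb U P ->
  let Wadj := L2adjoint leb Y leb U (kernel_operator leb Y w) in
  ae_eq leb Y (Wadj (kernel_operator leb Y w f)) (Wadj (fun u => P u - mu u)) <->
  ae_eq m setT (adjoint_residual m n rw (mu \_ U) (P \_ U) F) (cst 0).
Proof.
move=> Lf sF fF Lmu LP Wadj.
have /(L2E mY Yoo) sf := Lf; have /(L2E mU Uoo) smu := Lmu; have /(L2E mU Uoo) sP := LP.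
have PE : (fun u => P u - mu u) \_ U = fun u => (P \_ U) u - (mu \_ U) u.
  by apply/funext => u; rewrite /patch; case: ifP => //; rewrite subr0.
have LPmu : L2 leb U (fun u => P u - mu u).
  by apply/(L2E mU Uoo); rewrite PE; exact: sqintB.
have so := sqint_operator sw sF; have [mo _] := so.
have sd := sqintB sP smu.
have h1 := L2adjointE mY Yoo mU Uoo Lw (L2_kernel_operator mY Yoo mU Uoo Lw Lf).
have h2 := L2adjointE mY Yoo mU Uoo Lw LPmu.
have A1 y : adjoint_operator Y mU Uoo w (kernel_operator leb Y w f \_ U) y =
    \int[n]_u (rw (u, y) * integral_operator m rw F u).
  have [mw _] := sw; have [mF _] := sF; have [mf _] := sf.
  have mwy : measurable_fun setT (fun u => rw (u, y)) by mfun.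
  rewrite /adjoint_operator (kernel_operator_L2 mY Yoo mU Uoo)//.
  have [mof _] := sqint_operator sw sf; have [mor _] := sqint_restrict (sqint_operator sw sf).
  apply: Rintegral_ae_eq; [exact: measurable_funM|exact: measurable_funM|].
  apply: aeS (restrict_ae_eq mU Uoo (integral_operator m rw (f \_ Y))) => u /(_ I) -> _.
  congr (_ * _); apply: Rintegral_ae_eq.
  - by apply: measurable_funM => //; mfun.
  - by apply: measurable_funM => //; mfun.
  by apply: aeS fF => z /(_ I) -> _.
have qE : {ae m, forall y, adjoint_residual m n rw (mu \_ U) (P \_ U) F y =
    adjoint_operator Y mU Uoo w (kernel_operator leb Y w f \_ U) y -
    adjoint_operator Y mU Uoo w ((fun u => P u - mu u) \_ U) y}.
  apply: aeS (sqint_slice2 sw) => y sy; rewrite A1 /adjoint_operator -RintegralB//; last 2 first.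
  - exact: (sqintM_integrable sy so).
  - by rewrite PE; exact: (sqintM_integrable sy sd).
  apply: eq_Rintegral => u _; rewrite PE -mulrBr /residual opprB addrA.
  by rewrite [RHS]mulrC [LHS]mulrC -addrA addrCA addrA addrAC.
split=> [/(ae_eq_restrict mY Yoo) h|h].
  apply: aeI qE (ae_and h (ae_and h1 h2)).
  by move=> y -> [/(_ I) e [/(_ I) <- /(_ I) <-]] _; rewrite e subrr.
apply/(ae_eq_restrict mY Yoo); apply: aeI h (ae_and qE (ae_and h1 h2)).
move=> y /(_ I) q0 [e [/(_ I) -> /(_ I) ->]] _; apply/eqP.
by rewrite -subr_eq0 -e q0.
Qed.

Variable phi : 'I_K -> Rn R d -> R.
Hypothesis Lphi : forall k, L2 leb Y (phi k).
Hypothesis ortho : forall i k, L2dot leb Y (phi i) (phi k) = (i == k)%:R.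

Let sphi k : sqint m (phi k \_ Y). Proof. exact/L2E. Qed.

Let rortho i k : \int[m]_y ((phi i \_ Y) y * (phi k \_ Y) y) = (i == k)%:R.
Proof. by rewrite -ortho (L2dotE mY Yoo). Qed.

Let restrict_tensor (f : Rn R l -> R) (g : Rn R d -> R) p :
  ((fun p => f p.1 * g p.2) \_ (U `*` Y)) p = (f \_ U) p.1 * (g \_ Y) p.2.
Proof.
rewrite /patch; case: ifPn => [/set_mem[Up Yp]|nUY]; first by rewrite !mem_set.
case: ifPn => [/set_mem Up|]; last by rewrite mul0r.
case: ifPn => [/set_mem Yp|]; last by rewrite mulr0.
by move: nUY; rewrite mem_set.
Qed.

Let restrict_remainder (g : Rn R l * Rn R d -> R) (wk : 'I_K -> Rn R l -> R) p :
  ((fun p => g p - \sum_(k < K) wk k p.1 * phi k p.2) \_ (U `*` Y)) p =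
  (g \_ (U `*` Y)) p - \sum_k (wk k \_ U) p.1 * (phi k \_ Y) p.2.
Proof.
under eq_bigr => k _ do rewrite -restrict_tensor.
rewrite /patch; case: ifPn => // _; rewrite big1 ?subr0//.
Qed.

Let slice_restrict (g : Rn R l * Rn R d -> R) u : U u ->
  (fun y => g (u, y)) \_ Y = fun y => (g \_ (U `*` Y)) (u, y).
Proof.
move=> Uu; apply/funext => y; rewrite /patch; case: ifPn => [/set_mem Yy|nY].
  by rewrite mem_set.
by rewrite memNset// => -[_ /mem_set]; exact/negP.
Qed.

Let Rintegral_remainder (g : Rn R d -> R) (c : 'I_K -> R) i : sqint m g ->
  \int[m]_y ((g y - \sum_k c k * (phi k \_ Y) y) * (phi i \_ Y) y) =
  \int[m]_y (g y * (phi i \_ Y) y) - c i.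
Proof.
move=> sg; have ss : sqint m (fun y => \sum_k c k * (phi k \_ Y) y).
  by apply: sqint_sum => k; exact: sqintZ.
under eq_Rintegral do rewrite mulrBl.
rewrite RintegralB//; last 2 first.
- exact: (sqintM_integrable sg (sphi i)).
- exact: (sqintM_integrable ss (sphi i)).
congr (_ - _); under eq_Rintegral do rewrite mulrC.
rewrite (Rintegral_sumM sphi c (sphi i)) (bigD1 i)//= rortho eqxx mulr1 big1 ?addr0// => k ki.
by rewrite rortho eq_sym (negbTE ki) mulr0.
Qed.

(** The coefficients are forced: pairing any such decomposition with phi_k gives w_k(u) as the
    scalar product of w(u, .) with phi_k, for almost every u. A condition on some decomposition is
    thus a condition on these canonical coefficients. *)
Lemma orthogonal_decomposition_iff (G : Rn R l -> ('I_K -> R) -> Prop) :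
  {ae n, forall u, G u (fun k => integral_operator m rw (phi k \_ Y) u)} <->
  exists (wk : 'I_K -> Rn R l -> R) (hw : Rn R l * Rn R d -> R),
    [/\ L2UY Y U hw,
        {ae (leb \x leb)%E, forall p, (U `*` Y) p ->
           w p = \sum_(k < K) wk k p.1 * phi k p.2 + hw p},
        {ae leb, forall u, U u -> L2orth leb Y (L2span leb Y phi) (fun y => hw (u, y))},
        forall k, L2 leb U (wk k) &
        {ae leb, forall u, U u -> G u (fun k => wk k u)}].
Proof.
split=> [hG|[wk [hw [Lhw wE orth Lwk hG]]]].
  pose wk k := integral_operator m rw (phi k \_ Y).
  have swk k : sqint n (wk k) by exact: sqint_operator.
  have rwk k : sqint n (wk k \_ U) by exact: sqint_restrict.
  pose hw p := w p - \sum_(k < K) wk k p.1 * phi k p.2.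
  exists wk, hw; split.
  - apply/(L2UYE mY Yoo mU Uoo).
    rewrite (_ : hw \_ _ = fun p => rw p - \sum_k (wk k \_ U) p.1 * (phi k \_ Y) p.2).
      by apply: (sqintB sw); apply: sqint_sum => k; exact: sqint_tensor.
    by apply/funext => p; exact: restrict_remainder.
  - by apply: aeW => p _; rewrite /hw addrC subrK.
  - apply/(ae_restrict mU Uoo); apply: aeI (sqint_slice1 sw) _; last first.
      by apply/(ae_restrict mU Uoo); apply: aeW => u Uu; exact: Uu.
    move=> u su Uu.
    have hE : (fun y => hw (u, y)) \_ Y = fun y => rw (u, y) - \sum_k wk k u * (phi k \_ Y) y.
      rewrite slice_restrict//; apply/funext => y; rewrite restrict_remainder/=.
      by congr (_ - _); apply: eq_bigr => k _; rewrite [(wk k \_ U) u]/patch mem_set.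
    have sh : sqint m (fun y => rw (u, y) - \sum_k wk k u * (phi k \_ Y) y).
      by apply: (sqintB su); apply: sqint_sum => k; exact: sqintZ.
    have Lh : L2 leb Y (fun y => hw (u, y)) by apply/(L2E mY Yoo); rewrite hE.
    split=> // p [Lp [c pE]]; rewrite (L2dotE mY Yoo)// hE.
    have /(L2E mY Yoo)[mp _] := Lp; have [mh _] := sh.
    have [ms _] : sqint m (fun y => \sum_k c k * (phi k \_ Y) y).
      by apply: sqint_sum => k; exact: sqintZ.
    transitivity (\int[m]_y ((rw (u, y) - \sum_k wk k u * (phi k \_ Y) y) *
        \sum_k c k * (phi k \_ Y) y)).
      apply: Rintegral_ae_eq; [exact: measurable_funM|exact: measurable_funM|].
      move/(ae_eq_restrict mY Yoo) : pE; rewrite restrict_sum.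
      by apply: aeS => y /(_ I) -> _.
    rewrite (Rintegral_sumM sphi c sh) big1// => k _.
    by rewrite Rintegral_remainder// subrr mulr0.
  - by move=> k; exact: L2_of_sqint.
  - by move/(ae_restrict mU Uoo) : hG.
have /(L2UYE mY Yoo mU Uoo) sh := Lhw.
have rwk k : sqint n (wk k \_ U) by exact/L2E.
(* The defect of the decomposition is null on the product space; as a kernel applied to phi_i it
   gives the scalar identity for almost every u. *)
pose E p := (rw p - \sum_k (wk k \_ U) p.1 * (phi k \_ Y) p.2) - (hw \_ (U `*` Y)) p.
have sE : sqint (n \x m)%E E.
  by apply: (sqintB _ sh); apply: (sqintB sw); apply: sqint_sum => k; exact: sqint_tensor.
have EUY : E \_ (U `*` Y) = E.
  apply: restrict_eq => p nUY; rewrite /E -restrict_remainder /patch memNset//.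
  by rewrite subrr.
have sE0 : sqi (n \x m)%E E = 0%E.
  have mEr : measurable_fun setT (E \_ (U `*` Y)) by rewrite EUY; exact: sE.1.
  rewrite -EUY (sqi_prod_restrict _ _ _ _ mEr) EUY.
  apply/(sqi_eq0 (tuple_lebesgue l \x tuple_lebesgue d)%E sE.1).
  apply: aeS wE => p pE _; rewrite /E -restrict_remainder.
  have [UYp|nUYp] := pselect ((U `*` Y) p); last by rewrite /patch memNset// subrr.
  by rewrite /patch mem_set// pE// addrAC addrK subrr.
have opE0 : {ae n, forall u, forall i, integral_operator m E (phi i \_ Y) u = 0}.
  apply: filter_forall => i; have so := sqint_operator sE (sphi i).
  have : sqi n (integral_operator m E (phi i \_ Y)) = 0%E.
    apply/eqP; rewrite eq_le sqi_ge0 andbT.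
    by apply: (le_trans (sqi_kernel n m sE.1 (sphi i).1)); rewrite sE0 mul0e.
  by move=> /(sqi_eq0 _ so.1); apply: aeS => u /(_ I).
move/(ae_restrict mU Uoo) : orth => orth; move/(ae_restrict mU Uoo) : hG => hG.
have inU : {ae n, forall u, U u}.
  by apply/(ae_restrict mU Uoo); apply: aeW => u Uu; exact: Uu.
apply: aeI hG (ae_and inU (ae_and orth (ae_and opE0
  (ae_and (sqint_slice1 sw) (sqint_slice1 sh))))).
move=> u Gu [Uu [[Lhu ortu] [E0 [su shu]]]].
rewrite (_ : (fun k => _) = (fun k => wk k u))//; apply/funext => i.
have := E0 i; rewrite /integral_operator /E.
have sd : sqint m (fun y => rw (u, y) - \sum_k (wk k \_ U) u * (phi k \_ Y) y).
  by apply: (sqintB su); apply: sqint_sum => k; exact: sqintZ.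
under eq_Rintegral => y _ do rewrite mulrBl.
rewrite RintegralB//; last 2 first.
- exact: (sqintM_integrable sd (sphi i)).
- exact: (sqintM_integrable shu (sphi i)).
rewrite (Rintegral_remainder (fun k => (wk k \_ U) u) i su).
have -> : \int[m]_y ((hw \_ (U `*` Y)) (u, y) * (phi i \_ Y) y) = 0.
  rewrite -[RHS](ortu (phi i)); last first.
    split; first exact: Lphi.
    (* phi_i belongs to its own span, so the remainder is orthogonal to it. *)
    exists (fun k => (k == i)%:R); apply: aeW => y _.
    by rewrite (bigD1 i)//= eqxx mul1r big1 ?addr0// => k /negbTE ->; rewrite mul0r.
  by rewrite (L2dotE mY Yoo)// slice_restrict.
by rewrite subr0 [(wk i \_ U) u]/patch mem_set// => /eqP; rewrite subr_eq0 => /eqP.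
Qed.

End least_squares_decomposition.

Lemma L2span_self dX (X : measurableType dX) (R : realType)
    (mu : {measure set X -> \bar R}) (D : set X) N (f : 'I_N -> X -> R) :
  (forall j, L2 mu D (f j)) -> forall j, L2span mu D f (f j).
Proof.
move=> Lf j; split=> //; exists (fun i => (i == j)%:R); apply: aeW => x _.
by rewrite (bigD1 j)//= eqxx mul1r big1 ?addr0// => i /negbTE ->; rewrite mul0r.
Qed.

Unset Implicit Arguments.
Set Strict Implicit.

Theorem theorem3 (R : realType) (d l N : nat)
    (Y : set (Rn R d)) (U : set (Rn R l)) (T : R) (sigma h : R -> R)
    (fI : 'I_N -> Rn R d -> R) (P : 'I_N -> Rn R l -> R)
    (a : Rn R d * measurableTypeR R -> R)
    (b : Rn R d * Rn R d * measurableTypeR R -> R)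
    (w : Rn R l * Rn R d -> R) (mu : Rn R l -> R)
    (K : nat) (phi : 'I_K -> Rn R d -> R) :
  open (row_set Y) -> bounded_set (row_set Y) ->
  open (row_set U) -> bounded_set (row_set U) ->
  0 < T -> (0 < N)%N ->
  (forall x, derivable sigma x 1) -> continuous (derive1 sigma) ->
  (exists k : R, k.-lipschitz sigma) ->
  (forall j, L2 (tuple_lebesgue d) Y (fI j)) ->
  (forall j, L2 (tuple_lebesgue l) U (P j)) ->
  (forall i j, i != j -> ~ ae_eq (tuple_lebesgue d) Y (fI i) (fI j)) ->
  (forall x, 0 < derive1 sigma x) ->
  weakly_independent (tuple_lebesgue d) Y fI ->
  (forall x, h x = x) ->
  control_space Y U T (a, b, w, mu) ->
  let f j := forward Y T sigma a b (fI j) T in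
  orthonormal_basis (tuple_lebesgue d) Y phi (L2span (tuple_lebesgue d) Y f) ->
  let W := kernel_operator (tuple_lebesgue d) Y w in
  let Wadj := L2adjoint (tuple_lebesgue d) Y (tuple_lebesgue l) U W in
  let Pv u : 'cV[R]_N := \col_j P j u in
  let e := unit_diag R N in
  let Omega := gram Y f phi in
  let A := (1%:M - e *m e^T) *m Omega in
  critical_point (control_space Y U T) (loss Y U T sigma h fI P) (a, b, w, mu)
  <->
  (forall j, ae_eq (tuple_lebesgue d) Y
     (Wadj (W (f j))) (Wadj (fun u => P j u - mu u))) /\
  exists (wk : 'I_K -> Rn R l -> R) (hw : Rn R l * Rn R d -> R),
    let wv u : 'cV[R]_K := \col_k wk k u in
    [/\ L2UY Y U hw,
        {ae (tuple_lebesgue l \x tuple_lebesgue d)%E, forall p, (U `*` Y) p ->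
           w p = \sum_(k < K) wk k p.1 * phi k p.2 + hw p},
        {ae tuple_lebesgue l, forall u, U u ->
           L2orth (tuple_lebesgue d) Y (L2span (tuple_lebesgue d) Y phi)
             (fun y => hw (u, y))},
        (forall k, L2 (tuple_lebesgue l) U (wk k)) /\
        {ae tuple_lebesgue l, forall u, U u ->
           A^T *m A *m wv u = A^T *m Pv u} &
        {ae tuple_lebesgue l, forall u, U u ->
           mu u = (Num.sqrt N%:R)^-1 *
             (((Pv u)^T *m e) ord0 ord0 - (e^T *m Omega *m wv u) ord0 ord0)}].
Proof.
move=> oY bY oU bU T0 N0 sigma_derivable dsigma_continuous [k k_lip] LfI LP _ dsigma_gt0
  indep hE xE f [Lphi ortho spanE] W Wadj Pv e Omega A.
have mY := measurable_open_row_set oY; have Yoo := tuple_lebesgue_lty mY bY.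
have mU := measurable_open_row_set oU; have Uoo := tuple_lebesgue_lty mU bU.
have {}k_lip x y : `|sigma x - sigma y| <= k * `|x - y| by exact: (k_lip (x, y)).
have msigma : measurable_fun setT sigma by exact: (sigma_measurable sigma_derivable).
have [La Lb Lw Lmu] := xE.
pose m := mfrestr mY Yoo; pose n := mfrestr mU Uoo.
pose rw := w \_ (U `*` Y); pose rphi i := phi i \_ Y.
have sw : sqint (n \x m)%E rw by exact/L2UYE.
have sphi i : sqint m (rphi i) by exact/L2E.
have rortho i j : \int[m]_y (rphi i y * rphi j y) = (i == j)%:R.
  by rewrite -ortho (L2dotE mY Yoo).
have vex j := solution_of_exists mY Yoo T0 k_lip msigma LfI j La Lb.
pose v j := sval (cid (vex j)).
have vs j : solution_of T mY Yoo sigma fI a b j (v j) by exact: (svalP (cid (vex j))).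
have ft j := forward_terminal T0 k_lip msigma LfI La Lb (vs j).
pose F := terminal_state Y T fI v.
have sF j : sqint m (F j) by exact: (sqint_terminal_state LfI vs).
pose r := terminal_residual U T mY Yoo fI P w mu v.
have sr j : sqint n (r j) by exact: (sqint_terminal_residual mU Uoo LfI LP xE vs).
have fF j : ae_eq m setT (f j \_ Y) (F j) by case: (ft j).
have Lf j : L2 (tuple_lebesgue d) Y (f j) by case: (ft j).
have cex j : exists c : 'I_K -> R,
    ae_eq (tuple_lebesgue d) Y (f j) (fun y => \sum_k c k * phi k y).
  by have := L2span_self Lf j; rewrite -spanE => -[].
pose c j := sval (cid (cex j)).
have cE j : ae_eq (tuple_lebesgue d) Y (f j) (fun y => \sum_k c j k * phi k y).
  exact: (svalP (cid (cex j))).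
have FE j : ae_eq m setT (F j) (fun y => \sum_k c j k * rphi k y).
  have /(ae_eq_restrict mY Yoo) := cE j; rewrite restrict_sum => h1.
  by apply: aeI h1 (fF j) => y /(_ I) <- /(_ I) <-.
(* The basis is orthonormal, so the entries of Omega are the coordinates of the terminal states. *)
have OmegaE j i : Omega j i = c j i.
  rewrite mxE (L2dotE mY Yoo)// -(expansion_coefficient sphi sF rortho FE).
  have /(L2E mY Yoo)[mf _] := Lf j; have [mF _] := sF j; have [mp _] := sphi i.
  apply: Rintegral_ae_eq; [exact: measurable_funM|exact: measurable_funM|].
  by apply: aeS (fF j) => y /(_ I) -> _.
(* The canonical coefficients of w(u, .); in these coordinates the residual at u is Omega x + mu -
   P. *)
pose x u i := integral_operator m rw (rphi i) u.
have rE : {ae n, forall u, U u /\ forall j, r j u =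
    (Omega *m (\col_i x u i) + const_mx (mu u) - Pv u) j ord0}.
  have inU : {ae n, forall u, U u} by apply/(ae_restrict mU Uoo); apply: aeW.
  apply: aeI inU (operator_expansion sphi sF FE sw) => u Uu opE; split=> // j.
  rewrite /r /terminal_residual /residual opE !mxE; congr (_ + _ - _).
  - by apply: eq_bigr => i _; rewrite !mxE -OmegaE mxE.
  - by rewrite /patch mem_set.
  - by rewrite /patch mem_set.
(* The finite-dimensional content of conditions 2 and 3 at u, as a predicate on the coefficients, in
   the shape needed by [orthogonal_decomposition_iff]. *)
pose G u z := A^T *m A *m (\col_i z i) = A^T *m Pv u /\
  mu u = (Num.sqrt N%:R)^-1 * (((Pv u)^T *m e) ord0 ord0 -
    (e^T *m Omega *m (\col_i z i)) ord0 ord0).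
have GE u : (forall j, r j u = (Omega *m (\col_i x u i) + const_mx (mu u) - Pv u) j ord0) ->
    (\sum_j r j u = 0 /\ forall i, \sum_j c j i * r j u = 0) <-> G u (x u).
  move=> ru; rewrite /G -(normal_equations N0 Omega _ (mu u) (Pv u)).
  under eq_bigr do rewrite ru; split=> -[s0 h0]; split=> //.
    apply/matrixP => i j; rewrite (ord1 j) [RHS]mxE -[RHS](h0 i) mxE.
    by apply: eq_bigr => j0 _; rewrite [_^T _ _]mxE OmegaE ru.
  move=> i; have /matrixP/(_ i ord0) := h0; rewrite [RHS]mxE => h1; apply: (etrans _ h1); rewrite mxE.
  by apply: eq_bigr => j0 _; rewrite [_^T _ _]mxE OmegaE ru.
have moments := moments_iff sphi sF rortho FE sr.
(* The two residual conditions hold if and only if the normal equations hold at almost every u: the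
   moments reduce the product space to U, and [normal_equations] acts pointwise. *)
have coreE : (ae_eq n setT (fun u => \sum_j r j u) (cst 0) /\
    ae_eq (n \x m)%E setT (fun p => \sum_j r j p.1 * F j p.2) (cst 0)) <->
    {ae n, forall u, G u (x u)}.
  split=> [[s0 /moments h0]|hG].
    apply: aeI rE (ae_and s0 h0) => u [_ ru] [/(_ I) su hu].
    by apply/(GE u ru); split.
  split; last apply/moments.
    by apply: aeI rE hG => u [_ ru] /(GE u ru)[].
  by apply: aeI rE hG => u [_ ru] /(GE u ru)[].
have qE j := adjoint_equation_iff mU Uoo Lw (Lf j) (sF j) (fF j) Lmu (LP j).
have decompE := orthogonal_decomposition_iff mY Yoo mU Uoo Lw Lphi ortho G.
rewrite (critical_point_iff mU Uoo T0 k_lip msigma hE LfI LP xE vs N0 sigma_derivable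
  dsigma_continuous dsigma_gt0 indep).
split=> [[q0 s0 h0]|[q0 [wk [hw [Lhw wE orth [Lwk nE] muE]]]]].
  split; first by move=> j; apply/(qE j); exact: q0.
  have /decompE[wk [hw [Lhw wE orth Lwk hG]]] : {ae n, forall u, G u (x u)} by apply/coreE.
  exists wk, hw; split=> //; first split=> //.
  - by apply: aeS hG => u h1 /h1[].
  - by apply: aeS hG => u h1 /h1[].
have /coreE[s0 h0] : {ae n, forall u, G u (x u)}.
  apply/decompE; exists wk, hw; split=> //.
  by apply: aeI nE muE => u h1 h2 Uu; split; [exact: h1|exact: h2].
by split=> // j; apply/(qE j); exact: q0.
Qed.
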